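(* Let $n\ge 3$ and $\mu>0$. For $\rho>0$ define $$G_{-\mu\mathrm{i}}(\rho)=A_{n,-\mu\mathrm{i}}\,\frac{(\cosh\rho)^{\frac{n-3}{2}+\mu\mathrm{i}}}{(\sinh\rho)^{n-2}}\int_0^\pi\Bigl(1+\frac{\cos t}{\cosh\rho}\Bigr)^{\frac{n-3}{2}+\mu\mathrm{i}}(\sin t)^{-2\mu\mathrm{i}}\,dt,$$ $$G_{\mu\mathrm{i}}(\rho)=A_{n,\mu\mathrm{i}}\,\frac{(\cosh\rho)^{\frac{n-3}{2}-\mu\mathrm{i}}}{(\sinh\rho)^{n-2}}\int_0^\pi\Bigl(1+\frac{\cos t}{\cosh\rho}\Bigr)^{\frac{n-3}{2}-\mu\mathrm{i}}(\sin t)^{2\mu\mathrm{i}}\,dt.$$ Then $x\mapsto G_{-\mu\mathrm{i}}(\rho(x))$ satisfies $$\Bigl(-\Delta_{\mathbb{B}^n}-\frac{(n-1)^2}{4}-\mu^2\Bigr)G_{-\mu\mathrm{i}}(\rho(x))=\delta_0(x),\qquad x\in\mathbb{B}^n,$$ in the sense of distributions, and $G_{-\mu\mathrm{i}}(\rho(x))=O\bigl(\sinh^{-\frac{n-1}{2}}\rho(x)\bigr)$ as $\rho(x)\to\infty$. Moreover, for every $x\in\mathbb{B}^n$, as distributions in $y\in\mathbb{B}^n$, $$(-\Delta_{\mathbb{B}^n})_y\,G_{-\mu\mathrm{i}}(\rho(x,y))-\frac{(n-1)^2}{4}G_{-\mu\mathrm{i}}(\rho(x,y))-\mu^2G_{-\mu\mathrm{i}}(\rho(x,y))=\delta_x(y),$$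 $$(-\Delta_{\mathbb{B}^n})_y\,G_{\mu\mathrm{i}}(\rho(x,y))-\frac{(n-1)^2}{4}G_{\mu\mathrm{i}}(\rho(x,y))-\mu^2G_{\mu\mathrm{i}}(\rho(x,y))=\delta_x(y),$$ and, for fixed $x$, both functions satisfy $G_{\pm\mu\mathrm{i}}(\rho(x,y))=O\bigl(\sinh^{-\frac{n-1}{2}}\rho(y)\bigr)$ as $\rho(y)\to\infty$.
   Context: $\mathbb{B}^n=\{x\in\mathbb{R}^n:|x|<1\}$ is the Poincaré ball model of hyperbolic space, with metric $g=\bigl(\tfrac{2}{1-|x|^2}\bigr)^2g_e$ ($g_e$ Euclidean), volume element $dV_{\mathbb{B}^n}=\bigl(\tfrac{2}{1-|x|^2}\bigr)^n dx$ and Laplace–Beltrami operator $\Delta_{\mathbb{B}^n}=\frac{1-|x|^2}{4}\bigl((1-|x|^2)\Delta_{\mathbb{R}^n}+2(n-2)\sum_i x_i\partial_{x_i}\bigr)$. $\rho(x,y)$ is the geodesic distance and $\rho(x)=\rho(x,0)=\log\frac{1+|x|}{1-|x|}$. For complex $z$ with $\Re z>-\tfrac12$, $A_{n,z}=(2\pi)^{-n/2}\dfrac{\Gamma(\frac{n-1}{2}+z)}{2^{z+1/2}\,\Gamma(z+\frac12)}$. Complex powers of positive reals are $a^w=e^{w\log a}$, and $\mathrm{i}=\sqrt{-1}$. The equation $(-\Delta_{\mathbb{B}^n}-\frac{(n-1)^2}{4}-\mu^2)F=\delta_x$ means that for all $\phi\in C_c^\infty(\mathbb{B}^n)$, $\int_{\mathbb{B}^n}F(y)\bigl(-\Delta_{\mathbb{B}^n}\phi-\frac{(n-1)^2}{4}\phi-\mu^2\phi\bigr)(y)\,dV_{\mathbb{B}^n}(y)=\phi(x)$.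 *)

(* Defs.v *)
From HB Require Import structures.
From mathcomp Require Import all_boot all_order all_algebra.
From mathcomp Require Import all_classical all_reals all_analysis.
From mathcomp Require Export complex.

Set Implicit Arguments.
Unset Strict Implicit.
Unset Printing Implicit Defensive.

Import Order.TTheory GRing.Theory Num.Theory.
Import numFieldNormedType.Exports.

Local Open Scope classical_set_scope.
Local Open Scope ring_scope.
Local Open Scope complex_scope.

Section lebesgue_measure_on_tuples.
Context {R : realType}.

Definition cons_pair (n : nat)
    (p : measurableTypeR R * n.-tuple (measurableTypeR R)) :
    n.+1.-tuple (measurableTypeR R) :=
  [the n.+1.-tuple _ of p.1 :: p.2].

Lemma measurable_cons_pair (n : nat) :
  measurable_fun [set: measurableTypeR R * n.-tuple (measurableTypeR R)]
    (@cons_pair n).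
Proof.
apply: (@measurable_cons _ _ _ _ fst n snd);
  [exact: measurable_fst | exact: measurable_snd].
Qed.

Section step.
Context (n : nat).
Context (m : {sigma_finite_measure set (n.-tuple (measurableTypeR R)) -> \bar R}).

Definition cons_measure : set (n.+1.-tuple (measurableTypeR R)) -> \bar R :=
  pushforward (lebesgue_measure \x m)%E (@cons_pair n).

Let cons_measure0 : cons_measure set0 = 0%E.
Proof. by rewrite /cons_measure /pushforward preimage_set0 measure0. Qed.

Let cons_measure_ge0 A : (0 <= cons_measure A)%E.
Proof. exact: (@measure_ge0 _ _ _ (lebesgue_measure \x m)%E). Qed.

Let cons_measure_sigma_additive : semi_sigma_additive cons_measure.
Proof.
have mf := @measurable_cons_pair n.
exact: (@measure_semi_sigma_additive _ _ _
  (measure_function_pushforward__canonical__measure_function_Measure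
     (lebesgue_measure \x m)%E mf)).
Qed.

HB.instance Definition _ := isMeasure.Build _ _ _ cons_measure
  cons_measure0 cons_measure_ge0 cons_measure_sigma_additive.

Let cons_measure_sigma_finite : sigma_finite setT cons_measure.
Proof.
have /sigma_finiteP[F [TF ndF Foo]] := sigma_finiteT (@lebesgue_measure R).
have /sigma_finiteP[G [TG ndG Goo]] := sigma_finiteT m.
pose g (t : n.+1.-tuple (measurableTypeR R)) :=
  (tnth t ord0, [tuple of behead t]).
have mg : measurable_fun setT g.
  apply/measurable_fun_pairP; split; first exact: measurable_tnth.
  exact: measurable_behead.
have gK (p : measurableTypeR R * n.-tuple (measurableTypeR R)) :
    g (cons_pair p) = p.
  by case: p => a t; rewrite /g /cons_pair /=; congr (_, _); apply: val_inj.
exists (fun i => g @^-1` (F i `*` G i)).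
  rewrite -preimage_bigcup (_ : \bigcup_i _ = setT) ?preimage_setT//.
  rewrite -setXTT TF TG predeqE => -[x y]; split.
    by move=> [i _ []/= ? ?]; split; exists i.
  move=> [/= [i _ Fx] [k _ Gy]]; exists (maxn i k) => //; split.
  - by move: x Fx; exact/subsetPset/ndF/leq_maxl.
  - by move: y Gy; exact/subsetPset/ndG/leq_maxr.
move=> i; have [mF Fi] := Foo i; have [mG Gi] := Goo i; split.
  by rewrite -[X in measurable X]setTI; apply: mg => //; exact: measurableX.
rewrite /cons_measure /pushforward.
have -> : @cons_pair n @^-1` (g @^-1` (F i `*` G i)) = F i `*` G i.
  by apply/seteqP; split => p; rewrite /preimage /mkset gK.
by rewrite product_measure1E// lte_mul_pinfty// ge0_fin_numE.
Qed.

HB.instance Definition _ := @Measure_isSigmaFinite.Build _ _ _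
  cons_measure cons_measure_sigma_finite.

End step.

(* Lebesgue measure on R^n, carried by the library's product sigma-algebra on
   n-tuples, as the n-fold product of the one-dimensional Lebesgue measure. *)
Fixpoint lebesgue_tuple (n : nat) :
    {sigma_finite_measure set (n.-tuple (measurableTypeR R)) -> \bar R} :=
  match n with
  | 0 => \d_ [tuple]
  | n'.+1 => cons_measure (lebesgue_tuple n')
  end.

End lebesgue_measure_on_tuples.

Section complex_valued.
Context {R : realType}.
Implicit Types (z w : R[i]) (a : R).

Definition cexp z : R[i] :=
  (expR (complex.Re z))%:C * (cos (complex.Im z) +i* sin (complex.Im z)).

(* Meant for a > 0; ln a = 0 for a <= 0. *)
Definition cpow a w : R[i] := cexp (w * (ln a)%:C).

Definition cintegrable d (T : measurableType d)
    (m : {measure set T -> \bar R}) (D : set T) (f : T -> R[i]) : Prop :=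
  m.-integrable D (fun t => (complex.Re (f t))%:E) /\
  m.-integrable D (fun t => (complex.Im (f t))%:E).

Definition cintegral d (T : measurableType d)
    (m : {measure set T -> \bar R}) (D : set T) (f : T -> R[i]) : R[i] :=
  (\int[m]_(t in D) complex.Re (f t)) +i* (\int[m]_(t in D) complex.Im (f t)).

(* Euler's integral, which converges for Re z > 0. *)
Definition cGamma z : R[i] :=
  cintegral lebesgue_measure `]0%R, +oo[
    (fun t : measurableTypeR R => cpow t (z - 1) * (expR (- t))%:C).

(* For n >= 2 and Re z > - 1/2 both Gamma arguments have positive real part. *)
Definition Acoef (n : nat) z : R[i] :=
  ((2 * pi) `^ (- (n%:R / 2)))%:C *
  (cGamma (((n%:R - 1) / 2)%:C + z) /
   (cpow 2 (z + (2^-1)%:C) * cGamma (z + (2^-1)%:C))).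

Definition cosh a : R := (expR a + expR (- a)) / 2.
Definition sinh a : R := (expR a - expR (- a)) / 2.

(* The kernel G_z; G_{-mu i} and G_{mu i} are its values at z = -mu i and
   z = mu i. *)
Definition green (n : nat) z (r : R) : R[i] :=
  Acoef n z *
  (cpow (cosh r) (((n%:R - 3) / 2)%:C - z) / (sinh r ^+ (n - 2))%:C) *
  cintegral lebesgue_measure `[0%R, pi]
    (fun t : measurableTypeR R =>
       cpow (1 + cos t / cosh r) (((n%:R - 3) / 2)%:C - z) *
       cpow (sin t) (2 * z)).

End complex_valued.

Section ball_model.
Context {R : realType} {n : nat}.
Implicit Types (x y : 'rV[R]_n).

(* The library norm on 'rV[R]_n is the sup norm. *)
Definition enorm x : R := Num.sqrt (\sum_(i < n) x ord0 i ^+ 2).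

Definition uball : set 'rV[R]_n := [set x | enorm x < 1].

Definition C1_curve (c : R -> 'rV[R]_n) x y : Prop :=
  [/\ forall t, derivable c t 1, continuous (derive1 c),
      forall t, 0 <= t <= 1 -> uball (c t), c 0 = x & c 1 = y].

Definition hlength (c : R -> 'rV[R]_n) : R :=
  \int[lebesgue_measure]_(t in `[0, 1])
    (2 / (1 - enorm (c t) ^+ 2) * enorm (derive1 c t)).

Definition hdist x y : R :=
  inf [set l | exists2 c, C1_curve c x y & l = hlength c].

Definition partial (i : 'I_n) (f : 'rV[R]_n -> R) : 'rV[R]_n -> R :=
  fun x => 'D_(delta_mx ord0 i) f x.

Definition smooth (f : 'rV[R]_n -> R) : Prop :=
  forall (s : seq 'I_n) x, differentiable (foldr partial f s) x.

(* An element of C_c^oo of the ball is represented by its extension by 0 to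
   R^n. *)
Definition test_fun (phi : 'rV[R]_n -> R[i]) : Prop :=
  [/\ smooth (fun x => complex.Re (phi x)),
      smooth (fun x => complex.Im (phi x)) &
      exists K : set 'rV[R]_n,
        [/\ compact K, K `<=` uball & forall x, ~ K x -> phi x = 0]].

Definition laplaceB (f : 'rV[R]_n -> R) x : R :=
  (1 - enorm x ^+ 2) / 4 *
  ((1 - enorm x ^+ 2) * (\sum_(i < n) partial i (partial i f) x) +
   2 * (n%:R - 2) * \sum_(i < n) x ord0 i * partial i f x).

Definition claplaceB (phi : 'rV[R]_n -> R[i]) x : R[i] :=
  laplaceB (fun y => complex.Re (phi y)) x +i*
  laplaceB (fun y => complex.Im (phi y)) x.

Definition helmholtz (mu : R) (phi : 'rV[R]_n -> R[i]) x : R[i] :=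
  - claplaceB phi x - ((n%:R - 1) ^+ 2 / 4)%:C * phi x - (mu ^+ 2)%:C * phi x.

Definition row_of (t : n.-tuple (measurableTypeR R)) : 'rV[R]_n :=
  \row_(i < n) tnth t i.

Definition dV x : R := (2 / (1 - enorm x ^+ 2)) ^+ n.

(* The distributional equation (- Delta - (n-1)^2/4 - mu^2) F = delta_x on the
   ball. *)
Definition solves_delta (mu : R) x (F : 'rV[R]_n -> R[i]) : Prop :=
  forall phi, test_fun phi ->
    let f t := F (row_of t) * helmholtz mu phi (row_of t) *
               (dV (row_of t))%:C in
    cintegrable (lebesgue_tuple n) (row_of @^-1` uball) f /\
    cintegral (lebesgue_tuple n) (row_of @^-1` uball) f = phi x.

(* F(y) = O((sinh rho(y))^(-(n-1)/2)) as rho(y) -> oo, rho(y) = rho(y, 0). *)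
Definition sinh_decay (F : 'rV[R]_n -> R[i]) : Prop :=
  exists C M : R, forall y, uball y -> M <= hdist y 0 ->
    ComplexField.Normc.normc (F y) <=
    C * sinh (hdist y 0) `^ (- ((n%:R - 1) / 2)).

End ball_model.

(* Main.v *)
(** Write s = cosh rho(x, y) - 1 = 2 |x - y|^2 / ((1 - |x|^2) (1 - |y|^2)) and
    m = (n - 2) / 2.  For a radial kernel h(s) the Helmholtz equation off the
    pole is the ODE s (s + 2) h'' + n (1 + s) h' + ((n - 1)^2 / 4 + mu^2) h = 0.
    Replacing h(s) by the smooth function h(s + e) and integrating by parts on
    R^n, the right-hand side becomes phi e ((2 s + e + 2) h'' + n h')(s + e).
    If s^m h(s) tends to k as s -> 0, and its derivatives behave accordingly,
    this is phi times e (a |x - y|^2 + e)^-(n/2 + 1), with a = 2 / (1 - |x|^2)^2,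
    up to a bounded factor that is continuous at (x, 0).  These functions have an
    integral independent of e and concentrate at x as e -> 0, so the limit is a
    multiple of k phi(x).

    For the kernel G_z, h is (s (s + 2))^-m J(1 + s) up to a constant, where
    J(u) is the integral over (0, pi) of (u + cos t)^b (sin t)^(2 z) and
    b = (n - 3) / 2 - z.  The ODE for J comes from integrating the t-derivative
    of (u + cos t)^(b - 1) (sin t)^(2 z + 1), and J(1) is a beta integral, so that
    A_(n,z) is exactly the constant that gives the mass 1; this uses that Gamma
    does not vanish on the line Re z = 1/2. *)

From mathcomp Require Import all_boot all_order all_algebra.
From mathcomp Require Import all_classical all_reals all_analysis.
From mathcomp Require Import measurable_realfun.
From mathcomp Require Import complex ring lra.
Require Import Defs.

Set Implicit Arguments.
Unset Strict Implicit.
Unset Printing Implicit Defensive.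

Import Order.TTheory GRing.Theory Num.Theory.
Import numFieldNormedType.Exports.

Local Open Scope classical_set_scope.
Local Open Scope ring_scope.

(** * Derivatives of explicit functions of one real variable *)

Section real_calculus.
Context {R : realType}.
Implicit Types (f g : R -> R) (x df dg c : R).

(** The pole forbids integrating by parts against the kernel itself. After the shift by e the kernel
    is smooth on the whole ball and the ODE holds at s + e, so the error comes only from the
    coefficients s (s + 2) and n (1 + s) being taken at s instead of s + e; this is the source of
    the factor e.

    Polar coordinates on R^n are avoided: a negative power of a |x - y|^2 + e is a Gamma mixture of
    Gaussians, whose integrals factor over the coordinates. The same device gives the integrable
    majorant of the kernel near its pole.

    All analysis is done on real integrals. With [osc c1 c2] the real part of (c1 - i c2) e^(i x),
    the real and imaginary parts of A J are one and the same integral with coefficients (Re A, - Im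
    A) and (Im A, Re A). The first profile must have the residue of mass 1, the second residue 0.
    Gamma and beta identities carry a phase for the same reason. Imaginary exponents have modulus 1
    and do not affect size estimates.

    The distance is an infimum over curves, so the formula for its cosh needs a length estimate for
    every curve and an explicit geodesic. *)

Lemma is_derive_continuous f x df : is_derive x 1 f df -> {for x, continuous f}.
Proof.
move=> [fx _]; apply: differentiable_continuous; exact/derivable1_diffP.
Qed.

Lemma is_derive1_cstf c x : is_derive x 1 (fun=> c) 0.
Proof. exact: is_derive_cst. Qed.

Lemma is_derive1_idf x : is_derive x 1 (fun y => y) 1.
Proof. exact: is_derive_id. Qed.

Lemma is_derive1Df f g x df dg : is_derive x 1 f df -> is_derive x 1 g dg ->
  is_derive x 1 (fun y => f y + g y) (df + dg).
Proof. exact: is_deriveD. Qed.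

Lemma is_derive1Nf f x df : is_derive x 1 f df -> is_derive x 1 (fun y => - f y) (- df).
Proof. exact: is_deriveN. Qed.

Lemma is_derive1Mf f g x df dg : is_derive x 1 f df -> is_derive x 1 g dg ->
  is_derive x 1 (fun y => f y * g y) (df * g x + f x * dg).
Proof.
move=> d1 d2; apply: (@is_derive_eq _ _ _ _ _ _ _ _ (is_deriveM d1 d2)).
by rewrite /GRing.scale/=; ring.
Qed.

Lemma is_derive1Xf n f x df : is_derive x 1 f df ->
  is_derive x 1 (fun y => f y ^+ n) (n%:R * f x ^+ n.-1 * df).
Proof.
move=> d; have := is_deriveX n d.
by rewrite (_ : f ^+ n = fun y => f y ^+ n)//; apply/funext => y; rewrite fctE.
Qed.

Lemma is_derive1Vf f x df : f x != 0 -> is_derive x 1 f df ->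
  is_derive x 1 (fun y => (f y)^-1) (- df / f x ^+ 2).
Proof.
move=> f0 d; apply: is_derive_eq (is_deriveV f0 d) _.
by rewrite /GRing.scale/= mulNr mulrC -mulNr; congr (_ * _); rewrite mulNr mulrC.
Qed.

Lemma is_derive1_compf f g x df dg : is_derive (g x) 1 f df -> is_derive x 1 g dg ->
  is_derive x 1 (fun y => f (g y)) (df * dg).
Proof. by move=> d1 d2; exact: is_derive1_comp. Qed.

Lemma is_derive1_expRf f x df : is_derive x 1 f df ->
  is_derive x 1 (fun y => expR (f y)) (expR (f x) * df).
Proof. by move=> d; exact: is_derive1_compf. Qed.

Lemma is_derive1_cosf f x df : is_derive x 1 f df ->
  is_derive x 1 (fun y => cos (f y)) (- sin (f x) * df).
Proof. by move=> d; exact: is_derive1_compf. Qed.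

Lemma is_derive1_sinf f x df : is_derive x 1 f df ->
  is_derive x 1 (fun y => sin (f y)) (cos (f x) * df).
Proof. by move=> d; exact: is_derive1_compf. Qed.

Lemma is_derive1_lnf f x df : 0 < f x -> is_derive x 1 f df ->
  is_derive x 1 (fun y => ln (f y)) ((f x)^-1 * df).
Proof. by move=> f0 d; apply: is_derive1_compf => //; exact: is_derive1_ln. Qed.

Lemma is_derive1_powRf p f x df : 0 < f x -> is_derive x 1 f df ->
  is_derive x 1 (fun y => f y `^ p) (p * f x `^ (p - 1) * df).
Proof.
by move=> f0 d; apply: (is_derive1_compf (f := fun y => y `^ p)) => //; exact: is_derive1_powR.
Qed.

Lemma is_derive1_sqrtf f x df : 0 < f x -> is_derive x 1 f df ->
  is_derive x 1 (fun y => Num.sqrt (f y)) ((2 * Num.sqrt (f x))^-1 * df).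
Proof.
by move=> f0 d; apply: (is_derive1_compf (f := @Num.sqrt R)) => //; exact: is_derive1_sqrt.
Qed.

Lemma powRDp c p q : 0 < c -> c `^ (p + q) = c `^ p * c `^ q.
Proof. by move=> c0; apply: powRD; apply/implyP => _; rewrite gt_eqF. Qed.

Lemma ler_powR_base p c d : 0 <= p -> 0 <= c -> c <= d -> c `^ p <= d `^ p.
Proof.
move=> p0 c0 cd; apply: ge0_ler_powR => //; rewrite nnegrE//.
exact: le_trans cd.
Qed.

End real_calculus.

(* Differentiates an explicit function of one real variable, leaving the side
   conditions of inverses, logarithms, powers and roots. *)
Ltac derive_expr :=
  lazymatch goal with
  | |- is_derive _ _ _ _ =>
    first [ eassumption
    | eapply is_derive1_cstf | eapply is_derive1_idf
    | eapply is_derive1Df; derive_expr | eapply is_derive1Nf; derive_expr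
    | eapply is_derive1Mf; derive_expr | eapply is_derive1Xf; derive_expr
    | eapply is_derive1Vf; [|derive_expr] | eapply is_derive1_expRf; derive_expr
    | eapply is_derive1_cosf; derive_expr | eapply is_derive1_sinf; derive_expr
    | eapply is_derive1_lnf; [|derive_expr] | eapply is_derive1_powRf; [|derive_expr]
    | eapply is_derive1_sqrtf; [|derive_expr] | idtac ]
  end.
Ltac derive_tac := eapply is_derive_eq; [derive_expr|rewrite /=].
Ltac continuous_tac := eapply is_derive_continuous; derive_expr.

(** * Integrability of real-valued functions *)

Section integrable_EFin.
Context d (T : measurableType d) (R : realType) (m : {measure set T -> \bar R}).
Context (D : set T) (mD : measurable D).
Implicit Types f g : T -> R.

Lemma integrable_EFinD f g : m.-integrable D (fun x => (f x)%:E) ->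
  m.-integrable D (fun x => (g x)%:E) -> m.-integrable D (fun x => (f x + g x)%:E).
Proof. exact: integrableD. Qed.

Lemma integrable_EFinB f g : m.-integrable D (fun x => (f x)%:E) ->
  m.-integrable D (fun x => (g x)%:E) -> m.-integrable D (fun x => (f x - g x)%:E).
Proof. exact: integrableB. Qed.

Lemma integrable_EFinZ c f : m.-integrable D (fun x => (f x)%:E) ->
  m.-integrable D (fun x => (c * f x)%:E).
Proof. exact: integrableZl. Qed.

Lemma integrable_EFin_le f g : measurable_fun D f ->
  (forall x, D x -> `|f x| <= g x) ->
  m.-integrable D (fun x => (g x)%:E) -> m.-integrable D (fun x => (f x)%:E).
Proof.
move=> mf fg; apply: le_integrable => //; first exact/measurable_EFinP.
by move=> x Dx; rewrite lee_fin (le_trans (fg _ Dx))// ler_norm.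
Qed.

Lemma fine_integral f : m.-integrable D (fun x => (f x)%:E) ->
  (\int[m]_(x in D) (f x)%:E = (\int[m]_(x in D) f x)%:E)%E.
Proof. by move=> fi; rewrite fineK//; exact: integrable_fin_num. Qed.

End integrable_EFin.

(* Stated for an abstract domain: on row vectors the neighbourhood filter
   unfolds too eagerly for the library's limit lemmas to apply. *)
Section continuity_at_point.
Context {R : realType} {T : topologicalType}.
Implicit Types (f g : T -> R) (t : T).

Lemma ctp_cst (c : R) t : {for t, continuous (fun=> c)}.
Proof. exact: cvg_cst. Qed.

Lemma ctpD f g t : {for t, continuous f} -> {for t, continuous g} ->
  {for t, continuous (fun s => f s + g s)}.
Proof. exact: cvgD. Qed.

Lemma ctpN f t : {for t, continuous f} -> {for t, continuous (fun s => - f s)}.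
Proof. exact: cvgN. Qed.

Lemma ctpB f g t : {for t, continuous f} -> {for t, continuous g} ->
  {for t, continuous (fun s => f s - g s)}.
Proof. exact: cvgB. Qed.

Lemma ctpM f g t : {for t, continuous f} -> {for t, continuous g} ->
  {for t, continuous (fun s => f s * g s)}.
Proof. exact: cvgM. Qed.

Lemma ctpV f t : f t != 0 -> {for t, continuous f} -> {for t, continuous (fun s => (f s)^-1)}.
Proof. exact: cvgV. Qed.

Lemma ctpX f n t : {for t, continuous f} -> {for t, continuous (fun s => f s ^+ n)}.
Proof.
move=> cf; elim: n => [|n IHn]; first exact: ctp_cst.
have -> : (fun s => f s ^+ n.+1) = (fun s => f s * f s ^+ n).
  by apply/funext => s; rewrite exprS.
exact: ctpM.
Qed.

Lemma ctp_comp (h : R -> R) f t : {for t, continuous f} -> {for f t, continuous h} ->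
  {for t, continuous (fun s => h (f s))}.
Proof. by move=> cf ch; exact: (cvg_comp f h cf ch). Qed.

Lemma ctp_sum k (h : 'I_k -> T -> R) t : (forall i, {for t, continuous (h i)}) ->
  {for t, continuous (fun s => \sum_(i < k) h i s)}.
Proof.
move=> ch; rewrite /prop_for /continuous_at; elim: (index_enum _) => [|i r IHr].
  by rewrite big_nil; under eq_fun do rewrite big_nil; exact: cvg_cst.
rewrite big_cons; under eq_fun do rewrite big_cons.
by apply: cvgD => //; exact: ch.
Qed.

Lemma near_ctp f g t : (\forall s \near t, f s = g s) -> {for t, continuous f} ->
  {for t, continuous g}.
Proof.
move=> fg cf; rewrite /prop_for /continuous_at -(nbhs_singleton fg).
by apply: cvg_trans cf; apply: near_eq_cvg; apply: filterS fg => s ->.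
Qed.

End continuity_at_point.

(** * Lebesgue measure on tuples *)

Section tuple_integral.
Context {R : realType}.
Local Notation mT := (measurableTypeR R).
Local Notation mu := (@lebesgue_measure R).
Local Notation lam := (@lebesgue_tuple R).

Lemma ge0_integral_lebesgue_tupleS n (f : n.+1.-tuple mT -> \bar R) :
  measurable_fun [set: n.+1.-tuple mT] f -> (forall t, 0 <= f t)%E ->
  (\int[lam n.+1]_t f t = \int[mu]_a \int[lam n]_t f (cons_pair (a, t)))%E.
Proof.
move=> mf f0; have mc := @measurable_cons_pair R n; rewrite /= /cons_measure.
rewrite ge0_integral_pushforward//= preimage_setT fubini_tonelli1//=.
exact: (measurableT_comp mf).
Qed.

Lemma integrable_cons_pair n (f : n.+1.-tuple mT -> \bar R) :
  (lam n.+1).-integrable setT f ->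
  (mu \x lam n)%E.-integrable setT (f \o @cons_pair R n).
Proof.
move=> intf; have mc := @measurable_cons_pair R n.
have mf : measurable_fun [set: n.+1.-tuple mT] f by exact: measurable_int intf.
apply/integrableP; split; first exact: (measurableT_comp mf).
move/integrableP : intf => [_]; rewrite /= /cons_measure.
rewrite ge0_integral_pushforward//= ?preimage_setT//.
exact: measurableT_comp.
Qed.

Lemma integral_cons_pair n (f : n.+1.-tuple mT -> \bar R) :
  (lam n.+1).-integrable setT f ->
  (\int[lam n.+1]_t f t = \int[mu \x lam n]_p f (cons_pair p))%E.
Proof.
move=> intf; have mc := @measurable_cons_pair R n.
have mf : measurable_fun [set: n.+1.-tuple mT] f by exact: measurable_int intf.
rewrite /= /cons_measure integral_pushforward//= ?preimage_setT//.
exact: integrable_cons_pair.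
Qed.

Lemma measurable_tupleM n (f : 'I_n -> R -> R) :
  (forall i, measurable_fun setT (f i)) ->
  measurable_fun setT (fun t : n.-tuple mT => \prod_(i < n) f i (tnth t i)).
Proof.
move=> mf; apply: measurable_prod => i _.
by apply: (measurableT_comp (mf i)); exact: measurable_tnth.
Qed.

Lemma tnth_cons_pair n (p : mT * n.-tuple mT) i :
  tnth (cons_pair p) (lift ord0 i) = tnth p.2 i.
Proof. by rewrite !(tnth_nth 0). Qed.

Lemma integral_tupleM n (f : 'I_n -> R -> R) :
  (forall i, measurable_fun setT (f i)) -> (forall i x, 0 <= f i x) ->
  (\int[lam n]_t (\prod_(i < n) f i (tnth t i))%:E =
   \prod_(i < n) \int[mu]_x (f i x)%:E)%E.
Proof.
elim: n f => [|n IHn] f mf f0.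
  rewrite /= big_ord0.
  under eq_integral do rewrite big_ord0.
  by rewrite integral_cst//= mul1e diracE in_setT.
have mf' : measurable_fun setT (fun t : n.+1.-tuple mT =>
  (\prod_(i < n.+1) f i (tnth t i))%:E) by apply/measurable_EFinP; exact: measurable_tupleM.
have p0 (t : n.+1.-tuple mT) : (0 <= (\prod_(i < n.+1) f i (tnth t i))%:E)%E.
  by rewrite lee_fin prodr_ge0.
rewrite (ge0_integral_lebesgue_tupleS mf' p0).
rewrite big_ord_recl -(IHn (fun i => f (lift ord0 i)))//.
rewrite -ge0_integralZr//=; last 3 first.
- by apply/measurable_EFinP; exact: mf.
- by move=> x _; rewrite lee_fin.
- by apply: integral_ge0 => t _; rewrite lee_fin prodr_ge0.
apply: eq_integral => a _.
rewrite -ge0_integralZl//=; last 3 first.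
- apply/measurable_EFinP.
  exact: (measurable_tupleM (f := fun i => f (lift ord0 i))).
- by move=> t _; rewrite lee_fin prodr_ge0.
- by rewrite lee_fin.
apply: eq_integral => t _; rewrite big_ord_recl EFinM; congr (_%:E * _%:E)%E.
by apply: eq_bigr => i _; rewrite tnth_cons_pair.
Qed.

Lemma integrable_tupleM n (f : 'I_n -> R -> R) :
  (forall i, measurable_fun setT (f i)) -> (forall i x, 0 <= f i x) ->
  (forall i, \int[mu]_x (f i x)%:E < +oo)%E ->
  (lam n).-integrable setT (fun t => (\prod_(i < n) f i (tnth t i))%:E).
Proof.
move=> mf f0 foo; apply/integrableP; split.
  apply/measurable_EFinP; exact: measurable_tupleM.
under eq_integral do rewrite gee0_abs ?lee_fin ?prodr_ge0//.
rewrite integral_tupleM//.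
have fE i : (\int[mu]_x (f i x)%:E)%E = (fine (\int[mu]_x (f i x)%:E)%E)%:E.
  rewrite fineK// ge0_fin_numE ?foo//.
  by apply: integral_ge0 => x _; rewrite lee_fin.
under eq_bigr do rewrite fE.
by rewrite prodEFin ltry.
Qed.

Definition tuple_upd n (t : n.-tuple mT) (i : 'I_n) (s : R) : n.-tuple mT :=
  [tuple if j == i then s else tnth t j | j < n].

Lemma tuple_upd_cons0 n a (t : n.-tuple mT) s :
  tuple_upd (cons_pair (a, t)) ord0 s = cons_pair (s, t).
Proof.
apply: eq_from_tnth => i; rewrite tnth_mktuple.
by case: (unliftP ord0 i) => [j|] ->; rewrite ?tnth_cons_pair// eqxx tnth0.
Qed.

Lemma tuple_upd_consS n a (t : n.-tuple mT) i s :
  tuple_upd (cons_pair (a, t)) (lift ord0 i) s = cons_pair (a, tuple_upd t i s).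
Proof.
apply: eq_from_tnth => k; rewrite tnth_mktuple.
case: (unliftP ord0 k) => [j|] ->.
  by rewrite !tnth_cons_pair tnth_mktuple (inj_eq lift_inj).
by rewrite -[_ == _]negbK neq_lift/= !tnth0.
Qed.

(** The product bound makes g integrable, so Fubini allows coordinate i to be integrated innermost.
    If i is not the first coordinate, the first one is frozen at a and the induction hypothesis
    applies with the bound M w(a); if it is, the order of integration is exchanged. *)
Lemma integral_tuple_slice0 n (g : n.-tuple mT -> R) (w : R -> R) (M : R) (i : 'I_n) :
  measurable_fun [set: n.-tuple mT] g ->
  measurable_fun setT w -> (forall x, 0 <= w x) -> (\int[mu]_x (w x)%:E < +oo)%E ->
  (forall t, `|g t| <= M * \prod_(j < n) w (tnth t j)) ->
  (forall t, \int[mu]_s (g (tuple_upd t i s))%:E = 0)%E ->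
  (\int[lam n]_t (g t)%:E = 0)%E.
Proof.
move=> + mw w0 woo.
elim: n g M i => [|n IHn] g M i mg gM g0; first by case: i g0.
have intg : (lam n.+1).-integrable setT (fun t => (g t)%:E).
  apply: (le_integrable (mu := lam n.+1) measurableT
    (g := fun t => (M%:E * (\prod_(j < n.+1) w (tnth t j))%:E)%E)) => //.
  - exact/measurable_EFinP.
  - by move=> t _ /=; rewrite lee_fin (le_trans (gM t))// ler_norm.
  - by apply: integrableZl => //; exact: (@integrable_tupleM _ (fun=> w)).
rewrite (integral_cons_pair intg).
have intg' := integrable_cons_pair intg.
case: (unliftP ord0 i) g0 => [j|] -> g0.
  rewrite -(integral12_prod_meas1 intg') integral0_eq// => a _.
  apply: (IHn (fun t => g (cons_pair (a, t))) (M * w a) j).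
  - apply: (measurableT_comp mg); apply: (measurableT_comp (@measurable_cons_pair R n)).
    exact: measurable_pair1.
  - move=> t; rewrite (le_trans (gM _))// big_ord_recl tnth0 mulrA.
    by rewrite le_eqVlt; apply/orP; left; apply/eqP; congr (_ * _);
      apply: eq_bigr => k _; rewrite tnth_cons_pair.
  - by move=> t; rewrite -[RHS](g0 (cons_pair (a, t)));
      apply: eq_integral => s _; rewrite tuple_upd_consS.
rewrite -(integral21_prod_meas1 intg') integral0_eq// => t _.
rewrite /fubini_G/= -[RHS](g0 (cons_pair (0, t))).
by apply: eq_integral => s _; rewrite tuple_upd_cons0.
Qed.

End tuple_integral.

(** * Measurability of continuous functions of a row vector *)

Section measurable_row.
Context {R : realType}.
Local Notation mT := (measurableTypeR R).

Lemma measurable_inv : measurable_fun [set: R] (fun x => x^-1).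
Proof.
(* This form is measurable through [powR] and holds at 0 too, where both sides are 0. *)
rewrite (_ : (fun x => x^-1) = fun x => x * (x ^+ 2) `^ (-1)); last first.
  apply/funext => x; rewrite powR_inv1 ?sqr_ge0//.
  have [->|x0] := eqVneq x 0; first by rewrite invr0 mul0r.
  by rewrite expr2 invfM mulrA divff ?mul1r.
apply: measurable_funM => //.
exact: (measurableT_comp (measurable_powR (-1))
  (exprn_measurable 2 : measurable_fun setT (fun x : R => x ^+ 2))).
Qed.

Lemma cvg_row n T (F : set_system T) {FF : Filter F} (u : T -> 'rV[R]_n) (l : 'rV[R]_n) :
  (forall i, u k ord0 i @[k --> F] --> l ord0 i) -> u k @[k --> F] --> l.
Proof.
move=> ul; apply/cvg_ballP => e e0.
have ulf : forall i, \forall k \near F, ball (l ord0 i) e (u k ord0 i).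
  by move=> i; move/cvg_ballP : (ul i); exact.
have {}ulf : \forall k \near F, forall i, ball (l ord0 i) e (u k ord0 i).
  exact: filter_forall.
by move: ulf; apply: filterS => k ulk; split => // a i; rewrite ord1.
Qed.

Lemma measurable_continuous_row n (f : 'rV[R]_n -> R) : continuous f ->
  measurable_fun [set: n.-tuple mT] (fun t => f (row_of t)).
(* The Borel sets of row vectors are not known to agree with the product
   sigma-algebra on tuples; f is instead a limit of functions of the grid cell. *)
Proof.
move=> cf.
pose I k (t : n.-tuple mT) : n.-tuple int :=
  [tuple Num.floor (k.+1%:R * tnth t i) | i < n].
pose G k (z : n.-tuple int) : 'rV[R]_n := \row_i ((tnth z i)%:~R / k.+1%:R).
apply: (@measurable_fun_cvg _ _ _ _ (fun k t => f (G k (I k t)))) => [k|t _].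
  move=> _ A mA; rewrite setTI.
  (* The value depends on t only through its grid cell, so a preimage is a union of boxes indexed by
     the countable set of integer tuples. *)
  rewrite (_ : _ @^-1` _ = \bigcup_(z in [set: n.-tuple int])
    ([set t | A (f (G k z))] `&` \bigcap_(i in [set: 'I_n])
       ((fun t : n.-tuple mT => k.+1%:R * tnth t i) @^-1`
        `[(tnth z i)%:~R, (tnth z i + 1)%:~R[))); last first.
    apply/seteqP; split => [t /= At|t [z _ [/= Az zt]]].
      exists (I k t) => //; split => //= i _ /=.
      by rewrite tnth_mktuple in_itv/= ge_floor floorD1_gt.
    rewrite (_ : I k t = z)//; apply: eq_from_tnth => i; rewrite tnth_mktuple.
    by apply: floor_def; have := zt i Logic.I; rewrite /= in_itv.
  apply: countable_bigcupT_measurable => // z.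
  apply: measurableI.
    by case: (pselect (A (f (G k z)))) => Az;
      [rewrite (_ : [set _ | _] = setT)|rewrite (_ : [set _ | _] = set0)];
      rewrite //; apply/seteqP; split.
  apply: fin_bigcap_measurable; first exact: finite_finset.
  move=> i _; rewrite -[X in measurable X]setTI.
  have : measurable_fun setT (fun t : n.-tuple mT => k.+1%:R * tnth t i).
    by apply: measurable_funM => //; exact: measurable_tnth.
  by apply => //; exact: measurable_itv.
apply: (cvg_comp (fun k => G k (I k t)) f _ (cf _)).
apply: cvg_row => i.
rewrite (_ : (fun k => _) = fun k => (Num.floor (k.+1%:R * tnth t i))%:~R / k.+1%:R); last first.
  by apply/funext => k; rewrite mxE tnth_mktuple.
rewrite mxE.
apply: (@squeeze_cvgr _ _ _ _ (fun k => tnth t i - harmonic k) (fun=> tnth t i)).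
- near=> k; rewrite ler_pdivlMr// ler_pdivrMr// [tnth t i * _]mulrC ge_floor andbT.
  by rewrite mulrBl [_^-1 * _]mulVf// [tnth t i * _]mulrC lerBlDr ltW// -[1 in ltRHS]/(1%:~R) -intrD floorD1_gt.
- by rewrite -[X in _ --> X]subr0; apply: cvgB; [exact: cvg_cst|exact: cvg_harmonic].
- exact: cvg_cst.
Unshelve. all: by end_near. Qed.
End measurable_row.

(** * Improper integrals as limits over compact intervals *)

Section exhaustion.
Context {R : realType}.
Local Notation mu := (@lebesgue_measure R).

(* The library integrates derivatives over compact intervals; the integrals over
   ]0, +oo[, ]0, pi[ and R are reached through such exhaustions. *)
Definition exhausts (a b : nat -> R) (A : set R) :=
  [/\ {homo a : n m / (n <= m)%N >-> m <= n}, {homo b : n m / (n <= m)%N >-> n <= m},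
      forall n, a n < b n & A = \bigcup_n `[a n, b n]%classic].

Lemma exhausts_nd a b A : exhausts a b A ->
  {homo (fun n => `[a n, b n]%classic) : n m / (n <= m)%N >-> (n <= m)%O}.
Proof.
move=> [na nb _ _] n m nm; apply/subsetPset => x /=; rewrite !in_itv/= => /andP[ax xb].
by rewrite (le_trans (na _ _ nm))// (le_trans xb)// nb.
Qed.

Lemma exhausts_itv a b A n x : exhausts a b A -> x \in `[a n, b n] -> A x.
Proof. by move=> [_ _ _ ->] xab; exists n. Qed.

Lemma measurable_exhausts a b A : exhausts a b A -> measurable A.
Proof. by move=> [_ _ _ ->]; exact: bigcup_measurable. Qed.

Lemma continuous_measurable_exhausts a b A (f : R -> R) : exhausts a b A ->
  (forall x, A x -> {for x, continuous f}) -> measurable_fun A f.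
Proof.
move=> e cf; have [_ _ _ AE] := e; rewrite AE; apply/measurable_fun_bigcup => // n.
apply: subspace_continuous_measurable_fun => //.
apply: continuous_in_subspaceT => x; rewrite inE/= => xab.
by apply: cf; exact: exhausts_itv e xab.
Qed.

Lemma ge0_cvg_integral_exhausts a b A (f : R -> R) : exhausts a b A ->
  measurable_fun A f -> (forall x, A x -> 0 <= f x) ->
  (\int[mu]_(x in `[a n, b n]) (f x)%:E @[n --> \oo] --> \int[mu]_(x in A) (f x)%:E)%E.
Proof.
move=> e mf f0; have [_ _ _ AE] := e; rewrite AE.
apply: ge0_nondecreasing_set_cvg_integral => //.
- exact: exhausts_nd e.
- move=> n; apply/measurable_EFinP; apply: measurable_funS mf.
  + exact: measurable_exhausts e.
  + by move=> x; exact: exhausts_itv e.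
- by move=> n x xab; rewrite lee_fin; apply: f0; exact: exhausts_itv e xab.
Qed.

(** Monotone convergence for the positive and the negative part; integrability makes the difference
    of the limits meaningful. *)
Lemma cvg_integral_exhausts a b A (f : R -> R) : exhausts a b A ->
  mu.-integrable A (EFin \o f) ->
  (\int[mu]_(x in `[a n, b n]) (f x)%:E @[n --> \oo] --> \int[mu]_(x in A) (f x)%:E)%E.
Proof.
move=> e intf.
have mA := measurable_exhausts e.
have mf : measurable_fun A (EFin \o f) by exact: measurable_int intf.
have Sn n : `[a n, b n]%classic `<=` A by move=> x; exact: exhausts_itv e.
have [_ _ _ AE] := e.
have cp (g : R -> \bar R) : (forall x, 0 <= g x)%E -> measurable_fun A g ->
    (\int[mu]_(x in `[a n, b n]) g x @[n --> \oo] --> \int[mu]_(x in A) g x)%E.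
  move=> g0 mg; rewrite [in X in _ --> X]AE; apply: ge0_nondecreasing_set_cvg_integral => //.
  - exact: exhausts_nd e.
  - by move=> n; apply: measurable_funS mg.
rewrite [X in _ --> X]integralE.
rewrite (_ : (fun n => _) = (fun n => \int[mu]_(x in `[a n, b n]) (EFin \o f)^\+%E x -
            \int[mu]_(x in `[a n, b n]) (EFin \o f)^\-%E x)%E); last first.
  by apply/funext => n; rewrite integralE.
apply: cvgeB.
- by rewrite fin_num_adde_defl// fin_numN; exact: integrable_neg_fin_num.
- by apply: cp => //; exact: measurable_funepos.
- by apply: cp => //; exact: measurable_funeneg.
Qed.

Lemma cvg_Rintegral_exhausts a b A (f : R -> R) : exhausts a b A ->
  mu.-integrable A (EFin \o f) ->
  \int[mu]_(x in `[a n, b n]) f x @[n --> \oo] --> \int[mu]_(x in A) f x.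
Proof.
move=> e intf; apply: fine_cvg; rewrite fineK; first exact: cvg_integral_exhausts e intf.
by apply: integrable_fin_num => //; exact: measurable_exhausts e.
Qed.

Lemma integral_FTC_exhausts_itv a b A (f F : R -> R) n : exhausts a b A ->
  (forall x, A x -> is_derive x 1 F (f x)) ->
  (forall x, A x -> {for x, continuous f}) ->
  (\int[mu]_(x in `[a n, b n]) (f x)%:E = (F (b n) - F (a n))%:E)%E.
Proof.
move=> e dF cf; have [_ _ ab _] := e.
have cF x : A x -> {for x, continuous F}.
  move=> Ax; apply: differentiable_continuous; apply/derivable1_diffP.
  by have [] := dF _ Ax.
have Aab x : a n <= x -> x <= b n -> A x.
  by move=> ax xb; apply: (exhausts_itv (n := n) e); rewrite in_itv/= ax.
rewrite (continuous_FTC2 (F := F) (ab n))//.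
- apply: continuous_in_subspaceT => x; rewrite inE/= => xab.
  by apply: cf; exact: exhausts_itv e xab.
- split.
  + move=> x; rewrite in_itv/= => /andP[ax xb].
    by have [] := dF _ (Aab _ (ltW ax) (ltW xb)).
  + by apply: cvg_at_right_filter; apply: cF; exact: Aab (lexx _) (ltW (ab n)).
  + by apply: cvg_at_left_filter; apply: cF; exact: Aab (ltW (ab n)) (lexx _).
- move=> x; rewrite in_itv/= => /andP[ax xb].
  by rewrite derive1E; have /@derive_val := dF _ (Aab _ (ltW ax) (ltW xb)); apply.
Qed.

Lemma Rintegral_FTC_exhausts a b A (f F : R -> R) l : exhausts a b A ->
  (forall x, A x -> is_derive x 1 F (f x)) ->
  (forall x, A x -> {for x, continuous f}) ->
  mu.-integrable A (EFin \o f) ->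
  F (b n) - F (a n) @[n --> \oo] --> l -> \int[mu]_(x in A) f x = l.
Proof.
move=> e dF cf intf Fl.
apply: cvg_unique (cvg_Rintegral_exhausts e intf) _ => //.
rewrite (_ : (fun n => _) = (fun n => F (b n) - F (a n)))//.
by apply/funext => n; rewrite /Rintegral (integral_FTC_exhausts_itv n e dF cf).
Qed.

Lemma ge0_integral_FTC_exhausts a b A (f F : R -> R) l : exhausts a b A ->
  (forall x, A x -> is_derive x 1 F (f x)) ->
  (forall x, A x -> {for x, continuous f}) ->
  (forall x, A x -> 0 <= f x) ->
  F (b n) - F (a n) @[n --> \oo] --> l -> (\int[mu]_(x in A) (f x)%:E = l%:E)%E.
Proof.
move=> e dF cf f0 Fl; have mf := continuous_measurable_exhausts e cf.
apply: cvg_unique (ge0_cvg_integral_exhausts e mf f0) _ => //.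
rewrite (_ : (fun n => _) = EFin \o (fun n => F (b n) - F (a n))).
  by apply: cvg_EFin => //; exact: nearW.
by apply/funext => n; rewrite (integral_FTC_exhausts_itv n e dF cf).
Qed.

Lemma exhausts_image a b A B (F : R -> R) : exhausts a b A ->
  {in A &, {homo F : x y / x < y}} -> F @` A = B -> is_interval B ->
  exhausts (F \o a) (F \o b) B.
Proof.
move=> e Fincr FAB iB; have [na nb ab AE] := e.
have Fle x y : A x -> A y -> x <= y -> F x <= F y.
  move=> Ax Ay; rewrite le_eqVlt => /predU1P[->//|xy].
  by rewrite ltW// Fincr// inE.
have Aa n : A (a n) by apply: (exhausts_itv (n := n) e); rewrite in_itv/= lexx ltW.
have Ab n : A (b n) by apply: (exhausts_itv (n := n) e); rewrite in_itv/= lexx ltW.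
split=> [n m nm|n m nm|n|].
- by apply: Fle => //; exact: na.
- by apply: Fle => //; exact: nb.
- by apply: Fincr; rewrite ?inE.
- apply/seteqP; split => [y|y [n _ /=]].
    rewrite -FAB => -[x Ax <-]; have := Ax; rewrite AE => -[n _ /=].
    rewrite in_itv/= => /andP[ax xb]; exists n => //=.
    by rewrite in_itv/= !Fle.
  rewrite in_itv/= => Fy.
  by apply: (iB (F (a n)) (F (b n))) => //; rewrite -FAB; exact: imageP.
Qed.

(** The substitution rule holds on each interval [[a n, b n]], and the image intervals exhaust [B];
    both sides then converge monotonically. *)
Lemma ge0_integration_by_substitution_exhausts a b A B (F f G : R -> R) :
  exhausts a b A -> exhausts (F \o a) (F \o b) B ->
  (forall x, A x -> is_derive x 1 F (f x)) ->
  (forall x, A x -> {for x, continuous f}) ->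
  {in A &, {homo F : x y / x < y}} -> (forall x, A x -> 0 <= f x) ->
  (forall y, B y -> {for y, continuous G}) -> (forall y, B y -> 0 <= G y) ->
  (\int[mu]_(y in B) (G y)%:E = \int[mu]_(x in A) (G (F x) * f x)%:E)%E.
Proof.
move=> eA eB dF cf Fincr f0 cG G0; have [_ _ ab AE] := eA.
have [_ _ _ BE] := eB.
have cF x : A x -> {for x, continuous F}.
  move=> Ax; apply: differentiable_continuous; apply/derivable1_diffP.
  by have [] := dF _ Ax.
have Fle x y : A x -> A y -> x <= y -> F x <= F y.
  move=> Ax Ay; rewrite le_eqVlt => /predU1P[->//|xy].
  by rewrite ltW// Fincr// inE.
have Aab n x : a n <= x -> x <= b n -> A x.
  by move=> ax xb; apply: (exhausts_itv (n := n) eA); rewrite in_itv/= ax.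
have BF x : A x -> B (F x).
  move=> Ax; have := Ax; rewrite AE => -[n _ /=]; rewrite in_itv/= => /andP[ax xb].
  apply: (exhausts_itv (n := n) eB); rewrite in_itv/=.
  have Aan := Aab n _ (lexx _) (ltW (ab n)); have Abn := Aab n _ (ltW (ab n)) (lexx _).
  by rewrite /= !Fle.
have cGFf x : A x -> {for x, continuous (fun x => G (F x) * f x)}.
  move=> Ax; apply: cvgM; last exact: cf.
  apply: (cvg_comp F G); first exact: cF.
  by apply: cG; exact: BF.
apply: cvg_unique (ge0_cvg_integral_exhausts eB _ _) _ => //.
  exact: continuous_measurable_exhausts eB cG.
have := ge0_cvg_integral_exhausts eA (continuous_measurable_exhausts eA cGFf).
move=> /(_ (fun x Ax => mulr_ge0 (G0 _ (BF _ Ax)) (f0 _ Ax))).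
rewrite (_ : (fun n => _) = (fun n => \int[mu]_(x in `[(F \o a) n, (F \o b) n]) (G x)%:E)%E)//.
apply/funext => n /=.
have nearA x : a n < x < b n -> \forall y \near x, A y.
  move=> /andP[ax xb]; near=> y; apply: (Aab n).
  + by apply: ltW; near: y; exact: lt_nbhsr.
  + by apply: ltW; near: y; exact: lt_nbhsl.
have F'E x : A x -> derive1 F x = f x.
  by move=> Ax; rewrite derive1E; have /@derive_val := dF _ Ax; apply.
rewrite (@integration_by_substitution_increasing _ F G (a n) (b n)).
- apply: eq_integral => x; rewrite inE/= in_itv/= => /andP[ax xb].
  rewrite -[RHS]/((G (F x) * derive1 F x)%:E) F'E//.
  exact: (Aab n _ ax xb).
- exact: ltW.
- move=> x y; rewrite !in_itv/= => /andP[ax xb] /andP[ay yb] xy.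
  by apply: Fincr => //; rewrite inE; exact: (Aab n).
- move=> x; rewrite in_itv/= => axb.
  have := cf _ (nbhs_singleton (nearA _ axb)).
  rewrite /prop_for /continuous_at F'E; last exact: nbhs_singleton (nearA _ axb).
  apply: cvg_trans; apply: near_eq_cvg.
  by near do rewrite F'E//; exact: nearA.
- apply/cvg_ex; exists (f (a n)).
  have : f x @[x --> (a n)^'+] --> f (a n).
    by apply: cvg_at_right_filter; apply: cf; exact: Aab (lexx _) (ltW (ab n)).
  apply: cvg_trans; apply: near_eq_cvg.
  near=> x; rewrite F'E//; apply: (Aab n); first by near: x; exact: nbhs_right_ge.
  by near: x; exact: nbhs_right_le.
- apply/cvg_ex; exists (f (b n)).
  have : f x @[x --> (b n)^'-] --> f (b n).
    by apply: cvg_at_left_filter; apply: cf; exact: Aab (ltW (ab n)) (lexx _).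
  apply: cvg_trans; apply: near_eq_cvg.
  near=> x; rewrite F'E//; apply: (Aab n); first by near: x; exact: nbhs_left_ge.
  by near: x; exact: nbhs_left_le.
- split.
  + move=> x; rewrite in_itv/= => /andP[ax xb].
    by have [] := dF _ (Aab n _ (ltW ax) (ltW xb)).
  + by apply: cvg_at_right_filter; apply: cF; exact: Aab (lexx _) (ltW (ab n)).
  + by apply: cvg_at_left_filter; apply: cF; exact: Aab (ltW (ab n)) (lexx _).
- apply: continuous_in_subspaceT => x; rewrite inE/= => xab.
  by apply: cG; exact: exhausts_itv eB xab.
Unshelve. all: by end_near. Qed.

End exhaustion.

(** * Gamma and Gauss integrals *)

Section gamma_integrals.
Context {R : realType}.
Local Notation mu := (@lebesgue_measure R).
Local Notation pos := (`]0%R, +oo[%classic : set R).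

Lemma powR_continuous p (x : R) : 0 < x -> {for x, continuous (fun y => y `^ p)}.
Proof. by move=> x0; continuous_tac. Qed.

Lemma expR_continuous (x : R) : {for x, continuous (@expR R)}.
Proof. exact: is_derive_continuous (is_derive_expR x). Qed.

(** With the offset in [n.+2] the left end is strictly below the right end already at n = 0. *)
Lemma exhausts_pos : exhausts (fun n => n.+2%:R^-1) (fun n => n.+2%:R) pos.
Proof.
split=> [n m nm|n m nm|n|].
- by rewrite lef_pV2 ?posrE// ler_nat.
- by rewrite ler_nat.
- by rewrite (@lt_trans _ _ 1)// ?invf_lt1 ?ltr1n.
- apply/seteqP; split => [x /=|x [n _ /=]]; rewrite !in_itv/= ?andbT.
    move=> x0; exists (Num.truncn (x + x^-1)) => //=; rewrite in_itv/=.
    have xx : x + x^-1 <= (Num.truncn (x + x^-1)).+2%:R.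
      by rewrite (le_trans (ltW (truncnS_gt _)))// ler_nat.
    have xV0 : 0 < x^-1 by rewrite invr_gt0.
    apply/andP; split; last by apply: le_trans xx; rewrite lerDl ltW.
    rewrite -[leRHS]invrK lef_pV2 ?posrE//.
    by apply: le_trans xx; rewrite lerDr ltW.
  by move=> /andP[+ _]; apply: lt_le_trans.
Qed.

Lemma exhausts_T : exhausts (fun n => - n.+1%:R) (fun n => n.+1%:R) [set: R].
Proof.
split=> [n m nm|n m nm|n|].
- by rewrite lerN2 ler_nat.
- by rewrite ler_nat.
- by rewrite (@lt_trans _ _ 0)// oppr_lt0.
- apply/seteqP; split => // x _; exists (Num.truncn `|x|) => //=.
  by rewrite in_itv/= -ler_norml ltW// truncnS_gt.
Qed.

Lemma exhausts_0pi :
  exhausts (fun n => n.+2%:R^-1) (fun n => pi - n.+2%:R^-1) (`]0%R, pi[%classic : set R).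
Proof.
split=> [n m nm|n m nm|n|].
- by rewrite lef_pV2 ?posrE// ler_nat.
- by rewrite lerD2l lerN2 lef_pV2 ?posrE// ler_nat.
- rewrite ltrBrDr (@le_lt_trans _ _ 1)//; last by have := @pi_ge2 R; lra.
  rewrite [leRHS](_ : 1 = 2^-1 + 2^-1); last by lra.
  by apply: lerD; rewrite lef_pV2 ?posrE// ler_nat.
- apply/seteqP; split => [x /=|x [n _ /=]]; rewrite !in_itv/=; last first.
    have n0 : 0 < n.+2%:R^-1 :> R by rewrite invr_gt0.
    by move=> /andP[x1 x2]; rewrite (lt_le_trans n0)//= (le_lt_trans x2)// gtrBl.
  move=> /andP[x0 xpi]; exists (Num.truncn (x^-1 + (pi - x)^-1)) => //=.
  set n := Num.truncn _; have xV0 : 0 < x^-1 by rewrite invr_gt0.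
  have yV0 : 0 < (pi - x)^-1 by rewrite invr_gt0 subr_gt0.
  have xx : x^-1 + (pi - x)^-1 <= n.+2%:R.
    by rewrite (le_trans (ltW (truncnS_gt _)))// ler_nat.
  rewrite in_itv/=; apply/andP; split.
    by rewrite -[leRHS]invrK lef_pV2 ?posrE//; apply: le_trans xx; rewrite lerDl ltW.
  rewrite lerBrDr -lerBrDl -[leRHS]invrK lef_pV2 ?posrE//.
  by apply: le_trans xx; rewrite lerDr ltW.
Qed.

Lemma image_scale_pos c : 0 < c -> (fun x => x * c) @` pos = pos.
Proof.
move=> c0; apply/seteqP; split => [_ [x /= x0 <-]|x /=].
  by rewrite /= !in_itv/= !andbT in x0 *; rewrite mulr_gt0.
rewrite in_itv/= andbT => x0; exists (x / c); last by rewrite divfK// gt_eqF.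
by rewrite /= in_itv/= andbT divr_gt0.
Qed.

Lemma is_derive_scale (c x : R) : is_derive x 1 (fun y => y * c) c.
Proof. by derive_tac; ring. Qed.

Lemma gamma_continuous p (k : R -> R) (x : R) : 0 < x -> {for x, continuous k} ->
  {for x, continuous (fun t => t `^ (p - 1) * expR (- t) * k t)}.
Proof.
move=> x0 ck; apply: cvgM => //.
by apply: (is_derive_continuous (f := fun t => t `^ (p - 1) * expR (- t))); derive_expr.
Qed.

Lemma posP x : pos x <-> 0 < x.
Proof. by rewrite /= in_itv/= andbT. Qed.

Lemma gamma_ge0 p (k : R -> R) x : 0 <= k x -> 0 <= x `^ (p - 1) * expR (- x) * k x.
Proof. by move=> k0; rewrite !mulr_ge0 ?powR_ge0 ?expR_ge0. Qed.

(** Substitution of t B for t. The factor [k] is carried along so that the rule serves both the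
    plain Gamma integral and the inner integral of the beta identity. *)
Lemma integral_gammaE p (B : R) (k : R -> R) : 0 < B ->
  (forall x, 0 < x -> {for x, continuous k}) -> (forall x, 0 <= k x) ->
  (\int[mu]_(t in pos) (t `^ (p - 1) * expR (- (t * B)) * k (t * B))%:E =
   (B `^ (- p))%:E * \int[mu]_(t in pos) (t `^ (p - 1) * expR (- t) * k t)%:E)%E.
Proof.
move=> B0 ck k0.
have eB : exhausts ((fun x => x * B) \o (fun n => n.+2%:R^-1))
    ((fun x => x * B) \o (fun n => n.+2%:R)) pos.
  apply: (exhausts_image exhausts_pos _ (image_scale_pos B0)).
    by move=> x y _ _ xy; rewrite ltr_pM2r.
  exact: interval_is_interval.
have cg x : pos x -> {for x, continuous (fun t => t `^ (p - 1) * expR (- t) * k t)}.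
  by move=> /posP x0; apply: gamma_continuous => //; exact: ck.
have g0 x : pos x -> 0 <= x `^ (p - 1) * expR (- x) * k x.
  by move=> /posP x0; exact: gamma_ge0.
have := ge0_integration_by_substitution_exhausts exhausts_pos eB
  (fun x _ => is_derive_scale B x) (fun x _ => cvg_cst _) _ _ cg g0.
move=> ->; last 2 first.
- by move=> x y _ _ xy; rewrite ltr_pM2r.
- by move=> x _; exact: ltW.
rewrite -ge0_integralZl//=.
- apply: eq_integral => t; rewrite inE => /posP t0.
  rewrite -EFinM; congr EFin.
  rewrite powRM ?ltW// [in RHS](_ : B `^ (- p) = B `^ (- (p - 1)) * B^-1).
    by rewrite powRN; field; rewrite ?gt_eqF ?powR_gt0.
  rewrite -[in RHS]powR_inv1 ?ltW// -powRDp//; congr powR; lra.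
- apply/measurable_EFinP; apply: (continuous_measurable_exhausts exhausts_pos) => x /posP x0.
  apply: cvgM; last exact: cvg_cst.
  apply: (cvg_comp (fun x => x * B) (fun t => t `^ (p - 1) * expR (- t) * k t)).
    by apply: cvgM; [exact: cvg_id|exact: cvg_cst].
  by apply: cg; apply/posP; rewrite mulr_gt0.
- move=> x /posP x0; rewrite lee_fin; apply: mulr_ge0; last exact: ltW.
  by apply: gamma_ge0.
- by rewrite lee_fin powR_ge0.
Qed.

(** The function c ln(1 + t) - t of t is largest at 1 + t = c; the bound is ln v <= v - 1 at v = (1
    + t) / c. *)
Lemma powR_expR_le (c t : R) : 0 < c -> 0 < t ->
  (1 + t) `^ c * expR (- t) <= expR (1 - c + c * ln c).
Proof.
move=> c0 t0; have t1 : 0 < 1 + t by rewrite addr_gt0.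
rewrite /powR gt_eqF// -expRD ler_expR.
have : ln (1 + ((1 + t) / c - 1)) <= (1 + t) / c - 1.
  by apply: le_ln1Dx; rewrite ltrBrDr addrC subrr divr_gt0.
rewrite addrCA subrr addr0 ln_div ?posrE// => h.
have : c * (ln (1 + t) - ln c) <= c * ((1 + t) / c - 1) by rewrite ler_pM2l.
rewrite [X in _ <= X -> _](_ : _ = 1 + t - c); first lra.
by field; rewrite gt_eqF.
Qed.

Lemma cvg_natinv : (n.+2%:R^-1 : R) @[n --> \oo] --> (0 : R).
Proof.
have := @cvg_harmonic R; rewrite -(cvg_shiftS (@harmonic R)); exact.
Qed.

Lemma continuous_pow_div p (x : R) : 0 < x ->
  {for x, continuous (fun t => t `^ (p - 1) * (1 + t) `^ (- (p + 1)))}.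
Proof. by move=> x0; continuous_tac => //; rewrite addr_gt0. Qed.

Lemma integral_pow_div p : 0 < p ->
  (\int[mu]_(t in pos) (t `^ (p - 1) * (1 + t) `^ (- (p + 1)))%:E = p^-1%:E)%E.
Proof.
move=> p0.
(* The antiderivative is (t / (1 + t))^p / p. *)
apply: (ge0_integral_FTC_exhausts (F := fun t => p^-1 * (1 + t^-1) `^ (- p)) exhausts_pos).
- move=> x /posP x0.
  have xV0 : 0 < 1 + x^-1 by rewrite addr_gt0// invr_gt0.
  derive_tac => //; first by rewrite gt_eqF.
  rewrite mul0r add0r (_ : 1 + x^-1 = (1 + x) * x^-1); last by field; rewrite gt_eqF.
  rewrite powRM ?invr_ge0 ?addr_ge0 1?ltW// -powR_inv1 1?ltW// -powRrM.
  rewrite (_ : -1 * (- p - 1) = p - 1 + 2%:R); last by lra.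
  rewrite [x `^ (_ + 2)]powRDp// powR_mulrn 1?ltW// (_ : - p - 1 = - (p + 1)); last by lra.
  by field; rewrite !gt_eqF.
- by move=> x /posP x0; exact: continuous_pow_div.
- by move=> x _; rewrite mulr_ge0 ?powR_ge0.
- rewrite -[X in _ --> X]subr0; apply: cvgB.
    have c0 : {for (0:R), continuous (fun t : R => p^-1 * (1 + t) `^ (- p))}.
      by continuous_tac; rewrite addr0.
    have := cvg_comp (fun n => n.+2%:R^-1 : R) _ cvg_natinv c0.
    by rewrite addr0 powR1 mulr1.
  rewrite -(mulr0 p^-1); apply: cvgM; first exact: cvg_cst.
  rewrite (_ : (fun n => _) = (fun n => (1 + n.+2%:R)^-1 `^ p)); last first.
    apply/funext => n; have n1 : 0 <= 1 + n.+2%:R :> R by rewrite addr_ge0.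
    rewrite invrK -(powR_inv1 n1) -powRrM.
    by congr (_ `^ _); ring.
  apply: (cvg_comp _ _ _ (powR_cvg0 p0)) => A [e /= e0 eA].
  have /cvgrPdist_lt/(_ _ e0) := cvg_natinv.
  apply: filterS => n; rewrite sub0r normrN => ne.
  have n0 : 0 < (1 + n.+2%:R)^-1 :> R by rewrite invr_gt0.
  apply: eA => //=; rewrite sub0r normrN; apply: le_lt_trans ne.
  rewrite !gtr0_norm ?invr_gt0// lef_pV2 ?posrE//.
  by rewrite lerDr.
Qed.

(** By [powR_expR_le] the exponential is at most a constant times (1 + t)^(-(p + 1)), which leaves
    an integrand with an explicit primitive. *)
Lemma integral_gamma_lty p : 0 < p ->
  (\int[mu]_(t in pos) (t `^ (p - 1) * expR (- t))%:E < +oo)%E.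
Proof.
move=> p0; have p1 : 0 < p + 1 by rewrite addr_gt0.
pose K := expR (1 - (p + 1) + (p + 1) * ln (p + 1)).
have mk : measurable_fun pos (fun t => (t `^ (p - 1) * (1 + t) `^ (- (p + 1)))%:E).
  apply/measurable_EFinP; apply: (continuous_measurable_exhausts exhausts_pos) => x /posP.
  exact: continuous_pow_div.
apply: (@le_lt_trans _ _ (\int[mu]_(t in pos) (K%:E * (t `^ (p - 1) * (1 + t) `^ (- (p + 1)))%:E))%E); last first.
  rewrite ge0_integralZl//=.
  - by rewrite integral_pow_div// -EFinM ltry.
  - by move=> x _; rewrite lee_fin mulr_ge0 ?powR_ge0.
  - by rewrite lee_fin expR_ge0.
apply: ge0_le_integral => //=.
- by move=> t _; rewrite lee_fin mulr_ge0 ?powR_ge0 ?expR_ge0.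
- apply/measurable_EFinP; apply: (continuous_measurable_exhausts exhausts_pos) => x /posP x0.
  by continuous_tac.
- exact: measurable_funeM.
- move=> t /posP t0; rewrite -EFinM lee_fin.
  have t1 : 0 < 1 + t by rewrite addr_gt0.
  rewrite [leRHS]mulrCA ler_pM2l ?powR_gt0// powRN ler_pdivlMr ?powR_gt0// mulrC.
  exact: powR_expR_le.
Qed.

Lemma gauss_integralE (c a : R) : 0 < c ->
  (\int[mu]_y (expR (- (c * (y - a) ^+ 2)))%:E = (Num.sqrt (pi / c))%:E)%E.
Proof.
move=> c0; pose k := Num.sqrt c; have k0 : 0 < k by rewrite sqrtr_gt0.
have e : exhausts ((fun y => k * (y - a)) \o (fun n => - n.+1%:R))
    ((fun y => k * (y - a)) \o (fun n => n.+1%:R)) [set: R].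
  apply: (exhausts_image exhausts_T) => //.
    by move=> x y _ _ xy; rewrite ltr_pM2l// ltrD2r.
  apply/seteqP; split => // x _; exists (x / k + a) => //.
  by field; rewrite gt_eqF.
have dF (x : R) : setT x -> is_derive x 1 (fun y => k * (y - a)) k.
  by move=> _; derive_tac; ring.
have := ge0_integration_by_substitution_exhausts (G := @gauss_fun R) exhausts_T e dF
  (fun x _ => cvg_cst _).
rewrite integralT_gauss => H.
have {H} : ((Num.sqrt pi)%:E = \int[mu]_x (gauss_fun (k * (x - a)) * k)%:E)%E.
  apply: H => //.
  - by move=> x y _ _ xy; rewrite ltr_pM2l// ltrD2r.
  - by move=> _ _; exact: ltW.
  - by move=> y _; exact: continuous_gauss_fun.
  - by move=> y _; exact: gauss_fun_ge0.
under eq_integral do rewrite mulrC EFinM.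
rewrite ge0_integralZl//=; last 3 first.
- apply/measurable_EFinP; apply: (measurableT_comp measurable_gauss_fun).
  by apply: measurable_funM => //; exact: measurable_funB.
- by move=> x _; rewrite lee_fin gauss_fun_ge0.
- by rewrite lee_fin ltW.
move=> H; have <- : (k^-1%:E * (Num.sqrt pi)%:E)%E = (Num.sqrt (pi / c))%:E.
  by rewrite -EFinM sqrtrM ?pi_ge0// sqrtrV 1?ltW// mulrC.
rewrite H muleA -EFinM mulVf ?gt_eqF// mul1e.
apply: eq_integral => y _; rewrite /gauss_fun; congr (expR (- _))%:E.
by rewrite exprMn sqr_sqrtr// ltW.
Qed.

End gamma_integrals.

Section fubini_on.
Context {R : realType} d1 d2 (T1 : measurableType d1) (T2 : measurableType d2).
Context (m1 : {sigma_finite_measure set T1 -> \bar R}).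
Context (m2 : {sigma_finite_measure set T2 -> \bar R}).

Lemma fubini_tonelli_on (A : set T1) (B : set T2) (f : T1 -> T2 -> R) :
  measurable A -> measurable B ->
  measurable_fun [set: T1 * T2] (fun p => f p.1 p.2) ->
  (forall x y, 0 <= f x y) ->
  (\int[m1]_(x in A) \int[m2]_(y in B) (f x y)%:E =
   \int[m2]_(y in B) \int[m1]_(x in A) (f x y)%:E)%E.
Proof.
move=> mA mB mf f0.
pose g p := (f p.1 p.2 * \1_A p.1 * \1_B p.2)%:E.
have mg : measurable_fun [set: T1 * T2] g.
  apply/measurable_EFinP; apply: measurable_funM; first apply: measurable_funM => //.
    by apply: (measurableT_comp (f := \1_A : T1 -> R)) => //; exact: measurable_indic.
  by apply: (measurableT_comp (f := \1_B : T2 -> R)) => //; exact: measurable_indic.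
have g0 p : (0 <= g p)%E by rewrite lee_fin !mulr_ge0.
transitivity (\int[m1]_x \int[m2]_y g (x, y))%E.
  rewrite integral_mkcond; apply: eq_integral => x _; rewrite patchE.
  case: ifPn => xA.
    rewrite integral_mkcond; apply: eq_integral => y _; rewrite patchE /g/= !indicE xA mulr1.
    by case: ifPn => _; rewrite ?mulr1 ?mulr0.
  rewrite integral0_eq// => y _; rewrite /g/= !indicE (negbTE xA) mulr0 mul0r//.
rewrite (fubini_tonelli g mg g0).
rewrite [RHS]integral_mkcond; apply: eq_integral => y _; rewrite patchE.
case: ifPn => yB.
  rewrite [RHS]integral_mkcond; apply: eq_integral => x _; rewrite patchE /g/= !indicE yB mulr1.
  by case: ifPn => _; rewrite ?mulr1 ?mulr0.
by rewrite integral0_eq// => x _; rewrite /g/= !indicE (negbTE yB) mulr0.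
Qed.

End fubini_on.

(** * The Gamma function on vertical lines, in real form *)

Section complex_gamma.
Context {R : realType}.
Local Notation mu := (@lebesgue_measure R).
Local Notation pos := (`]0%R, +oo[%classic : set R).
Implicit Types (p q x t : R).

Lemma measurable_pos : @measurable _ (measurableTypeR R) pos.
Proof. exact: measurable_itv. Qed.

Lemma gamma_integrable p (k : R -> R) : 0 < p -> measurable_fun setT k ->
  (exists M : R, forall x, `|k x| <= M) ->
  mu.-integrable pos (fun t => (t `^ (p - 1) * expR (- t) * k t)%:E).
Proof.
move=> p0 mk [M kM].
have mw : measurable_fun setT (fun t : R => t `^ (p - 1) * expR (- t)).
  apply: measurable_funM; first exact: measurable_powR.
  by apply: (measurableT_comp (f := @expR R)) => //; exact: measurable_expR.
apply: (integrable_EFin_le measurable_pos (g := fun t => M * (t `^ (p - 1) * expR (- t)))).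
- by apply: measurable_funTS; exact: measurable_funM.
- move=> t _ /=; rewrite !normrM mulrC.
  rewrite (ger0_norm (powR_ge0 _ _)) (ger0_norm (expR_ge0 _)); apply: ler_wpM2r => //.
  by rewrite mulr_ge0 ?powR_ge0 ?expR_ge0.
- apply: integrable_EFinZ; first exact: measurable_pos.
  apply/integrableP; split.
    by apply/measurable_EFinP; exact: measurable_funTS.
  under eq_integral do rewrite gee0_abs ?lee_fin ?mulr_ge0 ?powR_ge0 ?expR_ge0//.
  exact: integral_gamma_lty.
Qed.

(* The real part of e^(i th) Gamma (p + i m); th = - pi / 2 gives the imaginary
   part of Gamma (p + i m). *)
Definition gph p m th : R :=
  \int[mu]_(t in pos) (t `^ (p - 1) * expR (- t) * cos (m * ln t + th)).

Lemma measurable_cosln m th : measurable_fun [set: R] (fun t => cos (m * ln t + th)).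
Proof.
apply: (measurableT_comp (continuous_measurable_fun (@continuous_cos R))).
by apply: measurable_funD => //; apply: measurable_funM => //; exact: measurable_ln.
Qed.

Lemma normr_cos_le1 x : `|cos x| <= 1.
Proof. by rewrite ler_norml cos_geN1 cos_le1. Qed.

Lemma gph_integrable p m th : 0 < p ->
  mu.-integrable pos (fun t => (t `^ (p - 1) * expR (- t) * cos (m * ln t + th))%:E).
Proof.
move=> p0; apply: gamma_integrable => //; first exact: measurable_cosln.
by exists 1 => x; exact: normr_cos_le1.
Qed.

Hint Resolve measurable_pos : core.

(** The addition formula under the integral, with cos(x - pi / 2) = sin x: every phase is a
    combination of the real and the imaginary part. *)
Lemma gphD p m a b : 0 < p ->
  gph p m (a + b) = cos b * gph p m a - sin b * gph p m (a - pi / 2).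
Proof.
move=> p0; rewrite /gph -!RintegralZl//; try exact: gph_integrable.
rewrite -RintegralB//; try by apply: integrable_EFinZ => //; exact: gph_integrable.
apply: eq_Rintegral => t _.
rewrite addrA cosD (_ : m * ln t + (a - pi / 2) = (m * ln t + a) - pi / 2); last by ring.
by rewrite cosBpihalf; ring.
Qed.

Lemma gphDpi p m a : 0 < p -> gph p m (a - pi) = - gph p m a.
Proof.
move=> p0; rewrite gphD// cosN cospi sinN sinpi; ring.
Qed.

Lemma cvg_powR_natinv p : 0 < p -> n.+2%:R^-1 `^ p @[n --> \oo] --> (0 : R).
Proof.
move=> p0; apply: (cvg_comp _ _ _ (powR_cvg0 p0)) => A [e /= e0 eA].
have /cvgrPdist_lt/(_ _ e0) := @cvg_natinv R.
by apply: filterS => n ne; apply: eA => //=; rewrite invr_gt0.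
Qed.

Lemma cvg_gamma_boundary p (k : R -> R) : 0 < p -> (forall x, `|k x| <= 1) ->
  let F t := t `^ p * expR (- t) * k t in
  F n.+2%:R - F n.+2%:R^-1 @[n --> \oo] --> (0 : R).
Proof.
move=> p0 k1 F; rewrite -[X in _ --> X]subr0; apply: cvgB.
  pose K := expR (1 - (p + 1) + (p + 1) * ln (p + 1)).
  have KF n : `|F n.+2%:R| <= K * n.+2%:R^-1.
    have n0 : 0 < n.+2%:R :> R by [].
    have n1 : 0 < 1 + n.+2%:R :> R by rewrite addr_gt0.
    rewrite normrM (le_trans (ler_wpM2l _ (k1 _)))// mulr1 normrM.
    rewrite !ger0_norm ?powR_ge0 ?expR_ge0// ler_pdivlMr//.
    apply: le_trans (powR_expR_le (addr_gt0 p0 ltr01) n0).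
    rewrite mulrAC ler_wpM2r ?expR_ge0// mulrC.
    rewrite -[X in X * _ <= _](powRr1 (ltW n0)) -powRDp// addrC.
    by apply: ler_powR_base; rewrite ?addr_ge0 ?lerDr// ltW.
  apply: norm_cvg0; apply: (@squeeze_cvgr _ _ _ _ (fun=> 0) (fun n => K * n.+2%:R^-1)).
  - by near=> n; rewrite normr_ge0 KF.
  - exact: cvg_cst.
  - by rewrite -(mulr0 K); apply: cvgM; [exact: cvg_cst|exact: cvg_natinv].
apply: norm_cvg0; apply: (@squeeze_cvgr _ _ _ _ (fun=> 0) (fun n => n.+2%:R^-1 `^ p)).
- near=> n; rewrite normr_ge0/= normrM (le_trans (ler_wpM2l _ (k1 _)))// mulr1 normrM.
  rewrite !ger0_norm ?powR_ge0 ?expR_ge0// ler_piMr ?powR_ge0// -expR0 ler_expR oppr_le0.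
- exact: cvg_cst.
- exact: cvg_powR_natinv.
Unshelve. all: by end_near. Qed.

(** The functional equation Gamma(z + 1) = z Gamma(z) at z = p + i m, obtained by integrating the
    derivative of t^p e^(-t) cos(m ln t + th). The derivative of the phase gives the term with m. *)
Lemma gphS p m th : 0 < p ->
  gph (p + 1) m th = p * gph p m th - m * gph p m (th - pi / 2).
Proof.
move=> p0; have p1 : 0 < p + 1 by rewrite addr_gt0.
pose F t := t `^ p * expR (- t) * cos (m * ln t + th).
pose f t := p * (t `^ (p - 1) * expR (- t) * cos (m * ln t + th))
  - m * (t `^ (p - 1) * expR (- t) * cos (m * ln t + (th - pi / 2)))
  - t `^ (p + 1 - 1) * expR (- t) * cos (m * ln t + th).
have i1 := gph_integrable m th p0.
have i2 := gph_integrable m (th - pi / 2) p0.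
have i3 := gph_integrable m th p1.
have i4 := integrable_EFinB measurable_pos (integrable_EFinZ measurable_pos p i1)
  (integrable_EFinZ measurable_pos m i2).
have fi := integrable_EFinB measurable_pos i4 i3.
have : \int[mu]_(t in pos) f t = 0.
  apply: (Rintegral_FTC_exhausts (F := F) exhausts_pos) => //.
  - move=> x /posP x0; rewrite /F /f; derive_tac => //.
    by rewrite addrA cosBpihalf addrK -(mulr_powRB1 (ltW x0) p0); field; rewrite gt_eqF.
  - move=> x /posP x0; rewrite /f; by continuous_tac.
  - apply: (cvg_gamma_boundary (k := fun t => cos (m * ln t + th)) p0) => x.
    exact: normr_cos_le1.
rewrite /f RintegralB// RintegralB//; try exact: integrable_EFinZ.
by rewrite !RintegralZl// /gph => /eqP; rewrite subr_eq0 => /eqP <-.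
Qed.

(** Once the exponent of t is nonnegative the integrand is at least e^(-2) on [1, 2]; the functional
    equation first raises p to p + 1. *)
Lemma gph0_gt0 p : 0 < p -> 0 < gph p 0 0.
Proof.
suff H q : 1 <= q -> 0 < gph q 0 0.
  move=> p0; have := H (p + 1); rewrite lerDr => /(_ (ltW p0)).
  by rewrite gphS// mul0r subr0 pmulr_rgt0.
move=> q1; have q0 : 0 < q by rewrite (lt_le_trans _ q1).
rewrite -lte_fin /gph -fine_integral//; last exact: gph_integrable.
have wE t : t `^ (q - 1) * expR (- t) * cos (0 * ln t + 0) = t `^ (q - 1) * expR (- t).
  by rewrite mul0r addr0 cos0 mulr1.
under eq_integral do rewrite wE.
have mw : measurable_fun setT (fun t : R => t `^ (q - 1) * expR (- t)).
  apply: measurable_funM; first exact: measurable_powR.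
  by apply: (measurableT_comp (f := @expR R)) => //; exact: measurable_expR.
apply: (@lt_le_trans _ _ (\int[mu]_(t in `[1%R, 2%R]) (expR (- 2))%:E)%E).
  rewrite integral_cst//= lebesgue_measure_itv/= lte_fin ltr1n.
  by rewrite -EFinB -EFinM lte_fin mulr_gt0 ?expR_gt0//; lra.
apply: (@le_trans _ _ (\int[mu]_(t in `[1%R, 2%R]) (t `^ (q - 1) * expR (- t))%:E)%E).
  apply: ge0_le_integral => //.
  - by apply/measurable_EFinP; exact: measurable_funTS.
  - move=> t; rewrite /= in_itv/= => /andP[t1 t2]; rewrite lee_fin.
    rewrite -[leLHS]mul1r ler_pM ?expR_ge0//; last by rewrite ler_expR lerN2.
    rewrite -[leLHS](@powRr1 R 1)// powR1 -[leLHS](congr1 (@^~ (q - 1)) (@powR1 R)).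
    by apply: ler_powR_base; rewrite ?subr_ge0.
apply: ge0_subset_integral => //.
- by apply/measurable_EFinP; exact: measurable_funTS.
- by move=> t _; rewrite lee_fin mulr_ge0 ?powR_ge0 ?expR_ge0.
- by move=> t; rewrite /= !in_itv/= andbT => /andP[t1 _]; rewrite (lt_le_trans _ t1).
Qed.

Lemma sinh_ge (v : R) : 0 <= v -> v <= Defs.sinh v.
Proof.
rewrite le_eqVlt => /predU1P[<-|v0]; first by rewrite /Defs.sinh oppr0 subrr mul0r.
pose f (u : R) := Defs.sinh u - u.
have df (u : R) : is_derive u 1 f (Defs.cosh u - 1).
  by rewrite /f /Defs.sinh /Defs.cosh; derive_tac; field.
have [|c _] := @MVT R f (fun u => Defs.cosh u - 1) _ _ v0 (fun u _ => df u).
  by apply: continuous_subspaceT => u; exact: is_derive_continuous (df u).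
have f0 : f 0 = 0 by rewrite /f /Defs.sinh oppr0 subrr mul0r addr0.
rewrite f0 /f.
rewrite !subr0 => fE.
rewrite -subr_ge0 fE; apply: mulr_ge0; last exact: ltW.
rewrite subr_ge0 /Defs.cosh.
rewrite ler_pdivlMr// mul1r expRN.
have e0 := expR_gt0 c; rewrite -subr_ge0.
rewrite (_ : _ - _ = (expR c - 1) ^+ 2 / expR c); last by field; rewrite gt_eqF.
by rewrite divr_ge0 ?sqr_ge0// ltW.
Qed.

(** With v = ln y / 2 the two sides are (2 v)^2 and (2 sinh v)^2. *)
Lemma ln_sqr_le (y : R) : 0 < y -> ln y ^+ 2 <= y + y^-1 - 2.
Proof.
move=> y0; pose v := ln y / 2.
have -> : y + y^-1 - 2 = (2 * Defs.sinh `|v|) ^+ 2.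
  have -> : (2 * Defs.sinh `|v|) ^+ 2 = (2 * Defs.sinh v) ^+ 2.
    case: (lerP 0 v) => v0; first by rewrite ger0_norm.
    by rewrite ltr0_norm// /Defs.sinh opprK; field.
  have yE : y = expR v ^+ 2.
    by rewrite -expRM_natr /v divfK// lnK.
  have e0 := expR_gt0 v; rewrite /Defs.sinh expRN {1 2}yE; field; rewrite ?gt_eqF//.
have -> : ln y ^+ 2 = (2 * `|v|) ^+ 2.
  by rewrite exprMn real_normK ?num_real// /v; field.
have h := sinh_ge (normr_ge0 v).
rewrite lerXn2r ?nnegrE ?mulr_ge0// ?(le_trans _ h)//.
by rewrite ler_pM2l.
Qed.

Lemma normr_sin_le (x : R) : `|sin x| <= `|x|.
Proof.
wlog : x / 0 < x => [H|x0].
  have [/H//|x0|<-] := ltgtP 0 x; last by rewrite sin0 normr0.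
  by rewrite -normrN -sinN -[leRHS]normrN; apply: H; rewrite oppr_gt0.
have [|c _] := @MVT R sin cos _ _ x0 (fun u _ => is_derive_sin u).
  by apply: continuous_subspaceT; exact: continuous_sin.
rewrite sin0 !subr0 => ->; rewrite normrM.
by rewrite ler_piMl// normr_cos_le1.
Qed.

Lemma cos_ge (x : R) : 1 - x ^+ 2 / 2 <= cos x.
Proof.
have -> : cos x = 1 - 2 * sin (x / 2) ^+ 2.
  have := cos_mulr2n (x / 2); rewrite -[x / 2 *+ 2]mulr_natr divfK// => ->.
  by rewrite cos2sin2; ring.
have : sin (x / 2) ^+ 2 <= (x / 2) ^+ 2.
  rewrite -[leLHS]real_normK ?num_real// -[leRHS]real_normK ?num_real//.
  by rewrite lerXn2r ?nnegrE// normr_sin_le.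
have -> : x ^+ 2 / 2 = 2 * (x / 2) ^+ 2 by field.
lra.
Qed.

(** The phase - m ln a turns the cosine into cos(m ln(t / a)), which is close to 1 where t^(a - 1)
    e^(-t) concentrates. The bounds cos x >= 1 - x^2 / 2 and (ln y)^2 <= y + 1 / y - 2 at y = t / a
    leave only Gamma(a + 1), Gamma(a) and Gamma(a - 1), which the functional equation compares. *)
Lemma gph_ge a m : 1 < a ->
  gph a 0 0 * (1 - m ^+ 2 / (2 * (a - 1))) <= gph a m (- (m * ln a)).
Proof.
move=> a1; have a0 : 0 < a by rewrite (lt_trans _ a1).
have am0 : 0 < a - 1 by rewrite subr_gt0.
have rec1 : gph (a + 1) 0 0 = a * gph a 0 0 by rewrite gphS// mul0r subr0.
have rec2 : gph a 0 0 = (a - 1) * gph (a - 1) 0 0.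
  by have := gphS 0 0 am0; rewrite subrK mul0r subr0.
pose w b t := t `^ (b - 1) * expR (- t) * cos (0 * ln t + 0).
have iw b : 0 < b -> mu.-integrable pos (fun t => (w b t)%:E) by exact: gph_integrable.
have ap1 : 0 < a + 1 by rewrite addr_gt0.
have i1 := integrable_EFinZ measurable_pos (1 + m ^+ 2) (iw _ a0).
have i2 := integrable_EFinZ measurable_pos (m ^+ 2 / (2 * a)) (iw _ ap1).
have i3 := integrable_EFinZ measurable_pos (m ^+ 2 * a / 2) (iw _ am0).
have -> : gph a 0 0 * (1 - m ^+ 2 / (2 * (a - 1))) =
    \int[mu]_(t in pos) ((1 + m ^+ 2) * w a t - m ^+ 2 / (2 * a) * w (a + 1) t
      - m ^+ 2 * a / 2 * w (a - 1) t).
  rewrite RintegralB// ?RintegralB//; last exact: integrable_EFinB.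
  rewrite !RintegralZl//; try exact: iw.
  rewrite -/(gph a 0 0) -/(gph (a + 1) 0 0) -/(gph (a - 1) 0 0) rec1 rec2.
  by field; rewrite !gt_eqF.
rewrite /gph; apply: le_Rintegral => //.
- by apply: integrable_EFinB => //; exact: integrable_EFinB.
- exact: gph_integrable.
move=> t /posP t0; rewrite /w mul0r addr0 cos0 !mulr1.
have -> : t `^ (a + 1 - 1) = t * t `^ (a - 1) by rewrite addrK mulr_powRB1// ltW.
have -> : t `^ (a - 1 - 1) = t^-1 * t `^ (a - 1).
  by rewrite -[in RHS]powR_inv1 ?ltW// -powRDp//; congr powR; ring.
set W := t `^ (a - 1) * expR (- t).
have W0 : 0 <= W by rewrite mulr_ge0 ?powR_ge0 ?expR_ge0.
apply: (@le_trans _ _ (W * (1 - m ^+ 2 * (t / a + (t / a)^-1 - 2) / 2))).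
  by rewrite le_eqVlt; apply/orP; left; apply/eqP; rewrite /W; field; rewrite !gt_eqF.
rewrite ler_wpM2l// (le_trans _ (cos_ge _))// lerD2l lerN2 ler_pM2r ?invr_gt0//.
rewrite -mulrN -mulrDr exprMn ler_wpM2l ?sqr_ge0// -ln_div ?posrE// ln_sqr_le//.
by rewrite divr_gt0.
Qed.

(* By the functional equation a common zero at p would persist at p + N, where
   gph_ge excludes it for large N. *)
Lemma gph_neq0 p m : 0 < p -> ~ (gph p m 0 = 0 /\ gph p m (- (pi / 2)) = 0).
Proof.
move=> p0 [c0 s0].
have H N : gph (p + N%:R) m 0 = 0 /\ gph (p + N%:R) m (- (pi / 2)) = 0.
  elim: N => [|N [IHc IHs]]; first by rewrite addr0.
  have pN : 0 < p + N%:R by rewrite ltr_wpDr.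
  rewrite -natr1 addrA !gphS// IHc IHs sub0r IHs.
  have -> : - (pi / 2) - pi / 2 = 0 - pi :> R by field.
  by rewrite gphDpi// IHc; split; ring.
(* Chosen so that a = p + N satisfies m^2 < 2 (a - 1), which makes the lower bound of [gph_ge]
   positive. *)
pose N := (Num.truncn (1 + m ^+ 2 / 2)).+1.
have Na : 1 + m ^+ 2 / 2 < p + N%:R.
  by rewrite (lt_le_trans (truncnS_gt _))// lerDr ltW.
have a1 : 1 < p + N%:R.
  by apply: le_lt_trans Na; rewrite lerDl divr_ge0 ?sqr_ge0.
have a0 : 0 < p + N%:R by rewrite (lt_trans _ a1).
have := gph_ge m a1; rewrite -[X in gph _ m X]add0r gphD//.
have [-> ] := H N; rewrite sub0r => ->; rewrite !mulr0 subr0.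
apply/negP; rewrite -ltNge mulr_gt0 ?gph0_gt0// subr_gt0.
rewrite ltr_pdivrMr ?mulr_gt0 ?subr_gt0//; lra.
Qed.

End complex_gamma.

(** * The beta integral with an oscillating factor *)

Section beta.
Context {R : realType}.
Local Notation mu := (@lebesgue_measure R).
Local Notation pos := (`]0%R, +oo[%classic : set R).
Local Notation zpi := (`]0%R, pi[%classic : set R).
Implicit Types (p q x t : R).

(** [hcos2] is cos^2 (t / 2) and [hsin2] is sin^2 (t / 2). *)
Definition hcos2 t := (1 + cos t) / 2.
Definition hsin2 t := (1 - cos t) / 2.

Lemma cos_lt1_0pi t : 0 < t < pi -> -1 < cos t < 1.
Proof.
move=> /andP[t0 tpi]; rewrite -(@cospi R) -(@cos0 R) !ltr_cos ?t0 ?tpi//.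
- by rewrite in_itv/= !ltW.
- by rewrite in_itv/= pi_ge0/=.
- by rewrite in_itv/= lexx/= pi_ge0.
- by rewrite in_itv/= !ltW.
Qed.

Lemma hcos2_gt0 t : 0 < t < pi -> 0 < hcos2 t.
Proof. by move=> /cos_lt1_0pi /andP[c1 c2]; rewrite /hcos2; lra. Qed.

Lemma hsin2_gt0 t : 0 < t < pi -> 0 < hsin2 t.
Proof. by move=> /cos_lt1_0pi /andP[c1 c2]; rewrite /hsin2; lra. Qed.

Lemma hcos2_le1 t : 0 <= hcos2 t <= 1.
Proof. by have := cos_le1 t; have := cos_geN1 t; rewrite /hcos2 => *; apply/andP; split; lra. Qed.

Lemma sin_hcos2 t : 0 < t < pi -> sin t / 2 = hsin2 t `^ 2^-1 * hcos2 t `^ 2^-1.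
Proof.
move=> t0; have s0 := sin_gt0_pi t0.
have c0 := ltW (hcos2_gt0 t0); have d0 := ltW (hsin2_gt0 t0).
rewrite -powRM// powR12_sqrt ?mulr_ge0//.
apply/eqP; rewrite -(@eqrXn2 _ 2)// ?sqrtr_ge0 ?divr_ge0 1?ltW//.
rewrite sqr_sqrtr ?mulr_ge0// exprMn sin2cos2 /hsin2 /hcos2; apply/eqP.
by field.
Qed.

(* y = x tan^2 (t / 2) *)
Definition polar x t := x * ((hcos2 t)^-1 - 1).
Definition polar' x t := x * (sin t / 2) * (hcos2 t)^-1 ^+ 2.

Lemma is_derive_polar x t : 0 < t < pi -> is_derive t 1 (polar x) (polar' x t).
Proof.
move=> t0; have c0 := hcos2_gt0 t0; rewrite /polar /polar' /hcos2 in c0 *.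
by derive_tac; [rewrite gt_eqF|field; rewrite gt_eqF//; lra].
Qed.

Lemma continuous_polar' x t : 0 < t < pi -> {for t, continuous (polar' x)}.
Proof.
move=> t0; have c0 := hcos2_gt0 t0; rewrite /polar' /hcos2 in c0 *.
by continuous_tac; rewrite gt_eqF.
Qed.

Lemma polar_incr x : 0 < x -> {in zpi &, {homo polar x : s t / s < t}}.
Proof.
move=> x0 s t; rewrite !inE/= !in_itv/= => s0 t0 st.
have cs := hcos2_gt0 s0; have ct := hcos2_gt0 t0.
rewrite /polar ltr_pM2l// ltrD2r ltf_pV2 ?posrE// /hcos2 ltr_pM2r ?invr_gt0// ltrD2l.
move: s0 t0 => /andP[s0 s1] /andP[t0 t1].
by rewrite ltr_cos// in_itv/= !ltW.
Qed.

Lemma image_polar x : 0 < x -> polar x @` zpi = pos.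
Proof.
move=> x0; apply/seteqP; split => [_ [t /= + <-]|y /posP y0].
  rewrite in_itv/= => t0; apply/posP; rewrite mulr_gt0// subr_gt0.
  rewrite invf_gt1 ?hcos2_gt0// /hcos2.
  by have /andP[_ c1] := cos_lt1_0pi t0; lra.
pose g := (1 + y / x)^-1; have g1 : 0 < 1 + y / x by rewrite addr_gt0 ?divr_gt0.
have gt0 : 0 < g by rewrite invr_gt0.
have glt1 : g < 1 by rewrite invf_lt1// ltrDl divr_gt0.
have gin : -1 < 2 * g - 1 < 1 by apply/andP; split; lra.
have gin' : -1 <= 2 * g - 1 <= 1 by apply/andP; split; lra.
have cg : hcos2 (acos (2 * g - 1)) = g by rewrite /hcos2 acosK//; field.
exists (acos (2 * g - 1)).
  by rewrite /= in_itv/= acos_gt0 ?acos_ltpi//; case/andP: gin => *; apply/andP; split; lra.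
by rewrite /polar cg /g invrK; field; rewrite gt_eqF.
Qed.

Lemma exhausts_polar x : 0 < x ->
  exhausts (polar x \o (fun n => n.+2%:R^-1)) (polar x \o (fun n => pi - n.+2%:R^-1)) pos.
Proof.
move=> x0; apply: (exhausts_image exhausts_0pi (polar_incr x0) (image_polar x0)).
exact: interval_is_interval.
Qed.

Lemma measurable_hcos2 : measurable_fun [set: R] hcos2.
Proof.
apply: measurable_funM => //; apply: measurable_funD => //.
exact: continuous_measurable_fun (@continuous_cos R).
Qed.

(** The classical change from (x, y) to x + y and y / (x + y), done in one-dimensional steps: y = x
    tan^2 (t / 2) in the inner integral, then Tonelli, then the scaling r = x / cos^2 (t / 2). In
    these variables r = x + y and y = r sin^2 (t / 2). *)
Lemma beta_tonelli p (k : R -> R) : 0 < p ->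
  measurable_fun setT k -> (forall x, 0 < x -> {for x, continuous k}) ->
  (forall x, 0 <= k x) ->
  (\int[mu]_(x in pos) ((x `^ (p - 1) * expR (- x))%:E *
     \int[mu]_(y in pos) (y `^ (2^-1 - 1) * expR (- y) * k y)%:E) =
   \int[mu]_(t in zpi) ((hcos2 t `^ (p - 2^-1))%:E *
     \int[mu]_(r in pos) (r `^ (p + 2^-1 - 1) * expR (- r) * k (r * hsin2 t))%:E))%E.
Proof.
move=> p0 mk ck k0.
pose G (y : R) := y `^ (2^-1 - 1) * expR (- y) * k y.
have G0 y : 0 <= G y by rewrite !mulr_ge0 ?powR_ge0 ?expR_ge0.
have cG y : pos y -> {for y, continuous G}.
  by move=> /posP y0; apply: gamma_continuous => //; exact: ck.
have mexp : measurable_fun setT (fun t : R => expR (- t)).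
  by apply: (measurableT_comp (f := @expR R)) => //; exact: measurable_expR.
have mG : measurable_fun setT G.
  apply: measurable_funM => //; apply: measurable_funM => //; exact: measurable_powR.
have mw : measurable_fun setT (fun x : R => x `^ (p - 1) * expR (- x)).
  by apply: measurable_funM => //; exact: measurable_powR.
pose f x t := x `^ (p - 1) * expR (- x) * (G (polar x t) * `|polar' x t|).
have mc : measurable_fun setT (fun q : R * R => (hcos2 q.2)^-1).
  apply: (measurableT_comp (f := fun u : R => u^-1)); first exact: measurable_inv.
  exact: (measurableT_comp measurable_hcos2 measurable_snd).
have mf : measurable_fun setT (fun q : R * R => f q.1 q.2).
  apply: measurable_funM; first exact: (measurableT_comp mw measurable_fst).
  apply: measurable_funM.
    apply: (measurableT_comp mG); apply: measurable_funM; first exact: measurable_fst.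
    exact: measurable_funB.
  apply: (measurableT_comp (f := fun u : R => `|u|)) => //.
  apply: measurable_funM; last exact: measurable_funX.
  apply: measurable_funM; first exact: measurable_fst.
  apply: measurable_funM => //.
  exact: (measurableT_comp (continuous_measurable_fun (@continuous_sin R)) measurable_snd).
transitivity (\int[mu]_(x in pos) \int[mu]_(t in zpi) (f x t)%:E)%E.
  apply: eq_integral => x; rewrite inE => /posP x0.
  have dP t : zpi t -> is_derive t 1 (polar x) (polar' x t).
    by rewrite /= in_itv/=; exact: is_derive_polar.
  have cP t : zpi t -> {for t, continuous (polar' x)}.
    by rewrite /= in_itv/=; exact: continuous_polar'.
  have P0 t : zpi t -> 0 <= polar' x t.
    rewrite /= in_itv/= => t0; rewrite /polar'.
    apply: mulr_ge0; last by rewrite sqr_ge0.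
    by rewrite mulr_ge0 ?divr_ge0// ltW// sin_gt0_pi.
  rewrite (ge0_integration_by_substitution_exhausts exhausts_0pi (exhausts_polar x0)
    dP cP (polar_incr x0) P0 cG (fun y _ => G0 y)).
  rewrite -ge0_integralZl//=; last 3 first.
  - apply/measurable_EFinP; apply: measurable_funM.
      apply: (measurable_comp (F := setT)) => //.
      apply: (continuous_measurable_exhausts exhausts_0pi) => t tz.
      exact: is_derive_continuous (dP t tz).
    exact: (continuous_measurable_exhausts exhausts_0pi).
  - by move=> t tz; rewrite lee_fin mulr_ge0// P0.
  - by rewrite lee_fin mulr_ge0 ?powR_ge0 ?expR_ge0.
  apply: eq_integral => t; rewrite inE/= in_itv/= => t0.
  by rewrite -EFinM /f ger0_norm// P0// /= in_itv.
rewrite fubini_tonelli_on//; last by move=> x y; rewrite !mulr_ge0 ?powR_ge0 ?expR_ge0.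
apply: eq_integral => t; rewrite inE/= in_itv/= => t0.
have c0 := hcos2_gt0 t0; have s0 := hsin2_gt0 t0; have sin0 := sin_gt0_pi t0.
pose B := (hcos2 t)^-1; have B0 : 0 < B by rewrite invr_gt0.
have B1 : 0 < B - 1.
  by rewrite subr_gt0 invf_gt1// /hcos2; have /andP[_ c1] := cos_lt1_0pi t0; lra.
have B1E : B - 1 = hsin2 t * B.
  by rewrite /B /hsin2; move: c0; rewrite /hcos2 => c0; field; rewrite gt_eqF//; lra.
(* The power - 1 / 2 of sin^2 (t / 2) cancels against the sine in the Jacobian, so that only a power
   of cos^2 (t / 2) remains. *)
have csE : (B - 1) `^ (2^-1 - 1) * (sin t / 2) * B ^+ 2 * B `^ (- (p + 2^-1)) =
    hcos2 t `^ (p - 2^-1).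
  rewrite B1E sin_hcos2// powRM ?ltW//.
  have -> : hcos2 t = B `^ (-1) by rewrite powR_inv1 ?ltW// /B invrK.
  rewrite -!powRrM -powR_mulrn ?ltW//.
  transitivity ((hsin2 t `^ (2^-1 - 1) * hsin2 t `^ 2^-1) *
    (B `^ (2^-1 - 1) * B `^ (-1 * 2^-1) * B `^ 2%:R * B `^ (- (p + 2^-1)))); first by ring.
  rewrite -!powRDp// (_ : 2^-1 - 1 + 2^-1 = 0); last by field.
  by rewrite powRr0 mul1r; congr powR; field.
pose k' r := k (r * hsin2 t).
have ck' x : 0 < x -> {for x, continuous k'}.
  move=> x0; apply: (cvg_comp (fun r => r * hsin2 t) k).
    by apply: cvgM; [exact: cvg_id|exact: cvg_cst].
  by apply: ck; rewrite mulr_gt0.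
have := integral_gammaE (p + 2^-1) B0 ck' (fun x => k0 _).
set I := (\int[mu]_(r in pos) (r `^ _ * _ * k' r)%:E)%E => IE.
rewrite -/I -csE EFinM -muleA -IE -ge0_integralZl//=; last 3 first.
- apply/measurable_EFinP; apply: measurable_funTS; apply: measurable_funM.
    apply: measurable_funM; first exact: measurable_powR.
    apply: (measurableT_comp (f := fun u : R => expR (- u)) mexp).
    exact: measurable_funM.
  apply: (measurableT_comp mk); apply: measurable_funM => //.
  exact: measurable_funM.
- by move=> x _; rewrite lee_fin !mulr_ge0 ?powR_ge0 ?expR_ge0//; exact: k0.
- by rewrite lee_fin !mulr_ge0 ?powR_ge0 ?sqr_ge0// ?divr_ge0// ltW.
apply: eq_integral => x; rewrite inE => /posP x0.
rewrite -EFinM /f /G /k' /polar -/B; congr EFin.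
rewrite ger0_norm; last by rewrite /polar' !mulr_ge0 ?sqr_ge0// ?divr_ge0// ltW.
rewrite /polar' -/B (_ : x * B * hsin2 t = x * (B - 1)); last by rewrite B1E; ring.
have -> : expR (- (x * B)) = expR (- x) * expR (- (x * (B - 1))).
  by rewrite -expRD; congr expR; ring.
have -> : x `^ (p + 2^-1 - 1) = x `^ (p - 1) * x `^ (2^-1 - 1) * x.
  rewrite -[X in _ * _ * X](powRr1 (ltW x0)) -!powRDp//; congr powR; by field.
rewrite powRM ?ltW//; ring.
Qed.

Lemma gph_scale p m th s : 0 < s ->
  \int[mu]_(r in pos) (r `^ (p - 1) * expR (- r) * cos (m * ln (r * s) + th)) =
  gph p m (m * ln s + th).
Proof.
move=> s0; apply: eq_Rintegral => r; rewrite inE => /posP r0.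
by rewrite lnM ?posrE// mulrDr addrA.
Qed.

(** Boundedness of [k] makes the inner integrals finite, which turns the identity of extended
    integrals into one with real inner integrals. *)
Lemma beta_bounded p (k : R -> R) M : 0 < p ->
  measurable_fun setT k -> (forall x, 0 < x -> {for x, continuous k}) ->
  (forall x, 0 <= k x <= M) ->
  (\int[mu]_(t in zpi) (hcos2 t `^ (p - 2^-1) *
     \int[mu]_(r in pos) (r `^ (p + 2^-1 - 1) * expR (- r) * k (r * hsin2 t))%R)%:E =
   (gph p 0 0 * \int[mu]_(y in pos) (y `^ (2^-1 - 1) * expR (- y) * k y)%R)%:E)%E.
Proof.
move=> p0 mk ck k0M; have k0 x : 0 <= k x by have /andP[] := k0M x.
have kM : exists M : R, forall x, `|k x| <= M.
  by exists M => x; rewrite ger0_norm//; have /andP[] := k0M x.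
have h0 : 0 < 2^-1 :> R by [].
have ph0 : 0 < p + 2^-1 by rewrite addr_gt0.
have ik t : mu.-integrable pos (fun r => (r `^ (p + 2^-1 - 1) * expR (- r) * k (r * hsin2 t))%:E).
  apply: gamma_integrable => //; first by apply: (measurableT_comp mk); exact: measurable_funM.
  by have [M' kM'] := kM; exists M'.
under eq_integral do rewrite EFinM -fine_integral//.
rewrite -beta_tonelli// EFinM -(fine_integral measurable_pos (gamma_integrable h0 mk kM)).
rewrite /gph -(fine_integral measurable_pos (gph_integrable 0 0 p0)).
rewrite -ge0_integralZr//=.
- by apply: eq_integral => t _; rewrite mul0r addr0 cos0 mulr1.
- by have /integrableP[] := gph_integrable 0 0 p0.
- move=> t _; rewrite lee_fin mul0r addr0 cos0 mulr1.
  by rewrite mulr_ge0 ?powR_ge0 ?expR_ge0.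
- by apply: integral_ge0 => t _; rewrite lee_fin !mulr_ge0 ?powR_ge0 ?expR_ge0.
Qed.

(* The identity B(p, 1/2 + i m) Gamma(p + 1/2 + i m) = Gamma(p) Gamma(1/2 + i m)
   in real form; the phase th selects the real or the imaginary part. *)
Lemma beta_gph p m th : 2^-1 <= p ->
  gph p 0 0 * gph 2^-1 m th =
  \int[mu]_(t in zpi) (hcos2 t `^ (p - 2^-1) * gph (p + 2^-1) m (m * ln (hsin2 t) + th)).
Proof.
move=> p12; have p0 : 0 < p by rewrite (lt_le_trans _ p12).
have h0 : 0 < 2^-1 :> R by [].
have ph0 : 0 < p + 2^-1 by rewrite addr_gt0.
pose g x := cos (m * ln x + th).
have mg : measurable_fun setT g by exact: measurable_cosln.
have cg x : 0 < x -> {for x, continuous (fun x => 1 + g x)}.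
  by move=> x0; rewrite /g; continuous_tac.
have c1 x : 0 < x -> {for x, continuous (fun=> 1 : R)} by move=> _; exact: cvg_cst.
have g1 x : 0 <= 1 + g x <= 2.
  have := cos_geN1 (m * ln x + th); have := cos_le1 (m * ln x + th).
  by rewrite -/(g x) => *; apply/andP; split; lra.
have g01 (x : R) : 0 <= (1 : R) <= 1 by rewrite ler01 lexx.
(* The cosine changes sign, so the nonnegative case is applied to 1 and to 1 + cos and the two
   results are subtracted. *)
have b1 := beta_bounded p0 (@measurable_cst _ _ _ _ _ (1 : R)) c1 g01.
have b2 := beta_bounded p0 (measurable_funD (@measurable_cst _ _ _ _ _ (1 : R)) mg) cg g1.
have one q : 0 < q -> \int[mu]_(r in pos) (r `^ (q - 1) * expR (- r) * 1) = gph q 0 0.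
  by move=> q0; apply: eq_Rintegral => r _; rewrite mul0r addr0 cos0.
have i1 q : 0 < q -> mu.-integrable pos (fun r => (r `^ (q - 1) * expR (- r) * 1)%:E).
  by move=> q0; apply: gamma_integrable => //; exists 1 => x; rewrite normr1.
have split q s : 0 < q -> 0 < s ->
    \int[mu]_(r in pos) (r `^ (q - 1) * expR (- r) * (1 + g (r * s))) =
    gph q 0 0 + gph q m (m * ln s + th).
  move=> q0 s0; under eq_Rintegral do rewrite mulrDr.
  rewrite RintegralD//; first by rewrite one// gph_scale.
  - exact: i1.
  - apply: gamma_integrable => //; first by apply: (measurableT_comp mg); exact: measurable_funM.
    by exists 1 => x; exact: normr_cos_le1.
pose W t := hcos2 t `^ (p - 2^-1).
pose X t := gph (p + 2^-1) m (m * ln (hsin2 t) + th).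
have mW : measurable_fun setT W.
  exact: (measurableT_comp (measurable_powR (p - 2^-1)) measurable_hcos2).
have mX : measurable_fun setT X.
  have -> : X = (fun t => cos (m * ln (hsin2 t) + th) * gph (p + 2^-1) m 0 -
                  sin (m * ln (hsin2 t) + th) * gph (p + 2^-1) m (0 - pi / 2)).
    by apply/funext => t; rewrite /X -[X in gph _ _ X]add0r gphD.
  have ml : measurable_fun setT (fun t : R => m * ln (hsin2 t) + th).
    apply: measurable_funD => //; apply: measurable_funM => //.
    apply: (measurableT_comp (@measurable_ln R)); apply: measurable_funM => //.
    by apply: measurable_funB => //; exact: (continuous_measurable_fun (@continuous_cos R)).
  apply: measurable_funB; apply: measurable_funM => //.
    exact: (measurableT_comp (continuous_measurable_fun (@continuous_cos R)) ml).
  exact: (measurableT_comp (continuous_measurable_fun (@continuous_sin R)) ml).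
have e1 : (\int[mu]_(t in zpi) (W t * gph (p + 2^-1) 0 0)%:E =
    (gph p 0 0 * gph 2^-1 0 0)%:E)%E.
  by rewrite /= !one// in b1; rewrite -b1; apply: eq_integral => t _; rewrite one.
have e2 : (\int[mu]_(t in zpi) (W t * (gph (p + 2^-1) 0 0 + X t))%:E =
    (gph p 0 0 * (gph 2^-1 0 0 + gph 2^-1 m th))%:E)%E.
  transitivity ((gph p 0 0 * \int[mu]_(r in pos) (r `^ (2^-1 - 1) * expR (- r) * (1 + g r)))%:E)%E;
      last first.
    congr (_ %:E); congr (_ * _).
    have := split _ _ h0 ltr01; rewrite ln1 mulr0 add0r => <-.
    by apply: eq_Rintegral => r _; rewrite mulr1.
  rewrite -b2; apply: eq_integral => t; rewrite inE/= in_itv/= => t0.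
  by rewrite split// hsin2_gt0.
have iW : mu.-integrable zpi (fun t => (W t * gph (p + 2^-1) 0 0)%:E).
  apply/integrableP; split.
    by apply/measurable_EFinP; apply: measurable_funTS; exact: measurable_funM.
  under eq_integral do rewrite gee0_abs ?lee_fin ?mulr_ge0 ?powR_ge0 ?ltW ?gph0_gt0//.
  by rewrite e1 ltry.
have X0 t : 0 < hsin2 t -> 0 <= gph (p + 2^-1) 0 0 + X t.
  move=> s0; rewrite -split//; apply: Rintegral_ge0 => r _.
  by rewrite !mulr_ge0 ?powR_ge0 ?expR_ge0//; have /andP[] := g1 (r * hsin2 t).
have iX : mu.-integrable zpi (fun t => (W t * (gph (p + 2^-1) 0 0 + X t))%:E).
  apply/integrableP; split.
    apply/measurable_EFinP; apply: measurable_funTS; apply: measurable_funM => //.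
    exact: measurable_funD.
  rewrite (_ : (\int[mu]_(t in _) _)%E = (gph p 0 0 * (gph 2^-1 0 0 + gph 2^-1 m th))%:E) ?ltry//.
  rewrite -e2; apply: eq_integral => t; rewrite inE/= in_itv/= => t0.
  by rewrite /= ger0_norm// mulr_ge0 ?powR_ge0// X0// hsin2_gt0.
have mz : @measurable _ (measurableTypeR R) zpi by exact: measurable_itv.
transitivity (\int[mu]_(t in zpi) (W t * (gph (p + 2^-1) 0 0 + X t)) -
              \int[mu]_(t in zpi) (W t * gph (p + 2^-1) 0 0)).
  by rewrite /Rintegral e1 e2/= -mulrBr addrAC subrr add0r.
rewrite -RintegralB//; apply: eq_Rintegral => t _; rewrite /W /X; ring.
Qed.

End beta.

(** * Hyperbolic distance *)

Section dot_product.
Context {R : realType} {n : nat}.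
Implicit Types (x y z : 'rV[R]_n) (a b : R).

Definition dotv x y : R := \sum_(i < n) x ord0 i * y ord0 i.

Lemma enorm_sqr x : enorm x ^+ 2 = dotv x x.
Proof.
rewrite sqr_sqrtr; first by apply: eq_bigr => i _; rewrite expr2.
by apply: sumr_ge0 => i _; rewrite sqr_ge0.
Qed.

Lemma dotv_ge0 x : 0 <= dotv x x.
Proof. by rewrite -enorm_sqr sqr_ge0. Qed.

Lemma enormE x : enorm x = Num.sqrt (dotv x x).
Proof. by rewrite -enorm_sqr sqrtr_sqr ger0_norm// sqrtr_ge0. Qed.

Lemma dotvC x y : dotv x y = dotv y x.
Proof. by apply: eq_bigr => i _; rewrite mulrC. Qed.

Lemma dotvDl x y z : dotv (x + y) z = dotv x z + dotv y z.
Proof. by rewrite -big_split/=; apply: eq_bigr => i _; rewrite mxE mulrDl. Qed.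

Lemma dotvNl x z : dotv (- x) z = - dotv x z.
Proof. by rewrite -sumrN; apply: eq_bigr => i _; rewrite mxE mulNr. Qed.

Lemma dotvZl a x z : dotv (a *: x) z = a * dotv x z.
Proof. by rewrite mulr_sumr; apply: eq_bigr => i _; rewrite mxE mulrA. Qed.

Lemma dotvDr x y z : dotv z (x + y) = dotv z x + dotv z y.
Proof. by rewrite dotvC dotvDl !(dotvC z). Qed.

Lemma dotvNr x z : dotv z (- x) = - dotv z x.
Proof. by rewrite dotvC dotvNl (dotvC z). Qed.

Lemma dotvZr a x z : dotv z (a *: x) = a * dotv z x.
Proof. by rewrite dotvC dotvZl (dotvC z). Qed.

Definition dotvE := (dotvDl, dotvNl, dotvZl, dotvDr, dotvNr, dotvZr).

Lemma dotv0 x : dotv 0 x = 0.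
Proof. by rewrite -(scale0r x) dotvZl mul0r. Qed.

Lemma dotv_eq0 x : dotv x x = 0 -> x = 0.
Proof.
move=> /eqP; rewrite psumr_eq0; last by move=> i _; rewrite -expr2 sqr_ge0.
move=> /allP x0; apply/rowP => i; rewrite mxE.
by have := x0 i (mem_index_enum _); rewrite -expr2 sqrf_eq0 => /eqP.
Qed.

Lemma dotv_cauchy x y : dotv x y ^+ 2 <= dotv x x * dotv y y.
Proof.
have [y0|y0] := eqVneq (dotv y y) 0.
  rewrite y0 (dotv_eq0 y0); have -> : (0 : 'rV[R]_n) = 0 *: 0 by rewrite scale0r.
  by rewrite dotvZr mul0r expr0n mulr0.
have yy0 : 0 < dotv y y by rewrite lt_neqAle eq_sym y0 dotv_ge0.
have := dotv_ge0 (dotv y y *: x - dotv x y *: y).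
rewrite !dotvE (dotvC y x).
set X := dotv x x; set Y := dotv y y; set Z := dotv x y.
rewrite (_ : _ + _ = Y * (X * Y - Z ^+ 2)); last by ring.
by rewrite pmulr_rge0// subr_ge0.
Qed.

Lemma uballE x : uball x = (dotv x x < 1) :> Prop.
Proof. by rewrite /uball/= enormE -[in LHS](@sqrtr1 R) ltr_sqrt. Qed.

End dot_product.

Section acosh.
Context {R : realType}.
Implicit Types u v : R.
Local Notation cosh := Defs.cosh.
Local Notation sinh := Defs.sinh.

Definition acosh u : R := ln (u + Num.sqrt (u ^+ 2 - 1)).

Lemma acosh_arg_gt0 u : 1 <= u -> 0 < u + Num.sqrt (u ^+ 2 - 1).
Proof. by move=> u1; rewrite ltr_wpDr ?sqrtr_ge0// (lt_le_trans _ u1). Qed.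

Lemma sqr_subr1_ge0 u : 1 <= u -> 0 <= u ^+ 2 - 1.
Proof. by move=> u1; rewrite subr_ge0 expr_ge1// (le_trans _ u1). Qed.

Lemma acoshK u : 1 <= u -> cosh (acosh u) = u.
Proof.
move=> u1; have h := acosh_arg_gt0 u1.
rewrite /cosh /acosh expRN lnK ?posrE//.
have := sqr_sqrtr (sqr_subr1_ge0 u1); set w := Num.sqrt _ in h *.
move=> w2; have -> : (u + w)^-1 = u - w.
  by apply: (mulfI (lt0r_neq0 h)); rewrite divff ?gt_eqF//; have : w ^+ 2 = u ^+ 2 - 1 by []; nra.
by field.
Qed.

Lemma sinh_acosh u : 1 <= u -> sinh (acosh u) = Num.sqrt (u ^+ 2 - 1).
Proof.
move=> u1; have h := acosh_arg_gt0 u1.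
rewrite /sinh /acosh expRN lnK ?posrE//.
have := sqr_sqrtr (sqr_subr1_ge0 u1); set w := Num.sqrt _ in h *.
move=> w2; have -> : (u + w)^-1 = u - w.
  by apply: (mulfI (lt0r_neq0 h)); rewrite divff ?gt_eqF//; have : w ^+ 2 = u ^+ 2 - 1 by []; nra.
by field.
Qed.

Lemma acosh1 : acosh 1 = 0.
Proof. by rewrite /acosh expr1n subrr sqrtr0 addr0 ln1. Qed.

Lemma acosh_ge0 u : 1 <= u -> 0 <= acosh u.
Proof. by move=> u1; rewrite ln_ge0// (le_trans u1)// lerDl sqrtr_ge0. Qed.

Lemma is_derive_acosh u : 1 < u -> is_derive u 1 acosh (Num.sqrt (u ^+ 2 - 1))^-1.
Proof.
move=> u1; have h := acosh_arg_gt0 (ltW u1).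
have w0 : 0 < u ^+ 2 - 1 by rewrite subr_gt0 expr_gt1// ltW// (lt_trans _ u1).
have s0 : 0 < Num.sqrt (u ^+ 2 - 1) by rewrite sqrtr_gt0.
rewrite /acosh; derive_tac => //.
by field; rewrite !gt_eqF.
Qed.

(** At u = 1 [acosh] is continuous but not differentiable; this limit removes the shift by d used to
    stay away from 1. *)
Lemma continuous_acosh_shift u : 1 <= u ->
  acosh (u + d) @[d --> (0 : R)^'+] --> acosh u.
Proof.
move=> u1; rewrite /acosh.
have h := acosh_arg_gt0 u1.
apply: (cvg_comp _ (@ln R)); last exact: continuous_ln h.
have cu : u + d @[d --> (0 : R)^'+] --> u.
  rewrite -[X in _ --> X]addr0; apply: cvgD; first exact: cvg_cst.
  by apply: cvg_at_right_filter; exact: cvg_id.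
apply: cvgD => //; apply: (cvg_comp _ (@Num.sqrt R)).
  by apply: cvgB; [apply: cvgM; exact: cu|exact: cvg_cst].
exact: sqrt_continuous.
Qed.

End acosh.

Section hyperbolic_distance.
Context {R : realType} {n : nat}.
Local Notation mu := (@lebesgue_measure R).
Implicit Types (x y : 'rV[R]_n).
Local Notation cosh := Defs.cosh.
Local Notation sinh := Defs.sinh.

(* cosh of the hyperbolic distance, minus 1 *)
Definition hgap x y : R :=
  2 * dotv (x - y) (x - y) / ((1 - dotv x x) * (1 - dotv y y)).

Lemma hgap_ge0 x y : uball x -> uball y -> 0 <= hgap x y.
Proof.
rewrite !uballE => x1 y1; rewrite divr_ge0 ?mulr_ge0 ?dotv_ge0// ?subr_ge0 ltW//.
Qed.

Lemma is_derive_sumf k (h : 'I_k -> R -> R) (dh : 'I_k -> R) (t : R) :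
  (forall i, is_derive t 1 (h i) (dh i)) ->
  is_derive t 1 (fun s => \sum_(i < k) h i s) (\sum_(i < k) dh i).
Proof.
move=> dhi; have := is_derive_sum dhi.
by rewrite (_ : \sum_(i < k) h i = fun s => \sum_(i < k) h i s)//; apply/funext => s; rewrite fct_sumE.
Qed.

Lemma is_derive_coord (c : R -> 'rV[R]_n) (t : R) i : derivable c t 1 ->
  is_derive t 1 (fun s => c s ord0 i) (derive1 c t ord0 i).
Proof.
move=> dc; have dci := (derivable_mxP c t 1).1 dc ord0 i.
apply: DeriveDef => //; by rewrite derive1E derive_mx// mxE.
Qed.

Lemma is_derive_dotv (c e : R -> 'rV[R]_n) (dc de : 'rV[R]_n) (t : R) :
  (forall i, is_derive t 1 (fun s => c s ord0 i) (dc ord0 i)) ->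
  (forall i, is_derive t 1 (fun s => e s ord0 i) (de ord0 i)) ->
  is_derive t 1 (fun s => dotv (c s) (e s)) (dotv dc (e t) + dotv (c t) de).
Proof.
move=> hc he; rewrite /dotv -big_split/=; apply: is_derive_sumf => i.
exact: is_derive1Mf.
Qed.

(** The inequality on [du] says that the derivative of acosh u is at most l. Since acosh is singular
    at 1, where u starts, the fundamental theorem of calculus is applied to acosh (u + d), and d
    tends to 0. *)
Lemma acosh_le_length (u du l : R -> R) :
  (forall t : R, 0 <= t <= 1 -> is_derive t 1 u (du t)) ->
  (forall t : R, 0 <= t <= 1 -> {for t, continuous du}) ->
  (forall t : R, 0 <= t <= 1 -> {for t, continuous l}) ->
  (forall t : R, 0 <= t <= 1 -> 0 <= l t) -> (forall t : R, 0 <= t <= 1 -> 1 <= u t) ->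
  (forall t : R, 0 <= t <= 1 -> du t ^+ 2 <= (u t ^+ 2 - 1) * l t ^+ 2) -> u 0 = 1 ->
  acosh (u 1) <= \int[mu]_(t in `[0, 1]) l t.
Proof.
move=> hu cdu cl l0 u1 dul u01.
have t01 : 0 <= (1 : R) <= 1 by rewrite ler01 lexx.
pose w (d t : R) := Num.sqrt ((u t + d) ^+ 2 - 1).
have w0 (d t : R) : 0 < d -> 0 <= t <= 1 -> 0 < (u t + d) ^+ 2 - 1.
  move=> d0 t0; have ut := u1 t t0.
  nra.
have H (d : R) : 0 < d -> acosh (u 1 + d) - acosh (1 + d) <= \int[mu]_(t in `[0, 1]) l t.
  move=> d0.
  have dphi (t : R) : 0 <= t <= 1 -> is_derive t 1 (fun t => acosh (u t + d)) (du t / w d t).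
    move=> t0; have ut := u1 t t0; have ht := hu t t0.
    have ud : 1 < u t + d by rewrite (le_lt_trans ut)// ltrDl.
    have dd := is_derive_acosh ud.
    have dg : is_derive t 1 (fun t => u t + d) (du t + 0) by derive_expr.
    suff -> : du t / w d t = (Num.sqrt ((u t + d) ^+ 2 - 1))^-1 * (du t + 0).
      exact: (@is_derive1_compf R acosh (fun t => u t + d) t _ _ dd dg).
    by rewrite /w addr0 mulrC.
  have cphi (t : R) : 0 <= t <= 1 -> {for t, continuous (fun t => du t / w d t)}.
    move=> t0; apply: cvgM; first exact: cdu.
    have ht := hu t t0.
    apply: (is_derive_continuous (f := fun t => (w d t)^-1)); rewrite /w.
    by derive_expr; rewrite ?w0// gt_eqF// sqrtr_gt0 w0.
  have il : mu.-integrable `[0%R, 1%R] (fun t => (l t)%:E).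
    apply: continuous_compact_integrable; first exact: segment_compact.
    by apply: continuous_in_subspaceT => t; rewrite inE/= in_itv/=; exact: cl.
  have iphi : mu.-integrable `[0%R, 1%R] (fun t => (du t / w d t)%:E).
    apply: continuous_compact_integrable; first exact: segment_compact.
    by apply: continuous_in_subspaceT => t; rewrite inE/= in_itv/=; exact: cphi.
  have <- : \int[mu]_(t in `[0, 1]) (du t / w d t) = acosh (u 1 + d) - acosh (1 + d).
    rewrite /Rintegral (continuous_FTC2 (F := fun t => acosh (u t + d)))//.
    - by rewrite u01.
    - by apply: continuous_in_subspaceT => t; rewrite inE/= in_itv/=; exact: cphi.
    - split.
      + move=> t; rewrite in_itv/= => /andP[t0 t1].
        by have [] := dphi t; rewrite ?ltW.
      + by apply: cvg_at_right_filter; apply: is_derive_continuous (dphi 0 _); rewrite lexx ler01.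
      + by apply: cvg_at_left_filter; apply: is_derive_continuous (dphi 1 _).
    - move=> t; rewrite in_itv/= => /andP[t0 t1].
      by rewrite derive1E; apply: (@derive_val _ _ _ _ _ _ _ (dphi t _)); rewrite !ltW.
  apply: le_Rintegral => // t; rewrite /= in_itv/= => t0.
  have wt : 0 < w d t by rewrite sqrtr_gt0 w0.
  rewrite ler_pdivrMr// (le_trans (ler_norm _))//.
  rewrite -sqrtr_sqr -(ger0_norm (mulr_ge0 (l0 t t0) (ltW wt))) -sqrtr_sqr ler_wsqrtr//.
  rewrite exprMn [leRHS]mulrC sqr_sqrtr; last exact/ltW/w0.
  apply: (le_trans (dul t t0)); rewrite ler_wpM2r ?sqr_ge0// lerD2r.
  have ut := u1 t t0.
  by rewrite ler_sqr ?nnegrE ?addr_ge0 ?(le_trans _ ut) ?ltW// ltrDl.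
have cl1 : acosh (u 1 + d) - acosh (1 + d) @[d --> (0 : R)^'+] --> acosh (u 1) - acosh 1.
  by apply: cvgB; apply: continuous_acosh_shift => //; exact: u1.
rewrite acosh1 subr0 in cl1.
apply: (ler_cvg_to cl1 (cvg_cst _)).
by near=> d; apply: H; near: d; exact: nbhs_right_gt.
Unshelve. all: by end_near. Qed.

(** With u(t) the cosh of the distance from x to [c t], the claim reduces to u'^2 <= (u^2 - 1) l^2,
    where l is the hyperbolic speed: the gradient of cosh rho has hyperbolic length sinh rho. *)
Lemma hdist_ge c x y : uball x -> C1_curve c x y -> acosh (1 + hgap x y) <= hlength c.
Proof.
move=> xb [dc cdc cb c0 c1].
pose N t := dotv (x - c t) (x - c t); pose D t := 1 - dotv (c t) (c t).
pose u t := 1 + 2 * N t / ((1 - dotv x x) * D t).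
pose dN t := - 2 * dotv (x - c t) (derive1 c t); pose dD t := - 2 * dotv (c t) (derive1 c t).
pose du t := 2 / (1 - dotv x x) * (dN t * D t - N t * dD t) / D t ^+ 2.
have x0 : 0 < 1 - dotv x x by rewrite subr_gt0 -uballE.
have D0 (t : R) : 0 <= t <= 1 -> 0 < D t by move=> /cb; rewrite uballE subr_gt0.
have hci (t : R) i := is_derive_coord i (dc t).
have hN (t : R) : is_derive t 1 N (dN t).
  apply: is_derive_eq.
    apply: (is_derive_dotv (dc := - derive1 c t) (de := - derive1 c t)) => i;
    (apply: (is_derive_eq (f' := 0 - derive1 c t ord0 i)); last by rewrite mxE sub0r);
    have -> : (fun s => (x - c s) ord0 i) = (fun s => x ord0 i - c s ord0 i)
      by [apply/funext => s; rewrite !mxE]; derive_expr; exact: hci.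
  by rewrite /= /dN !dotvE !(dotvC (derive1 c t)); ring.
have hD (t : R) : is_derive t 1 D (dD t).
  have h := is_derive_dotv (hci t) (hci t).
  by rewrite /D; derive_tac; rewrite /dD (dotvC (derive1 c t)); ring.
have -> : acosh (1 + hgap x y) = acosh (u 1) by rewrite /u /N /D c1.
rewrite /hlength.
have cdi i (t : R) : {for t, continuous (fun s => derive1 c s ord0 i)}.
  apply: (cvg_comp (derive1 c) (fun z : 'rV[R]_n => z ord0 i)); first exact: cdc.
  exact: coord_continuous.
have cdot (e : R -> 'rV[R]_n) (t : R) : (forall i, {for t, continuous (fun s => e s ord0 i)}) ->
    {for t, continuous (fun s => dotv (e s) (derive1 c s))}.
  by move=> ce; apply: ctp_sum => i; apply: cvgM; [exact: ce|exact: cdi].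
have cci i (t : R) : {for t, continuous (fun s => c s ord0 i)} by exact: is_derive_continuous (hci t i).
pose l t := 2 / (1 - enorm (c t) ^+ 2) * enorm (derive1 c t).
change (acosh (u 1) <= \int[mu]_(t in `[0, 1]) l t).
apply: (@acosh_le_length u du l).
- move=> t t0; have Dt := D0 t t0; have h1 := hN t; have h2 := hD t.
  rewrite /u; derive_tac; first by rewrite mulf_neq0 ?gt_eqF.
  by rewrite /du; field; rewrite !gt_eqF.
- move=> t t0; have Dt := D0 t t0.
  have cD := is_derive_continuous (hD t); have cN := is_derive_continuous (hN t).
  have cdN : {for t, continuous dN}.
    apply: cvgM; first exact: cvg_cst.
    apply: cdot => i; rewrite (_ : (fun s => _) = (fun s => x ord0 i - c s ord0 i)).
      by apply: cvgB; [exact: cvg_cst|exact: cci].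
    by apply/funext => s; rewrite !mxE.
  have cdD : {for t, continuous dD} by apply: cvgM; [exact: cvg_cst|exact: cdot].
  apply: cvgM; last first.
    by apply: cvgV; [rewrite sqrf_eq0 gt_eqF|apply: cvgM].
  apply: cvgM; first exact: cvg_cst.
  by apply: cvgB; apply: cvgM.
- move=> t t0; have Dt := D0 t t0; have cD := is_derive_continuous (hD t).
  apply: cvgM.
    apply: cvgM; first exact: cvg_cst.
    rewrite (_ : (fun s => _) = (fun s => (D s)^-1)); last first.
      by apply/funext => s; rewrite enorm_sqr.
    by rewrite enorm_sqr; apply: (cvgV (f := D)); rewrite ?gt_eqF.
  rewrite (_ : (fun s => _) = (fun s => Num.sqrt (dotv (derive1 c s) (derive1 c s)))); last first.
    by apply/funext => s; rewrite enormE.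
  apply: (cvg_comp _ (@Num.sqrt R)); last exact: sqrt_continuous.
  exact: cdot.
- move=> t t0; have Dt := D0 t t0; rewrite /l enorm_sqr mulr_ge0 ?sqrtr_ge0//.
  by rewrite divr_ge0// ltW.
- move=> t t0; have Dt := D0 t t0; rewrite /u lerDl divr_ge0 ?mulr_ge0 ?dotv_ge0// ltW//.
- move=> t t0; have Dt := D0 t t0; set e := derive1 c t.
  (* Up to a positive factor [w] is the Euclidean gradient of u at [c t], so Cauchy-Schwarz for [w]
     and the velocity is exactly the required inequality. *)
  pose w := - D t *: (x - c t) + N t *: c t.
  have CS := dotv_cauchy w e.
  have ww : dotv w w = N t * (N t + D t * (1 - dotv x x)).
    rewrite /w /N /D !dotvE (dotvC (c t) x); ring.
  have -> : du t = 4 / ((1 - dotv x x) * D t ^+ 2) * dotv w e.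
    rewrite /du /dN /dD -/e /w !dotvE; field; by rewrite !gt_eqF.
  have -> : u t ^+ 2 - 1 = 4 * (N t * (N t + D t * (1 - dotv x x))) / ((1 - dotv x x) * D t) ^+ 2.
    rewrite /u; field; by rewrite !gt_eqF.
  have -> : l t ^+ 2 = 4 / D t ^+ 2 * dotv e e.
    rewrite /l -/e exprMn !enorm_sqr -/(D t); field; by rewrite gt_eqF.
  rewrite -ww exprMn.
  rewrite (_ : 4 * dotv w w / _ * _ = (4 / ((1 - dotv x x) * D t ^+ 2)) ^+ 2 * (dotv w w * dotv e e)).
    by rewrite ler_wpM2l// sqr_ge0.
  field; by rewrite !gt_eqF.
- by rewrite /u /N c0 subrr dotv0 mulr0 mul0r addr0.
Qed.

Lemma hgap_eq0 x y : uball x -> uball y -> hgap x y = 0 -> x = y.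
Proof.
rewrite !uballE => x1 y1 h; apply/eqP; rewrite -subr_eq0; apply/eqP/dotv_eq0.
have := congr1 (fun z => z * ((1 - dotv x x) * (1 - dotv y y))) h.
rewrite divfK ?mul0r; last by rewrite mulf_neq0// subr_eq0 gt_eqF.
by move=> /eqP; rewrite mulf_eq0 pnatr_eq0/= => /eqP.
Qed.

(* The geodesic is the projection of the hyperboloid geodesic
   (sinh ((1 - t) r) X + sinh (t r) Y) / sinh r, where X = (p0, p), Y = (q0, q)
   are the lifts of x and y and r is their distance. *)
Lemma hdist_attained x y : uball x -> uball y ->
  exists2 c, C1_curve c x y & hlength c = acosh (1 + hgap x y).
Proof.
move=> xb yb; have g0 := hgap_ge0 xb yb.
have [/(hgap_eq0 xb yb) <-{y yb g0}|gn0] := eqVneq (hgap x y) 0.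
  have g0 : hgap x x = 0 by rewrite /hgap subrr dotv0 mulr0 mul0r.
  exists (fun=> x).
    split=> //; last by move=> z; rewrite (_ : derive1 _ = fun=> 0); [exact: cvg_cst|
      apply/funext => t; rewrite derive1_cst].
  rewrite g0 addr0 acosh1 /hlength.
  under eq_Rintegral do rewrite derive1_cst [enorm 0]enormE dotv0 sqrtr0 mulr0.
  by rewrite Rintegral_cst// mul0r.
have C1 : 1 < 1 + hgap x y by rewrite ltrDl lt_neqAle eq_sym gn0.
set C := 1 + hgap x y in C1 *; set r := acosh C.
have coshr : cosh r = C by rewrite acoshK// ltW.
have sinhr : 0 < sinh r by rewrite sinh_acosh ?ltW// sqrtr_gt0 subr_gt0 expr_gt1 ?(ltW (lt_trans _ C1)).
have r0 : 0 <= r by rewrite acosh_ge0// ltW.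
have xx1 : 0 < 1 - dotv x x by rewrite subr_gt0 -uballE.
have yy1 : 0 < 1 - dotv y y by rewrite subr_gt0 -uballE.
pose p := (2 / (1 - dotv x x)) *: x; pose q := (2 / (1 - dotv y y)) *: y.
pose p0 := (1 + dotv x x) / (1 - dotv x x); pose q0 := (1 + dotv y y) / (1 - dotv y y).
have pp : dotv p p = p0 ^+ 2 - 1 by rewrite /p /p0 !dotvE; field; rewrite gt_eqF.
have qq : dotv q q = q0 ^+ 2 - 1 by rewrite /q /q0 !dotvE; field; rewrite gt_eqF.
have pq : dotv p q = p0 * q0 - C.
  by rewrite /p /q /p0 /q0 /C /hgap !dotvE (dotvC y x); field; rewrite !gt_eqF.
have pE : p = (2 / (1 - dotv x x)) *: x by [].
have qE : q = (2 / (1 - dotv y y)) *: y by [].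
clearbody p q.
have p01 : 1 <= p0 by rewrite ler_pdivlMr// mul1r; have := dotv_ge0 x; lra.
pose S := sinh r.
pose al (t : R) := sinh ((1 - t) * r) / S; pose be (t : R) := sinh (t * r) / S.
pose dal (t : R) := - r * cosh ((1 - t) * r) / S.
pose dbe (t : R) := r * cosh (t * r) / S.
have hal (t : R) : is_derive t 1 al (dal t).
  by rewrite /al /dal /Defs.sinh /Defs.cosh; derive_tac; field; rewrite ?gt_eqF.
have hbe (t : R) : is_derive t 1 be (dbe t).
  by rewrite /be /dbe /Defs.sinh /Defs.cosh; derive_tac; field; rewrite ?gt_eqF.
have cdal (t : R) : {for t, continuous dal}.
  by rewrite /dal /Defs.cosh; continuous_tac.
have cdbe (t : R) : {for t, continuous dbe}.
  by rewrite /dbe /Defs.cosh; continuous_tac.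
have expr1r t : expR ((1 - t) * r) = expR r / expR (t * r).
  by rewrite -expRN -expRD; congr expR; ring.
have er0 := expR_gt0 r.
have sn0 : expR r - (expR r)^-1 != 0.
  by move: sinhr; rewrite /Defs.sinh expRN => /lt0r_neq0; rewrite mulf_eq0 => /norP[].
have bb : expR r * expR r - 1 != 0.
  apply: contra sn0 => /eqP h; rewrite (_ : _ - _ = (expR r * expR r - 1) / expR r).
    by rewrite h mul0r.
  by field; rewrite gt_eqF.
(* In the Minkowski form p0 q0 - p.q, which is C on the two lifts, [id1] to [id3] say that al X + be
   Y stays on the hyperboloid, has a velocity of square - r^2, and is orthogonal to its velocity. *)
have id1 t : al t ^+ 2 + be t ^+ 2 + 2 * (al t * be t) * C = 1.
  have e0 := expR_gt0 (t * r).
  rewrite /al /be /S -coshr /Defs.sinh /Defs.cosh !expRN expr1r.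
  by field; rewrite ?bb !gt_eqF.
have id2 t : dal t ^+ 2 + dbe t ^+ 2 + 2 * (dal t * dbe t) * C = - r ^+ 2.
  have e0 := expR_gt0 (t * r).
  rewrite /dal /dbe /S -coshr /Defs.sinh /Defs.cosh !expRN expr1r.
  by field; rewrite ?bb !gt_eqF.
have id3 t : al t * dal t + be t * dbe t + (al t * dbe t + dal t * be t) * C = 0.
  have e0 := expR_gt0 (t * r).
  rewrite /al /be /dal /dbe /S -coshr /Defs.sinh /Defs.cosh !expRN expr1r.
  by field; rewrite ?bb !gt_eqF.
pose X (t : R) := al t * p0 + be t * q0; pose dX (t : R) := dal t * p0 + dbe t * q0.
have hX (t : R) : is_derive t 1 X (dX t).
  by have h1 := hal t; have h2 := hbe t; rewrite /X; derive_tac; rewrite /dX; ring.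
pose V t := al t *: p + be t *: q.
have VV t : dotv (V t) (V t) = X t ^+ 2 - 1.
  rewrite -[1 in RHS](id1 t) /V !dotvE (dotvC q p) pp qq pq /X; ring.
have al0 : al 0 = 1 by rewrite /al subr0 mul1r divff// gt_eqF.
have be0 : be 0 = 0 by rewrite /be mul0r /Defs.sinh oppr0 subrr !mul0r.
have al1 : al 1 = 0 by rewrite /al subrr mul0r /Defs.sinh oppr0 subrr !mul0r.
have be1 : be 1 = 1 by rewrite /be mul1r divff// gt_eqF.
(* Since X^2 - 1 is a squared length, X never vanishes, and it is positive at 0. Every real t is
   covered because a [C1_curve] is differentiable on the whole line. *)
have X0 (t : R) : 0 < X t.
  rewrite ltNge; apply/negP => Xt.
  have cX : continuous X by move=> s; exact: is_derive_continuous (hX s).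
  have X00 : 0 <= X 0 by rewrite /X al0 be0 mul0r mul1r addr0 (le_trans _ p01).
  have [s _ Xs] : exists2 s, s \in `[Num.min 0 t, Num.max 0 t] & X s = 0.
    have [t0|t0] := leP 0 t.
      apply: IVT => //; first exact: continuous_subspaceT.
      by rewrite ge_min le_max Xt X00 orbT.
    apply: IVT; [exact: ltW|exact: continuous_subspaceT|].
    by rewrite ge_min le_max Xt X00 orbT.
  have := dotv_ge0 (V s); rewrite VV Xs expr0n/= sub0r.
  by rewrite leNgt oppr_lt0 ltr01.
have E0 t : 0 < 1 + X t by rewrite addr_gt0.
(* Stereographic projection of the hyperboloid onto the ball. *)
pose c t := (1 + X t)^-1 *: V t.
pose f (t : R) := al t / (1 + X t); pose g (t : R) := be t / (1 + X t).
pose df (t : R) := (dal t * (1 + X t) - al t * dX t) / (1 + X t) ^+ 2.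
pose dg (t : R) := (dbe t * (1 + X t) - be t * dX t) / (1 + X t) ^+ 2.
have hf (t : R) : is_derive t 1 f (df t).
  have h1 := hal t; have h2 := hX t; rewrite /f; derive_tac; first by rewrite gt_eqF.
  by rewrite /df; field; rewrite gt_eqF.
have hg (t : R) : is_derive t 1 g (dg t).
  have h1 := hbe t; have h2 := hX t; rewrite /g; derive_tac; first by rewrite gt_eqF.
  by rewrite /dg; field; rewrite gt_eqF.
have cE t i : c t ord0 i = f t * p ord0 i + g t * q ord0 i.
  by rewrite /c /V /f /g !mxE; ring.
have hc (t : R) i : is_derive t 1 (fun s => c s ord0 i) (df t * p ord0 i + dg t * q ord0 i).
  have -> : (fun s => c s ord0 i) = (fun s => f s * p ord0 i + g s * q ord0 i).
    by apply/funext => s; rewrite cE.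
  by have h1 := hf t; have h2 := hg t; derive_tac; ring.
have dc (t : R) : derivable c t 1.
  by apply/derivable_mxP => a i; rewrite ord1; have [] := hc t i.
have dcE (t : R) : derive1 c t = df t *: p + dg t *: q.
  apply/rowP => i; rewrite derive1E derive_mx// !mxE.
  by have /@derive_val := hc t i.
have c0x : c 0 = x.
  rewrite /c /V /X al0 be0 scale1r scale0r addr0 mul0r mul1r addr0 pE scalerA.
  rewrite (_ : _ * _ = 1) ?scale1r// /p0; field; rewrite gt_eqF//=.
  by rewrite (_ : _ + _ = 2) ?pnatr_eq0//; ring.
have c1y : c 1 = y.
  rewrite /c /V /X al1 be1 scale1r scale0r add0r mul0r mul1r add0r qE scalerA.
  rewrite (_ : _ * _ = 1) ?scale1r// /q0; field; rewrite gt_eqF//=.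
  by rewrite (_ : _ + _ = 2) ?pnatr_eq0//; ring.
have cc t : dotv (c t) (c t) = (X t - 1) / (X t + 1).
  by rewrite /c dotvZl dotvZr VV; field; rewrite addrC !gt_eqF.
exists c.
  split; [exact: dc| | |exact: c0x|exact: c1y].
  - move=> t; rewrite (_ : derive1 c = fun s => df s *: p + dg s *: q); last exact/funext.
    have cX : {for t, continuous X} by exact: is_derive_continuous (hX t).
    have cdX : {for t, continuous dX}.
      by apply: cvgD; apply: cvgM; [exact: cdal|exact: cvg_cst|exact: cdbe|exact: cvg_cst].
    have cEi : {for t, continuous (fun s => ((1 + X s) ^+ 2)^-1)}.
      have h1 := hX t; continuous_tac; by rewrite expf_neq0 ?gt_eqF.
    have cal := is_derive_continuous (hal t); have cbe := is_derive_continuous (hbe t).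
    have cE1 : {for t, continuous (fun s => 1 + X s)} by apply: cvgD; [exact: cvg_cst|].
    apply: cvg_row => i; rewrite !mxE.
    rewrite (_ : (fun s => _) = fun s => df s * p ord0 i + dg s * q ord0 i); last first.
      by apply/funext => s; rewrite !mxE.
    by apply: cvgD; apply: cvgM; (try exact: cvg_cst); apply: cvgM => //;
      apply: cvgB; apply: cvgM => //; [exact: cdal|exact: cdbe].
  - move=> t _; rewrite uballE cc ltr_pdivrMr ?mul1r; last by rewrite addrC.
    by rewrite ltrD2l gtrN.
have speed t : 2 / (1 - enorm (c t) ^+ 2) * enorm (derive1 c t) = r.
  have sq : dotv (derive1 c t) (derive1 c t) = (r / (1 + X t)) ^+ 2.
    rewrite dcE !dotvE (dotvC q p) pp qq pq.
    (* The squared Euclidean speed is a combination of three bilinear expressions in the lifts; [e1]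
       to [e3] evaluate them by the Minkowski identities. *)
    have e1 : dal t ^+ 2 * (p0 ^+ 2 - 1) + 2 * (dal t * dbe t) * (p0 * q0 - C) +
        dbe t ^+ 2 * (q0 ^+ 2 - 1) = dX t ^+ 2 + r ^+ 2.
      by have := id2 t; rewrite /dX => h; rewrite -[r ^+ 2]opprK -h; ring.
    have e2 : al t * dal t * (p0 ^+ 2 - 1) + (al t * dbe t + dal t * be t) * (p0 * q0 - C) +
        be t * dbe t * (q0 ^+ 2 - 1) = X t * dX t.
      by rewrite -[RHS]subr0 -(id3 t) /X /dX; ring.
    have e3 : al t ^+ 2 * (p0 ^+ 2 - 1) + 2 * (al t * be t) * (p0 * q0 - C) +
        be t ^+ 2 * (q0 ^+ 2 - 1) = X t ^+ 2 - 1.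
      by rewrite -[in RHS](id1 t) /X; ring.
    transitivity (((1 + X t) ^+ 2 * (dX t ^+ 2 + r ^+ 2) - 2 * (1 + X t) * dX t * (X t * dX t) +
      dX t ^+ 2 * (X t ^+ 2 - 1)) / (1 + X t) ^+ 4); last by field; rewrite gt_eqF.
    rewrite -e1 -e2 -e3 /df /dg.
    by field; rewrite gt_eqF.
  rewrite enorm_sqr cc enormE sq sqrtr_sqr ger0_norm ?divr_ge0// ?(ltW (E0 t))//.
  have -> : 1 - (X t - 1) / (X t + 1) = 2 / (1 + X t).
    by rewrite [X t + 1]addrC; field; rewrite gt_eqF.
  by field; rewrite gt_eqF.
rewrite /hlength; under eq_Rintegral do rewrite speed.
rewrite Rintegral_cst//= lebesgue_measure_itv/= lte_fin ltr01.
by rewrite -EFinB/= subr0 mulr1.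
Qed.

Lemma hdistE x y : uball x -> uball y -> hdist x y = acosh (1 + hgap x y).
Proof.
move=> xb yb; have [c cC cl] := hdist_attained xb yb.
have lb : lbound [set l | exists2 c, C1_curve c x y & l = hlength c] (acosh (1 + hgap x y)).
  by move=> _ [e eC ->]; exact: hdist_ge.
have inS : [set l | exists2 c, C1_curve c x y & l = hlength c] (acosh (1 + hgap x y)).
  by exists c.
apply/eqP; rewrite eq_le; apply/andP; split.
  by apply: ge_inf inS; exists (acosh (1 + hgap x y)).
by apply: lb_le_inf => //; exists (acosh (1 + hgap x y)).
Qed.

End hyperbolic_distance.

(** * Integration by parts on row vectors *)

Section row_calculus.
Context {R : realType} {n : nat}.
Local Notation mT := (measurableTypeR R).
Local Notation mu := (@lebesgue_measure R).
Local Notation lam := (@lebesgue_tuple R).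
Implicit Types (x y : 'rV[R]_n) (f g : 'rV[R]_n -> R) (K : set 'rV[R]_n).

Lemma measurable_expRN : measurable_fun [set: R] (fun u => expR (- u)).
Proof. by apply: (measurableT_comp (f := @expR R)) => //; exact: measurable_expR. Qed.

Definition basis (i : 'I_n) : 'rV[R]_n := delta_mx ord0 i.

(** Directional derivatives become derivatives at 0 of a function of one variable, so explicit
    partial derivatives can be computed by the one-variable rules. *)
Lemma is_derive_line f y v (df : R) :
  is_derive (0 : R) 1 (fun t => f (y + t *: v)) df <-> is_derive y v f df.
Proof.
have E : (fun h : R => h^-1 *: (((fun t => f (y + t *: v)) \o shift 0) (h *: (1:R)) -
      f (y + 0 *: v))) = (fun h => h^-1 *: ((f \o shift y) (h *: v) - f y)).
  apply/funext => h; rewrite /= addr0 scale0r addr0 [h%:A]mulr1.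
  by rewrite [y + _]addrC.
split=> -[d1 d2].
  by apply: DeriveDef; [rewrite /derivable -E|rewrite /derive -E].
by apply: DeriveDef; [rewrite /derivable E|rewrite /derive E].
Qed.

Lemma row_of_upd (t : n.-tuple mT) i (r s : R) :
  row_of (tuple_upd t i s) = row_of (tuple_upd t i r) + (s - r) *: basis i.
Proof.
apply/rowP => j; rewrite !mxE !tnth_mktuple eqxx/=.
by case: (j == i); rewrite ?mulr1 ?mulr0 ?addr0//; ring.
Qed.

Lemma sqr_le_dotv y i : y ord0 i ^+ 2 <= dotv y y.
Proof.
rewrite /dotv (bigD1 i)//= -expr2 lerDl; apply: sumr_ge0 => j _.
by rewrite -expr2 sqr_ge0.
Qed.

Lemma uball_coord y i : uball y -> `|y ord0 i| < 1.
Proof.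
rewrite uballE => y1; rewrite -(@ltr_pXn2r _ 2)// ?nnegrE// expr1n real_normK ?num_real//.
exact: le_lt_trans (sqr_le_dotv y i) y1.
Qed.

Lemma bounded_of_compact_support f K : compact K -> continuous f ->
  (forall y, ~ K y -> f y = 0) -> exists2 M : R, 0 <= M & forall y, `|f y| <= M.
Proof.
move=> cK cf f0; have [K0|/set0P K0] := eqVneq K set0.
  by exists 0 => // y; rewrite f0 ?normr0// K0.
have cn : {within K, continuous (fun y => `|f y|)}.
  by apply: continuous_subspaceT => y; apply: (cvg_comp f (fun r : R => `|r|) (cf y)); exact: norm_continuous.
have [c _ cmax] := EVT_max_rV K0 cK cn.
exists `|f c| => // y; have [yK|nK] := pselect (K y); first by apply: cmax; rewrite inE.
by rewrite f0// normr0.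
Qed.

Lemma continuous_dotv : continuous (fun y : 'rV[R]_n => dotv y y).
Proof.
move=> y; apply: ctp_sum => i.
by apply: ctpM; exact: coord_continuous.
Qed.

Lemma uball_open : open (@uball R n).
Proof.
have -> : @uball R n = (fun y => dotv y y) @^-1` [set r | r < 1].
  by apply/seteqP; split => y; rewrite /= uballE.
apply: open_comp; last exact: open_lt.
by move=> y _; exact: continuous_dotv.
Qed.

Lemma near_outside K y : compact K -> ~ K y -> \forall z \near y, ~ K z.
Proof.
move=> cK Ky; have oK : open (~` K) by rewrite openC; exact: compact_closed.
exact: (oK y Ky).
Qed.

(** A point outside the ball has a neighbourhood disjoint from the compact set K, and f vanishes
    there. *)
Lemma continuous_extend f K : compact K -> K `<=` uball ->
  (forall y, ~ K y -> f y = 0) -> (forall y, uball y -> {for y, continuous f}) ->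
  continuous f.
Proof.
move=> cK KB f0 cf y; have [yB|yB] := pselect (uball y); first exact: cf.
have yK : ~ K y by move=> /KB.
apply: (near_ctp (f := fun=> 0)); last exact: ctp_cst.
by apply: filterS (near_outside cK yK) => z zK; rewrite f0.
Qed.

Lemma is_derive_extend f g K i : compact K -> K `<=` uball ->
  (forall y, ~ K y -> f y = 0) -> (forall y, ~ K y -> g y = 0) ->
  (forall y, uball y -> is_derive y (basis i) f (g y)) ->
  forall y, is_derive y (basis i) f (g y).
Proof.
move=> cK KB f0 g0 df y; have [yB|yB] := pselect (uball y); first exact: df.
have yK : ~ K y by move=> /KB.
rewrite g0//; apply: (near_eq_is_derive (f := fun=> 0)).
apply: filterS (near_outside cK yK) => z zK.
by rewrite f0.
Qed.

(** The ball lies in the cube [-1, 1]^n, so products of [box1] dominate bounded functions supported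
    in the ball. *)
Definition box1 (s : R) : R := \1_(`[-1, 1]%classic : set R) s.

Lemma measurable_box1 : measurable_fun setT box1.
Proof. exact: measurable_indic. Qed.

Lemma box1_ge0 s : 0 <= box1 s.
Proof. by rewrite /box1 indicE. Qed.

Lemma box1_le1 s : box1 s <= 1.
Proof. by rewrite /box1 indicE; case: (_ \in _); rewrite ?lexx ?ler01. Qed.

Lemma box1_in s : `|s| <= 1 -> box1 s = 1.
Proof. by move=> s1; rewrite /box1 indicE mem_set//= in_itv/= -ler_norml. Qed.

Lemma integral_box1_lty : (\int[mu]_s (box1 s)%:E < +oo)%E.
Proof.
rewrite /box1 integral_indic//= setIT lebesgue_measure_itv/= lte_fin.
by case: ifP => _; rewrite ?ltry// -EFinB ltry.
Qed.

Lemma continuous_row_line f (t : n.-tuple mT) i : continuous f ->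
  continuous (fun s : R => f (row_of (tuple_upd t i s))).
Proof.
move=> cf s; apply: (cvg_comp (fun s => row_of (tuple_upd t i s)) f); last exact: cf.
apply: cvg_row => j; rewrite mxE tnth_mktuple.
rewrite (_ : (fun k => _) = fun k : R => if j == i then k else tnth t j); last first.
  by apply/funext => k; rewrite mxE tnth_mktuple.
by case: eqVneq => _; [exact: cvg_id|exact: cvg_cst].
Qed.

Lemma integrable_compact_support f K : compact K -> K `<=` uball -> continuous f ->
  (forall y, ~ K y -> f y = 0) ->
  (lam n).-integrable setT (fun t => (f (row_of t))%:E) /\
  exists M, forall t : n.-tuple mT, `|f (row_of t)| <=
    M * \prod_(i < n) box1 (tnth t i).
Proof.
move=> cK KB cf f0; have [M M0 fM] := bounded_of_compact_support cK cf f0.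
have H (t : n.-tuple mT) : `|f (row_of t)| <=
    M * \prod_(i < n) box1 (tnth t i).
  have p0 : 0 <= \prod_(i < n) box1 (tnth t i).
    by rewrite prodr_ge0// => i _; exact: box1_ge0.
  have [tB|tB] := pselect (uball (row_of t)).
    rewrite big1 ?mulr1// => i _; rewrite box1_in//.
    by have := uball_coord i tB; rewrite mxE => /ltW.
  by rewrite f0 ?normr0 ?mulr_ge0// => /KB.
split; last by exists M.
apply: (integrable_EFin_le (m := lam n) measurableT
  (g := fun t => M * \prod_(i < n) box1 (tnth t i))) => //.
  exact: measurable_continuous_row.
apply: integrable_EFinZ => //.
apply: (@integrable_tupleM _ _ (fun=> box1)) => // i.
- exact: measurable_box1.
- exact: integral_box1_lty.
Qed.

(** On each line in direction i the function f vanishes once the coordinate has modulus at least 1,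
    so its derivative g integrates to 0 there. *)
Lemma integral_partial0 f g K i : compact K -> K `<=` uball ->
  (forall y, ~ K y -> f y = 0) -> (forall y, ~ K y -> g y = 0) -> continuous g ->
  (forall y, uball y -> is_derive y (basis i) f (g y)) ->
  (\int[lam n]_t (g (row_of t))%:E = 0)%E.
Proof.
move=> cK KB f0 g0 cg df; have [_ [M gM]] := integrable_compact_support cK KB cg g0.
apply: (@integral_tuple_slice0 _ _ _ box1 M i) => //.
- exact: measurable_continuous_row.
- exact: measurable_box1.
- exact: integral_box1_lty.
move=> t; pose L (s : R) := row_of (tuple_upd t i s).
have out s : 1 <= `|s| -> ~ K (L s).
  move=> s1 /KB/(uball_coord i); rewrite mxE tnth_mktuple eqxx.
  by rewrite ltNge s1.
have cgL : continuous (g \o L) by exact: continuous_row_line.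
have ig : mu.-integrable setT (fun s => (g (L s))%:E).
  apply: (integrable_EFin_le (measurableT : measurable (setT : set mT))
    (g := fun s => (M * \prod_(j < n) box1 (tnth (tuple_upd t i s) j)))) => //.
  - exact: continuous_measurable_fun.
  - by move=> s _; exact: gM.
  - apply: (integrable_EFin_le (measurableT : measurable (setT : set mT))
      (g := fun s => `|M| * box1 s)).
    + apply: measurable_funM => //; apply: measurable_prod => j _.
      under eq_fun do rewrite tnth_mktuple.
      by case: (j == i); [exact: measurable_box1|exact: measurable_cst].
    + move=> s _; rewrite normrM (bigD1 i)//= normrM tnth_mktuple eqxx.
      rewrite ler_wpM2l// [`|box1 s|]ger0_norm ?box1_ge0// ler_piMr ?box1_ge0//.
      have : 0 <= \prod_(j < n | j != i) box1 (tnth (tuple_upd t i s) j) <= 1.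
        elim/big_ind : _ => [|a b /andP[a0 a1] /andP[b0 b1]|j _].
        - by rewrite ler01 lexx.
        - by rewrite mulr_ge0//= mulr_ile1.
        - by rewrite box1_ge0 box1_le1.
      by case/andP => p0 p1; rewrite ger0_norm.
    + apply: integrable_EFinZ => //; apply/integrableP; split.
        by apply/measurable_EFinP; exact: measurable_box1.
      under eq_integral do rewrite gee0_abs ?lee_fin ?box1_ge0//.
      exact: integral_box1_lty.
have : \int[mu]_(s in setT) g (L s) = 0.
  apply: (Rintegral_FTC_exhausts (F := f \o L) exhausts_T) => //.
  - move=> s _; have d := is_derive_extend cK KB f0 g0 df (L s).
    have /is_derive_line {}d := d.
    have -> : f \o L = fun r => f (L s + (r - s) *: basis i).
      by apply/funext => r; rewrite /= /L -row_of_upd.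
    have ds : is_derive s 1 (fun r : R => r - s) 1 by derive_tac; ring.
    have d' : is_derive (s - s) (1 : R) (fun t => f (L s + t *: basis i)) (g (L s)).
      by rewrite subrr.
    by have := is_derive1_compf (g := fun r => r - s) d' ds; rewrite mulr1.
  - by move=> s _; exact: cgL.
  - rewrite (_ : (fun k => _) = fun=> 0); first exact: cvg_cst.
    apply/funext => k /=; rewrite !f0 ?subrr//; apply: out.
      by rewrite normrN ger0_norm// ler1n.
    by rewrite ger0_norm// ler1n.
by move=> h; rewrite (fine_integral (measurableT : measurable (setT : set mT)) ig) h.
Qed.

(** After Tonelli the Gaussian in y is, for fixed t, a product of one-dimensional ones. Radial
    integrals over R^n thus become integrals in t. *)
Lemma integral_gauss_mixture x (w k : R -> R) :
  measurable_fun setT w -> (forall t, 0 <= w t) -> measurable_fun setT k ->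
  (forall t, 0 < t -> 0 < k t) ->
  (\int[lam n]_y \int[mu]_(t in `]0%R, +oo[)
     (w t * expR (- (k t * dotv (row_of y - x) (row_of y - x))))%:E =
   \int[mu]_(t in `]0%R, +oo[) (w t * (pi / k t) `^ (n%:R / 2))%:E)%E.
Proof.
move=> mw w0 mk k0.
have mdot : measurable_fun [set: n.-tuple mT]
    (fun y : n.-tuple mT => dotv (row_of y - x) (row_of y - x)).
  apply: measurable_sum => i; under eq_fun do rewrite !mxE -expr2.
  apply: measurable_funX; apply: measurable_funB => //; exact: measurable_tnth.
have := @fubini_tonelli_on R _ _ _ _ (lam n) mu setT `]0%R, +oo[%classic
  (fun (y : n.-tuple mT) t => w t * expR (- (k t * dotv (row_of y - x) (row_of y - x)))) measurableT
  (@measurable_pos R).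
move=> ->; last 2 first.
- apply: measurable_funM; first exact: (measurableT_comp mw measurable_snd).
  apply: (measurableT_comp measurable_expRN).
  apply: measurable_funM; first exact: (measurableT_comp mk measurable_snd).
  exact: (measurableT_comp mdot measurable_fst).
- by move=> y t; rewrite mulr_ge0 ?expR_ge0.
apply: eq_integral => t; rewrite inE => /posP t0.
have kt := k0 t t0.
under eq_integral do rewrite EFinM.
rewrite ge0_integralZl//=; last 2 first.
- apply/measurable_EFinP; apply: (measurableT_comp measurable_expRN).
  by apply: measurable_funM.
- by rewrite lee_fin.
rewrite EFinM; congr (_ * _)%E.
transitivity (\int[lam n]_y (\prod_(i < n) expR (- (k t * (tnth y i - x ord0 i) ^+ 2)))%:E)%E.
  apply: eq_integral => y _; congr EFin; rewrite -expR_sum; congr expR.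
  rewrite /dotv mulr_sumr -sumrN; apply: eq_bigr => i _.
  by rewrite !mxE expr2.
rewrite (@integral_tupleM _ _ (fun i z => expR (- (k t * (z - x ord0 i) ^+ 2)))).
- under eq_bigr do rewrite gauss_integralE//.
  rewrite prodEFin prodr_const card_ord; congr EFin.
  have pk : 0 <= pi / k t by rewrite divr_ge0 ?pi_ge0// ltW.
  by rewrite -powR12_sqrt// -powR_mulrn ?powR_ge0// -powRrM; congr powR; rewrite mulrC.
- move=> i; apply: (measurableT_comp (@measurable_expR R)).
  apply: (measurableT_comp (f := fun u : R => - u)); first exact: oppr_measurable.
  apply: measurable_funM => //; apply: measurable_funX; exact: measurable_funB.
- by move=> i z; rewrite expR_ge0.
Qed.

Lemma measurable_row_set1 x : measurable [set t : n.-tuple mT | row_of t = x].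
Proof.
have -> : [set t : n.-tuple mT | row_of t = x] =
    \bigcap_(i in [set: 'I_n]) ((fun t : n.-tuple mT => tnth t i) @^-1` [set x ord0 i]).
  apply/seteqP; split => [t <- i _|t tx]; first by rewrite /= mxE.
  by apply/rowP => i; rewrite mxE; exact: (tx i Logic.I).
apply: fin_bigcap_measurable; first exact: finite_finset.
by move=> i _; rewrite -[X in measurable X]setTI; exact: measurable_tnth.
Qed.

Lemma lebesgue_tuple_set1 x : (0 < n)%N -> lam n [set t | row_of t = x] = 0%E.
Proof.
move=> n0; set A := [set t | _].
have mA : measurable A by exact: measurable_row_set1.
have -> : lam n A = (\int[lam n]_t (\1_A t)%:E)%E by rewrite integral_indic// setIT.
transitivity (\int[lam n]_t (\prod_(i < n) \1_[set x ord0 i] (tnth t i))%:E)%E.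
  apply: eq_integral => t _; congr EFin; rewrite indicE.
  have [tx|tx] := pselect (A t).
    rewrite mem_set// big1// => i _; rewrite indicE mem_set//=.
    by rewrite -tx mxE.
  rewrite memNset//; have [i ti] : exists i, tnth t i <> x ord0 i.
    by apply: contrapT => /forallNP h; apply: tx; apply/rowP => i; rewrite mxE; exact: contrapT (h i).
  by rewrite (bigD1 i)//= indicE memNset//= mul0r.
rewrite (@integral_tupleM _ _ (fun i => \1_[set x ord0 i])) => //.
rewrite (bigD1 (Ordinal n0))//= integral_indic//= setIT lebesgue_measure_set1 mul0e//.
Qed.

End row_calculus.

Section integral_on.
Context {R : realType} d1 d2 (T1 : measurableType d1) (T2 : measurableType d2).
Context (m2 : {sigma_finite_measure set T2 -> \bar R}).

Lemma measurable_integral_on (B : set T2) (f : T1 -> T2 -> R) : measurable B ->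
  measurable_fun [set: T1 * T2] (fun p => f p.1 p.2) -> (forall x y, 0 <= f x y) ->
  measurable_fun setT (fun x => \int[m2]_(y in B) (f x y)%:E)%E.
Proof.
move=> mB mf f0; pose g p := (f p.1 p.2 * \1_B p.2)%:E.
have mg : measurable_fun [set: T1 * T2] g.
  apply/measurable_EFinP; apply: measurable_funM => //.
  by apply: (measurableT_comp (f := \1_B : T2 -> R)) => //; exact: measurable_indic.
have g0 p : (0 <= g p)%E by rewrite lee_fin !mulr_ge0.
apply: eq_measurable_fun (measurable_fun_fubini_tonelli_F (m2 := m2) _ mg g0).
move=> x _; rewrite /fubini_F [RHS]integral_mkcond; apply: eq_integral => y _.
by rewrite patchE /g/= indicE; case: ifPn => _; rewrite ?mulr1 ?mulr0.
Qed.

End integral_on.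

(** * Integrals of powers of the distance by Gaussian mixtures *)

Section riesz_kernels.
Context {R : realType}.
Local Notation mT := (measurableTypeR R).
Local Notation mu := (@lebesgue_measure R).
Local Notation lam := (@lebesgue_tuple R).
Local Notation pos := (`]0%R, +oo[%classic : set R).

Lemma gamma_scale p (B : R) : 0 < p -> 0 < B ->
  (\int[mu]_(t in pos) (t `^ (p - 1) * expR (- (t * B)))%:E =
   (B `^ (- p) * gph p 0 0)%:E)%E.
Proof.
move=> p0 B0; have := @integral_gammaE R p B (fun=> 1) B0.
move=> h; under eq_integral do rewrite -[X in X%:E]mulr1.
rewrite h; last 2 first.
- by move=> x _; exact: cvg_cst.
- by move=> _; exact: ler01.
rewrite EFinM; congr (_ * _)%E.
rewrite /gph -(fine_integral (m := mu) (@measurable_pos R) (gph_integrable 0 0 p0)).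
by apply: eq_integral => t _; rewrite mul0r addr0 cos0.
Qed.

Lemma gph1 : gph 1 0 0 = 1 :> R.
Proof.
pose f t : R := t `^ (1 - 1) * expR (- t) * cos (0 * ln t + 0).
apply: (Rintegral_FTC_exhausts (f := f) (F := fun t => - expR (- t)) exhausts_pos).
- move=> t /posP t0; rewrite /f; derive_tac; rewrite subrr powRr0 mul0r addr0 cos0; ring.
- move=> t /posP t0; rewrite /f; apply: ctpM; last first.
    by rewrite (_ : (fun _ => _) = fun=> 1 :> R); [exact: cvg_cst|apply/funext => s; rewrite mul0r addr0 cos0].
  by continuous_tac.
- exact: gph_integrable.
rewrite [X in _ --> X](_ : _ = - 0 - - expR (- 0)); last by rewrite oppr0 expR0 sub0r opprK.
apply: cvgB; apply: cvgN.
  rewrite (_ : (fun n => _) = (fun n => (expR n.+2%:R)^-1)); last first.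
    by apply/funext => n; rewrite expRN.
  have h := @cvg_natinv R; apply: (squeeze_cvgr _ (cvg_cst 0) h).
  near=> n; rewrite invr_ge0 expR_ge0/= lef_pV2 ?posrE ?expR_gt0//.
  by apply: le_trans (expR_ge1Dx _); rewrite lerDr ler01.
apply: (cvg_comp (fun n => n.+2%:R^-1 : R) (fun t => expR (- t)) (@cvg_natinv R)).
exact: (cvg_comp (fun t : R => - t) (@expR R) (cvgN cvg_id) (@expR_continuous R _)).
Unshelve. all: end_near. Qed.

Context {n : nat}.
Implicit Types (x : 'rV[R]_n).
Local Notation N x y := (dotv (row_of y - x) (row_of y - x)).

Lemma measurable_dotv_row x : measurable_fun [set: n.-tuple mT] (fun y : n.-tuple mT => N x y).
Proof.
apply: measurable_sum => i; under eq_fun do rewrite !mxE -expr2.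
apply: measurable_funX; apply: measurable_funB => //; exact: measurable_tnth.
Qed.

(** Here B^(-p) Gamma(p) is the integral of t^(p - 1) e^(-t B), used with B = a |y - x|^2 + e.
    Integrating the Gaussian in y gives a factor t^(-n/2), which for p = n/2 + 1 cancels t^(p - 1)
    and leaves the integral of e^(-t e), that is 1 / e. *)
Lemma integral_peak x (a e : R) : 0 < a -> 0 < e ->
  (\int[lam n]_y ((a * N x y + e) `^ (- (n%:R / 2 + 1)))%:E =
   ((pi / a) `^ (n%:R / 2) / (e * gph (n%:R / 2 + 1) 0 0))%:E)%E.
Proof.
move=> a0 e0; set p : R := n%:R / 2 + 1.
have p0 : 0 < p by rewrite /p ltr_wpDl// divr_ge0.
have G0 := gph0_gt0 p0.
have B0 y : 0 < a * N x y + e by rewrite ltr_wpDl// mulr_ge0 ?dotv_ge0// ltW.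
have := @integral_gauss_mixture R n x (fun t => (gph p 0 0)^-1 * (t `^ (p - 1) * expR (- (t * e))))
  (fun t => t * a) _ _ _ _.
move=> h; have {h} h := h _ _ _ _.
transitivity (\int[lam n]_y \int[mu]_(t in pos)
   ((gph p 0 0)^-1 * (t `^ (p - 1) * expR (- (t * e))) *
      expR (- (t * a * N x y)))%:E)%E.
  apply: eq_integral => y _.
  under eq_integral do rewrite -!mulrA -expRD -opprD -mulrDr [e + _]addrC EFinM.
  rewrite ge0_integralZl//=; last 3 first.
  - apply/measurable_EFinP; apply: measurable_funS (measurableT) (@subsetT _ _) _.
    apply: measurable_funM; first exact: measurable_powR.
    by apply: (measurableT_comp measurable_expRN); exact: measurable_funM.
  - by move=> t _; rewrite lee_fin mulr_ge0 ?powR_ge0 ?expR_ge0.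
  - by rewrite lee_fin invr_ge0 ltW.
  by rewrite gamma_scale// -EFinM mulrCA mulVf ?mulr1// gt_eqF.
rewrite h; last 4 first.
- apply: measurable_funM => //; apply: measurable_funM; first exact: measurable_powR.
  by apply: (measurableT_comp measurable_expRN); exact: measurable_funM.
- by move=> t; rewrite !mulr_ge0 ?powR_ge0 ?expR_ge0 ?invr_ge0 ?(ltW G0).
- exact: measurable_funM.
- by move=> t t0; rewrite mulr_gt0.
transitivity (\int[mu]_(t in pos) (((gph p 0 0)^-1 * (pi / a) `^ (n%:R / 2))%:E *
   (t `^ (1 - 1) * expR (- (t * e)))%:E))%E.
  apply: eq_integral => t; rewrite inE => /posP t0; rewrite -EFinM; congr EFin.
  have -> : pi / (t * a) = t^-1 * (pi / a) by rewrite invfM mulrCA.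
  rewrite (@powRM _ t^-1) ?divr_ge0 ?pi_ge0 ?invr_ge0 ?(ltW t0) ?(ltW a0)//.
  rewrite -(powR_inv1 (ltW t0)) -powRrM mulN1r subrr powRr0 mul1r /p addrK powRN.
  have tn : t `^ (n%:R / 2) != 0 by rewrite gt_eqF// powR_gt0.
  by field; rewrite tn gt_eqF.
rewrite ge0_integralZl//=; last 3 first.
- apply/measurable_EFinP; apply: measurable_funS (measurableT) (@subsetT _ _) _.
  apply: measurable_funM; first exact: measurable_powR.
  by apply: (measurableT_comp measurable_expRN); exact: measurable_funM.
- by move=> t _; rewrite lee_fin mulr_ge0 ?powR_ge0 ?expR_ge0.
- by rewrite lee_fin mulr_ge0 ?powR_ge0 ?invr_ge0 ?(ltW G0).
rewrite gamma_scale// gph1 mulr1 powR_inv1 ?ltW// -EFinM; congr EFin.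
by field; rewrite !gt_eqF.
Qed.

(** The mixture for the exponent m = n/2 - 1, with the factor e^(-N) turning t into t + 1: the
    integral in y leaves t^(m - 1) (1 + t)^(-(m + 1)), which is integrable. *)
Lemma integrable_riesz x : (2 < n)%N ->
  (lam n).-integrable setT (fun y => (N x y `^ (- (n%:R / 2 - 1)) * expR (- N x y))%:E).
Proof.
move=> n2; set m : R := n%:R / 2 - 1.
have m0 : 0 < m.
  by rewrite /m subr_gt0 ltr_pdivlMr// mul1r ltr_nat.
have G0 := gph0_gt0 m0; have mN := measurable_dotv_row x.
have mk : measurable_fun [set: n.-tuple mT] (fun y => N x y `^ (- m) * expR (- N x y)).
  apply: measurable_funM; first exact: (measurableT_comp (f := fun u : R => u `^ (- m)) (@measurable_powR _ _)).
  exact: (measurableT_comp measurable_expRN).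
have k0 (y : n.-tuple mT) : 0 <= N x y `^ (- m) * expR (- N x y) by rewrite mulr_ge0 ?powR_ge0 ?expR_ge0.
apply/integrableP; split; first exact/measurable_EFinP.
under eq_integral do rewrite gee0_abs ?lee_fin//.
have := @integral_gauss_mixture R n x (fun t => (gph m 0 0)^-1 * t `^ (m - 1)) (fun t => t + 1) _ _ _ _.
move=> h; have {h} h := h _ _ _ _.
have w0 (t : R) : 0 <= (gph m 0 0)^-1 * t `^ (m - 1) by rewrite mulr_ge0 ?powR_ge0 ?invr_ge0 ?(ltW G0).
apply: (@le_lt_trans _ _ (\int[lam n]_y \int[mu]_(t in pos)
   ((gph m 0 0)^-1 * t `^ (m - 1) * expR (- ((t + 1) * N x y)))%:E)%E); last first.
  rewrite h; last 4 first.
  - by apply: measurable_funM => //; exact: measurable_powR.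
  - exact: w0.
  - exact: measurable_funD.
  - by move=> t t0; rewrite addr_gt0.
  rewrite (_ : (\int[_]_(_ in _) _)%E = (\int[mu]_(t in pos) (((gph m 0 0)^-1 * pi `^ (n%:R / 2))%:E *
    (t `^ (m - 1) * (1 + t) `^ (- (m + 1)))%:E))%E); last first.
    apply: eq_integral => t; rewrite inE => /posP t0; rewrite -EFinM; congr EFin.
    have t1 : 0 < 1 + t by rewrite addr_gt0.
    rewrite [t + 1]addrC powRM ?pi_ge0 ?invr_ge0 ?(ltW t1)//.
    rewrite -(powR_inv1 (ltW t1)) -powRrM mulN1r /m subrK; ring.
  rewrite ge0_integralZl//=; last 3 first.
  - apply/measurable_EFinP; apply: measurable_funS (measurableT) (@subsetT _ _) _.
    apply: measurable_funM; first exact: measurable_powR.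
    apply: (measurableT_comp (f := fun u : R => u `^ (- (m + 1))) (@measurable_powR _ _)).
    exact: measurable_funD.
  - by move=> t _; rewrite lee_fin mulr_ge0 ?powR_ge0.
  - by rewrite lee_fin mulr_ge0 ?powR_ge0 ?invr_ge0 ?(ltW G0).
  by rewrite integral_pow_div// -EFinM ltry.
apply: ge0_le_integral => //.
- by move=> y _; rewrite lee_fin.
- exact/measurable_EFinP.
- apply: measurable_integral_on; first exact: measurable_pos.
    apply: measurable_funM.
      apply: (measurableT_comp (f := fun t : R => (gph m 0 0)^-1 * t `^ (m - 1))) => //.
      by apply: measurable_funM => //; exact: measurable_powR.
    apply: (measurableT_comp measurable_expRN); apply: measurable_funM.
      by apply: (measurableT_comp (f := fun t : R => t + 1)) => //; exact: measurable_funD.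
    exact: (measurableT_comp mN measurable_fst).
  by move=> y t; rewrite mulr_ge0 ?expR_ge0.
move=> y _; have [N0|N0] := eqVneq (N x y) 0.
  rewrite {1}N0 powR0 ?mul0r; last by rewrite oppr_eq0 gt_eqF.
  by apply: integral_ge0 => t _; rewrite lee_fin mulr_ge0 ?expR_ge0.
have {}N0 : 0 < N x y by rewrite lt_neqAle eq_sym N0 dotv_ge0.
rewrite (_ : (\int[_]_(_ in _) _)%E = (\int[mu]_(t in pos) (((gph m 0 0)^-1 * expR (- N x y))%:E *
    (t `^ (m - 1) * expR (- (t * N x y)))%:E))%E); last first.
  apply: eq_integral => t _; rewrite -EFinM; congr EFin.
  rewrite mulrDl mul1r opprD expRD; ring.
rewrite ge0_integralZl//=; last 3 first.
- apply/measurable_EFinP; apply: measurable_funS (measurableT) (@subsetT _ _) _.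
  apply: measurable_funM; first exact: measurable_powR.
  by apply: (measurableT_comp measurable_expRN); exact: measurable_funM.
- by move=> t _; rewrite lee_fin mulr_ge0 ?powR_ge0 ?expR_ge0.
- by rewrite lee_fin mulr_ge0 ?expR_ge0 ?invr_ge0 ?(ltW G0).
rewrite gamma_scale// -EFinM lee_fin le_eqVlt; apply/orP; left; apply/eqP.
by field; rewrite gt_eqF.
Qed.

End riesz_kernels.

(** * Green's identity in the ball *)

Section gap_calculus.
Context {R : realType} {n : nat}.
Implicit Types (x y : 'rV[R]_n) (i : 'I_n).

Lemma dotv_basis y i : dotv y (basis i) = y ord0 i.
Proof.
rewrite /dotv (bigD1 i)//= mxE !eqxx mulr1 big1 ?addr0// => j ji.
by rewrite mxE (negbTE ji) andbF mulr0.
Qed.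

Lemma dotv_line y i (t : R) :
  dotv (y + t *: basis i) (y + t *: basis i) = dotv y y + 2 * t * y ord0 i + t ^+ 2.
Proof.
rewrite !dotvE [dotv (basis i) y]dotvC !dotv_basis mxE !eqxx/=; ring.
Qed.

Lemma dotv_line_sub x y i (t : R) :
  dotv (y + t *: basis i - x) (y + t *: basis i - x) =
  dotv (y - x) (y - x) + 2 * t * (y ord0 i - x ord0 i) + t ^+ 2.
Proof. by rewrite addrAC dotv_line !mxE. Qed.

Lemma line_coord y i (t : R) : (y + t *: basis i) ord0 i = y ord0 i + t.
Proof. by rewrite !mxE !eqxx mulr1. Qed.

Lemma hgapE x y : hgap x y = 2 * dotv (y - x) (y - x) / ((1 - dotv x x) * (1 - dotv y y)).
Proof. by rewrite /hgap -opprB dotvNl dotvNr opprK. Qed.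

Lemma uball_gt0 y : uball y -> 0 < 1 - dotv y y.
Proof. by rewrite uballE subr_gt0. Qed.

Definition dgap x y i : R :=
  4 / (1 - dotv x x) * ((y ord0 i - x ord0 i) / (1 - dotv y y) +
    dotv (y - x) (y - x) * y ord0 i / (1 - dotv y y) ^+ 2).

Definition ddgap x y i : R :=
  4 / (1 - dotv x x) * ((1 - dotv y y)^-1 +
    4 * y ord0 i * (y ord0 i - x ord0 i) / (1 - dotv y y) ^+ 2 +
    dotv (y - x) (y - x) / (1 - dotv y y) ^+ 2 +
    4 * dotv (y - x) (y - x) * y ord0 i ^+ 2 / (1 - dotv y y) ^+ 3).

Definition conformal y : R := 2 / (1 - dotv y y).

Lemma is_derive_hgap x y i : uball x -> uball y ->
  is_derive y (basis i) (hgap x) (dgap x y i).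
Proof.
move=> /uball_gt0 X0 /uball_gt0 Y0; apply/is_derive_line.
rewrite (_ : (fun t => _) = fun t => 2 * (dotv (y - x) (y - x) + 2 * t * (y ord0 i - x ord0 i) + t ^+ 2)
   / ((1 - dotv x x) * (1 - (dotv y y + 2 * t * y ord0 i + t ^+ 2)))); last first.
  by apply/funext => t; rewrite hgapE dotv_line dotv_line_sub.
have Y0' : 1 - (dotv y y + 2 * 0 * y ord0 i + 0 ^+ 2) != 0.
  by rewrite gt_eqF// (_ : _ - _ = 1 - dotv y y)//; ring.
derive_tac; first by rewrite mulf_neq0// gt_eqF.
by rewrite /dgap; field; rewrite !gt_eqF//= ?andbT; move: Y0'; rewrite mulr0 mul0r addr0 expr0n.
Qed.

Lemma is_derive_dgap x y i : uball x -> uball y ->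
  is_derive y (basis i) (fun z => dgap x z i) (ddgap x y i).
Proof.
move=> /uball_gt0 X0 /uball_gt0 Y0; apply/is_derive_line.
rewrite (_ : (fun t => _) = fun t =>
   4 / (1 - dotv x x) * ((y ord0 i + t - x ord0 i) / (1 - (dotv y y + 2 * t * y ord0 i + t ^+ 2)) +
    (dotv (y - x) (y - x) + 2 * t * (y ord0 i - x ord0 i) + t ^+ 2) * (y ord0 i + t) /
     (1 - (dotv y y + 2 * t * y ord0 i + t ^+ 2)) ^+ 2)); last first.
  by apply/funext => t; rewrite /dgap dotv_line dotv_line_sub line_coord.
have Y0' : 1 - (dotv y y + 2 * 0 * y ord0 i + 0 ^+ 2) != 0.
  by rewrite gt_eqF// (_ : _ - _ = 1 - dotv y y)//; ring.
derive_tac => //; first by rewrite expf_neq0.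
by rewrite /ddgap; field; rewrite !gt_eqF//= ?andbT; move: Y0'; rewrite mulr0 mul0r addr0 expr0n.
Qed.

Lemma is_derive_conformal y i : uball y ->
  is_derive y (basis i) conformal (conformal y ^+ 2 * y ord0 i).
Proof.
move=> /uball_gt0 Y0; apply/is_derive_line.
rewrite (_ : (fun t => _) = fun t => 2 / (1 - (dotv y y + 2 * t * y ord0 i + t ^+ 2))); last first.
  by apply/funext => t; rewrite /conformal dotv_line.
have Y0' : 1 - (dotv y y + 2 * 0 * y ord0 i + 0 ^+ 2) != 0.
  by rewrite gt_eqF// (_ : _ - _ = 1 - dotv y y)//; ring.
derive_tac => //.
by rewrite /conformal; field; rewrite !gt_eqF//= ?andbT; move: Y0'; rewrite mulr0 mul0r addr0 expr0n.
Qed.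

Lemma dgap_vec x y i : uball y -> dgap x y i =
  ((4 / ((1 - dotv x x) * (1 - dotv y y) ^+ 2)) *:
    ((1 - dotv y y) *: (y - x) + dotv (y - x) (y - x) *: y)) ord0 i.
Proof.
move=> /uball_gt0 Y0; rewrite /dgap !mxE [in RHS]invfM.
by move: (1 - dotv x x)^-1 => X; field; rewrite gt_eqF.
Qed.

(** The hyperbolic gradient of cosh rho has squared length sinh^2 rho, which is s (s + 2) for s =
    cosh rho - 1. *)
Lemma sum_dgap_sqr x y : uball x -> uball y ->
  \sum_(i < n) dgap x y i ^+ 2 = conformal y ^+ 2 * (hgap x y * (hgap x y + 2)).
Proof.
move=> xb yb; have X0 := uball_gt0 xb; have Y0 := uball_gt0 yb.
under eq_bigr do rewrite dgap_vec// expr2.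
rewrite -/(dotv _ _) hgapE /conformal !dotvE [dotv x y]dotvC; move: X0 Y0.
set a := dotv x x; set b := dotv y x; set c := dotv y y => X0 Y0.
by field; rewrite !gt_eqF.
Qed.

Lemma sum_coord_dgap x y : uball y ->
  \sum_(i < n) y ord0 i * dgap x y i =
  4 / ((1 - dotv x x) * (1 - dotv y y) ^+ 2) *
    ((1 - dotv y y) * dotv y (y - x) + dotv (y - x) (y - x) * dotv y y).
Proof.
move=> yb; under eq_bigr do rewrite dgap_vec//.
transitivity (dotv y ((4 / ((1 - dotv x x) * (1 - dotv y y) ^+ 2)) *:
    ((1 - dotv y y) *: (y - x) + dotv (y - x) (y - x) *: y))); first by [].
by rewrite dotvZr [dotv y (_ + _ *: y)]dotvDr !dotvZr.
Qed.

Lemma sum_ddgap x y : \sum_(i < n) ddgap x y i =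
  4 / (1 - dotv x x) * (n%:R / (1 - dotv y y) +
    4 * dotv y (y - x) / (1 - dotv y y) ^+ 2 +
    n%:R * dotv (y - x) (y - x) / (1 - dotv y y) ^+ 2 +
    4 * dotv (y - x) (y - x) * dotv y y / (1 - dotv y y) ^+ 3).
Proof.
rewrite /ddgap -mulr_sumr; congr (_ * _); rewrite !big_split/=.
congr (_ + _ + _ + _).
- by rewrite sumr_const card_ord mulr_natl.
- by rewrite -mulr_suml; congr (_ / _); rewrite /dotv mulr_sumr; apply: eq_bigr => i _; rewrite !mxE mulrA.
- by rewrite sumr_const card_ord mulr_natl mulrnAl.
- by rewrite -mulr_suml -mulr_sumr; congr (_ * _ / _); apply: eq_bigr => i _; rewrite expr2.
Qed.

(** The eigenfunction identity for cosh rho, namely that its hyperbolic Laplacian is n cosh rho,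
    multiplied by the square of the conformal factor. *)
Lemma laplace_gap x y : uball x -> uball y ->
  (n%:R - 2) * conformal y * \sum_(i < n) y ord0 i * dgap x y i + \sum_(i < n) ddgap x y i =
  conformal y ^+ 2 * (n%:R * (1 + hgap x y)).
Proof.
move=> xb yb; have X0 := uball_gt0 xb; have Y0 := uball_gt0 yb.
rewrite sum_coord_dgap// sum_ddgap hgapE /conformal !dotvE [dotv x y]dotvC; move: X0 Y0.
set a := dotv x x; set b := dotv y x; set c := dotv y y => X0 Y0.
by field; rewrite !gt_eqF.
Qed.

Lemma laplaceB_conformal (f : 'rV[R]_n -> R) y : uball y ->
  laplaceB f y = conformal y ^- 2 * (\sum_(i < n) partial i (partial i f) y) +
    (n%:R - 2) / conformal y * \sum_(i < n) y ord0 i * partial i f y.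
Proof.
move=> /uball_gt0 Y0; rewrite /laplaceB enorm_sqr /conformal.
by field; rewrite gt_eqF.
Qed.

Lemma dV_conformal y : dV y = conformal y ^+ n.
Proof. by rewrite /dV enorm_sqr. Qed.

End gap_calculus.

Section green_identity.
Context {R : realType} {n : nat}.
Local Notation mT := (measurableTypeR R).
Local Notation lam := (@lebesgue_tuple R).
Implicit Types (x y : 'rV[R]_n) (i : 'I_n) (K : set 'rV[R]_n) (f : 'rV[R]_n -> R).

Lemma ctp_coord i y : {for y, continuous (fun z : 'rV[R]_n => z ord0 i)}.
Proof. exact: coord_continuous. Qed.

Lemma ctp_dotv_sub x y : {for y, continuous (fun z : 'rV[R]_n => dotv (z - x) (z - x))}.
Proof.
apply: ctp_sum => i.
have c : {for y, continuous (fun z : 'rV[R]_n => z ord0 i - x ord0 i)}.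
  by apply: ctpB; [exact: ctp_coord|exact: ctp_cst].
rewrite (_ : (fun z => _) = fun z : 'rV[R]_n => (z ord0 i - x ord0 i) * (z ord0 i - x ord0 i)).
  exact: ctpM.
by apply/funext => z; rewrite !mxE.
Qed.

Lemma ctp_subdotv y : {for y, continuous (fun z : 'rV[R]_n => 1 - dotv z z)}.
Proof. by apply: ctpB; [exact: ctp_cst|exact: continuous_dotv]. Qed.

Lemma ctp_conformal y : uball y -> {for y, continuous (@conformal R n)}.
Proof.
move=> yb; apply: ctpM; first exact: ctp_cst.
by apply: ctpV; [rewrite gt_eqF// uball_gt0|exact: ctp_subdotv].
Qed.

Lemma ctp_hgap x y : uball x -> uball y -> {for y, continuous (hgap x)}.
Proof.
move=> xb yb; rewrite (_ : hgap x = fun z => 2 * dotv (z - x) (z - x) *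
   ((1 - dotv x x) * (1 - dotv z z))^-1); last by apply/funext => z; rewrite hgapE.
apply: ctpM; first by apply: ctpM; [exact: ctp_cst|exact: ctp_dotv_sub].
apply: ctpV; first by rewrite mulf_neq0// gt_eqF// uball_gt0.
by apply: ctpM; [exact: ctp_cst|exact: ctp_subdotv].
Qed.

Lemma ctp_Vsubdotv k y : uball y -> {for y, continuous (fun z : 'rV[R]_n => (1 - dotv z z) ^- k)}.
Proof.
move=> yb; apply: ctpV; first by rewrite expf_neq0// gt_eqF// uball_gt0.
by apply: ctpX; exact: ctp_subdotv.
Qed.

Lemma ctp_dgap x y i : uball y -> {for y, continuous (fun z => dgap x z i)}.
Proof.
move=> yb; apply: ctpM; first exact: ctp_cst.
apply: ctpD; apply: ctpM.
- by apply: ctpB; [exact: ctp_coord|exact: ctp_cst].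
- exact: (@ctp_Vsubdotv 1 _ yb).
- by apply: ctpM; [exact: ctp_dotv_sub|exact: ctp_coord].
- exact: ctp_Vsubdotv.
Qed.

Lemma ctp_ddgap x y i : uball y -> {for y, continuous (fun z => ddgap x z i)}.
Proof.
move=> yb; apply: ctpM; first exact: ctp_cst.
have cx : {for y, continuous (fun z : 'rV[R]_n => z ord0 i - x ord0 i)}.
  by apply: ctpB; [exact: ctp_coord|exact: ctp_cst].
have c4 : {for y, continuous (fun z : 'rV[R]_n => 4 * z ord0 i)}.
  by apply: ctpM; [exact: ctp_cst|exact: ctp_coord].
apply: ctpD; first (apply: ctpD; first apply: ctpD).
- exact: (@ctp_Vsubdotv 1 _ yb).
- by apply: ctpM; [exact: ctpM|exact: ctp_Vsubdotv].
- by apply: ctpM; [exact: ctp_dotv_sub|exact: ctp_Vsubdotv].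
- apply: ctpM; last exact: ctp_Vsubdotv.
  apply: ctpM; last by apply: ctpX; exact: ctp_coord.
  by apply: ctpM; [exact: ctp_cst|exact: ctp_dotv_sub].
Qed.

Lemma smooth_partial f i : smooth f -> smooth (partial i f).
Proof. by move=> sf s y; have := sf (rcons s i) y; rewrite foldr_rcons. Qed.

Lemma smooth_continuous f : smooth f -> continuous f.
Proof. by move=> sf y; apply: differentiable_continuous; exact: (sf [::]). Qed.

Lemma smooth_is_derive f y i : smooth f -> is_derive y (basis i) f (partial i f y).
Proof. by move=> sf; apply: DeriveDef => //; apply: diff_derivable; exact: (sf [::]). Qed.

Lemma partial_outside f K i : compact K -> (forall y, ~ K y -> f y = 0) ->
  forall y, ~ K y -> partial i f y = 0.
Proof.
move=> cK f0 y Ky; have h : is_derive y (basis i) f 0.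
  apply: (near_eq_is_derive (f := fun=> 0)).
  by apply: filterS (near_outside cK Ky) => z zK; rewrite f0.
by rewrite /partial -/(basis i) derive_val.
Qed.

Lemma laplaceB_outside f K : compact K -> (forall y, ~ K y -> f y = 0) ->
  forall y, ~ K y -> laplaceB f y = 0.
Proof.
move=> cK f0 y Ky; rewrite /laplaceB.
rewrite [\sum_(i < n) partial _ _ _]big1 => [|i _]; last first.
  exact: (@partial_outside _ _ i cK (@partial_outside _ _ i cK f0) y Ky).
rewrite big1 => [|i _]; last by rewrite (partial_outside _ cK f0)// mulr0.
by rewrite !mulr0 addr0 mulr0.
Qed.

Lemma ctp_laplaceB f y : smooth f -> {for y, continuous (laplaceB f)}.
Proof.
move=> sf; rewrite (_ : laplaceB f = fun z => (1 - dotv z z) * 4^-1 *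
  ((1 - dotv z z) * (\sum_(i < n) partial i (partial i f) z) +
   2 * (n%:R - 2) * \sum_(i < n) z ord0 i * partial i f z)); last first.
  by apply/funext => z; rewrite /laplaceB enorm_sqr.
apply: ctpM; first by apply: ctpM; [exact: ctp_subdotv|exact: ctp_cst].
apply: ctpD.
  apply: ctpM; first exact: ctp_subdotv.
  apply: ctp_sum => i.
  exact: (@smooth_continuous _ (@smooth_partial _ i (@smooth_partial _ i sf)) y).
apply: ctpM; first exact: ctp_cst.
apply: ctp_sum => i; apply: ctpM; first exact: ctp_coord.
exact: (@smooth_continuous _ (@smooth_partial _ i sf) y).
Qed.

Lemma integral_divergence0 K (F G : 'I_n -> 'rV[R]_n -> R) : compact K -> K `<=` uball ->
  (forall i y, ~ K y -> F i y = 0) -> (forall i y, ~ K y -> G i y = 0) ->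
  (forall i y, uball y -> {for y, continuous (G i)}) ->
  (forall i y, uball y -> is_derive y (basis i) (F i) (G i y)) ->
  (\int[lam n]_t (\sum_(i < n) G i (row_of t))%:E = 0)%E.
Proof.
move=> cK KB F0 G0 cG dF.
have cG' i : continuous (G i).
  by apply: (continuous_extend cK KB) => //; [exact: G0|exact: cG].
have iG i := (integrable_compact_support cK KB (cG' i) (G0 i)).1.
have zG i := integral_partial0 cK KB (F0 i) (G0 i) (cG' i) (dF i).
elim: (index_enum _) => [|i r IHr].
  by under eq_integral do rewrite big_nil; exact: integral0.
under eq_integral do rewrite big_cons EFinD.
rewrite integralD//=; first by rewrite zG IHr adde0.
rewrite (_ : (fun t => _) = fun t => \sum_(j <- r) (G j (row_of t))%:E)%E; last first.
  by apply/funext => t; rewrite sumEFin.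
by apply: integrable_sum => // j _; exact: iG.
Qed.

Section radial.
Context (h h1 h2 : R -> R).
Hypothesis dh : forall s : R, 0 < s -> is_derive s 1 h (h1 s).
Hypothesis dh1 : forall s : R, 0 < s -> is_derive s 1 h1 (h2 s).
Hypothesis ch2 : forall s : R, 0 < s -> {for s, continuous h2}.

(** For the conformal factor W one has W^n Delta f = div (W^(n-2) grad f) with Euclidean divergence
    and gradient. The integrand is therefore the divergence of W^(n-2) (h grad f - f grad h), with h
    taken at s + e; [sum_dgap_sqr] and [laplace_gap] provide the coefficients of h2 and h1. *)
Lemma integral_green_identity K (f : 'rV[R]_n -> R) x e : (2 < n)%N -> compact K ->
  K `<=` uball -> smooth f -> (forall y, ~ K y -> f y = 0) -> uball x -> 0 < e ->
  (\int[lam n]_t ((fun y => h (hgap x y + e) * laplaceB f y * dV y -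
     f y * dV y * (hgap x y * (hgap x y + 2) * h2 (hgap x y + e) +
       n%:R * (1 + hgap x y) * h1 (hgap x y + e))) (row_of t))%:E = 0)%E.
Proof.
move=> n2 cK KB sf f0 xb e0.
have pf0 i := @partial_outside _ _ i cK f0.
have ppf0 i := @partial_outside _ _ i cK (pf0 i).
have s0 y : uball y -> 0 < hgap x y + e.
  by move=> yb; rewrite ltr_wpDl// hgap_ge0.
pose W := @conformal R n.
pose F i y := W y ^+ (n - 2) * (h (hgap x y + e) * partial i f y -
   f y * (h1 (hgap x y + e) * dgap x y i)).
pose G i y := (n - 2)%:R * W y ^+ (n - 2).-1 * (W y ^+ 2 * y ord0 i) *
   (h (hgap x y + e) * partial i f y - f y * (h1 (hgap x y + e) * dgap x y i)) +
  W y ^+ (n - 2) * ((h1 (hgap x y + e) * dgap x y i * partial i f y +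
     h (hgap x y + e) * partial i (partial i f) y) -
   (partial i f y * (h1 (hgap x y + e) * dgap x y i) +
     f y * (h2 (hgap x y + e) * dgap x y i * dgap x y i + h1 (hgap x y + e) * ddgap x y i))).
transitivity (\int[lam n]_t (\sum_(i < n) G i (row_of t))%:E)%E; last apply: (integral_divergence0 (F := F) (G := G) cK KB).
- apply: eq_integral => t _; congr EFin; move: (row_of t) => y {t}.
  have [yK|yK] := pselect (K y); last first.
    rewrite (laplaceB_outside cK)// (f0 _ yK) !(mulr0, mul0r) subr0.
    by rewrite big1// => i _; rewrite /G (f0 _ yK) (pf0 _ _ yK) (ppf0 _ _ yK) !(mul0r, mulr0, subr0, addr0).
  have yb := KB _ yK; have Wy : W y != 0 by rewrite /W /conformal mulf_neq0 ?invr_eq0 ?gt_eqF ?uball_gt0.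
  have nW : W y ^+ n = W y ^+ (n - 2).-1 * W y ^+ 3.
    rewrite -exprD; congr (_ ^+ _).
    by rewrite addnS -addSn prednK ?subn_gt0// subnK// ltnW.
  have nW2 : W y ^+ (n - 2) = W y ^+ (n - 2).-1 * W y.
    by rewrite -exprSr prednK// subn_gt0.
  rewrite laplaceB_conformal// dV_conformal.
  have E1 := sum_dgap_sqr xb yb; have E2 := laplace_gap xb yb.
  pose A := \sum_(i < n) y ord0 i * partial i f y.
  pose B := \sum_(i < n) partial i (partial i f) y.
  pose C := \sum_(i < n) y ord0 i * dgap x y i.
  pose D := \sum_(i < n) ddgap x y i.
  pose E := \sum_(i < n) dgap x y i ^+ 2.
  transitivity (n%:R * W y ^+ (n - 2).-1 * 0 + (n%:R - 2) * W y ^+ (n - 2).-1 * W y ^+ 2 *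
      (h (hgap x y + e) * A - f y * h1 (hgap x y + e) * C) +
     W y ^+ (n - 2) * (h (hgap x y + e) * B - f y * (h2 (hgap x y + e) * E + h1 (hgap x y + e) * D))).
    rewrite -/A -/B -/W nW nW2 in E1 E2 *; move: E1 E2; rewrite -/E -/C -/D => -> E2.
    have -> : D = conformal y ^+ 2 * (n%:R * (1 + hgap x y)) - (n%:R - 2) * conformal y * C.
      by rewrite -E2 addrAC subrr add0r.
    by rewrite -/W; field.
  rewrite mulr0 add0r /A /B /C /D /E !mulr_sumr -!sumrB -!big_split/= !mulr_sumr -!sumrB !mulr_sumr -big_split/=.
  apply: eq_bigr => i _; rewrite /G natrB ?(ltnW n2)//.
  rewrite nW2; ring.
- by move=> i y yK; rewrite /F (f0 _ yK) (pf0 _ _ yK) !(mul0r, mulr0, subr0).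
- by move=> i y yK; rewrite /G (f0 _ yK) (pf0 _ _ yK) (ppf0 _ _ yK) !(mul0r, mulr0, subr0, addr0).
- move=> i y yb.
  have cs : {for y, continuous (fun z => hgap x z + e)}.
    by apply: ctpD; [exact: ctp_hgap|exact: ctp_cst].
  have cW := ctp_conformal yb.
  have cf := @smooth_continuous _ sf y.
  have cp := @smooth_continuous _ (smooth_partial i sf) y.
  have cpp := @smooth_continuous _ (smooth_partial i (smooth_partial i sf)) y.
  have ch := ctp_comp cs (is_derive_continuous (dh (s0 _ yb))).
  have ch1 := ctp_comp cs (is_derive_continuous (dh1 (s0 _ yb))).
  have ch2' := ctp_comp cs (ch2 (s0 _ yb)).
  have cq := @ctp_dgap x y i yb; have cr := @ctp_ddgap x y i yb.
  have c1 : {for y, continuous (fun z => h1 (hgap x z + e) * dgap x z i)} by exact: ctpM.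
  apply: ctpD; apply: ctpM.
  + apply: ctpM; first by apply: ctpM; [exact: ctp_cst|exact: ctpX].
    by apply: ctpM; [exact: ctpX|exact: ctp_coord].
  + exact: ctpB (ctpM ch cp) (ctpM cf c1).
  + exact: ctpX.
  + apply: ctpB; first exact: ctpD (ctpM c1 cp) (ctpM ch cpp).
    exact: ctpD (ctpM cp c1) (ctpM cf (ctpD (ctpM (ctpM ch2' cq) cq) (ctpM ch1 cr))).
- move=> i y yb; apply/is_derive_line.
  have /is_derive_line d1 := is_derive_hgap i xb yb.
  have /is_derive_line d2 := is_derive_dgap i xb yb.
  have /is_derive_line d3 := is_derive_conformal i yb.
  have /is_derive_line d4 := smooth_is_derive y i sf.
  have /is_derive_line d5 := smooth_is_derive y i (smooth_partial i sf).
  have E0 : y + 0 *: basis i = y by rewrite scale0r addr0.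
  have d6 : is_derive (0 : R) 1 (fun t => hgap x (y + t *: basis i) + e) (dgap x y i).
    by derive_tac; rewrite addr0.
  have d7 : is_derive (0 : R) 1 (fun t => h (hgap x (y + t *: basis i) + e))
      (h1 (hgap x y + e) * dgap x y i).
    by apply: (is_derive1_compf (f := h)) => //; rewrite E0; exact/dh/s0.
  have d8 : is_derive (0 : R) 1 (fun t => h1 (hgap x (y + t *: basis i) + e))
      (h2 (hgap x y + e) * dgap x y i).
    by apply: (is_derive1_compf (f := h1)) => //; rewrite E0; exact/dh1/s0.
  by rewrite /F /G; derive_tac; rewrite E0 -/W.
Qed.

End radial.

End green_identity.

(** * Radial kernels with a point source *)

Section approximate_identity.
Context {R : realType} {n : nat}.
Local Notation mT := (measurableTypeR R).
Local Notation lam := (@lebesgue_tuple R).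
Local Notation N x y := (dotv (row_of y - x) (row_of y - x)).
Implicit Types (x : 'rV[R]_n).

Definition peak x (a e : R) (y : n.-tuple mT) : R :=
  e * (a * N x y + e) `^ (- (n%:R / 2 + 1)).

Definition peak_mass (a : R) : R := (pi / a) `^ (n%:R / 2) / gph (n%:R / 2 + 1) 0 0.

Lemma peak_ge0 x a e y : 0 < e -> 0 <= peak x a e y.
Proof. by move=> e0; rewrite mulr_ge0 ?powR_ge0 ?ltW. Qed.

Lemma measurable_peak x a e : measurable_fun setT (peak x a e).
Proof.
apply: measurable_funM => //.
apply: (measurableT_comp (f := fun u : R => u `^ _) (@measurable_powR _ _)).
by apply: measurable_funD => //; apply: measurable_funM => //; exact: measurable_dotv_row.
Qed.

Lemma integral_peak_mass x a e : 0 < a -> 0 < e ->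
  (\int[lam n]_y (peak x a e y)%:E = (peak_mass a)%:E)%E.
Proof.
move=> a0 e0; under eq_integral do rewrite EFinM.
rewrite ge0_integralZl//=; last 3 first.
- apply/measurable_EFinP; apply: (measurableT_comp (f := fun u : R => u `^ _) (@measurable_powR _ _)).
  by apply: measurable_funD => //; apply: measurable_funM => //; exact: measurable_dotv_row.
- by move=> y _; rewrite lee_fin powR_ge0.
- by rewrite lee_fin ltW.
rewrite integral_peak// -EFinM; congr EFin; rewrite /peak_mass.
have p0 : 0 < n%:R / 2 + 1 :> R by rewrite ltr_wpDl// divr_ge0.
by field; rewrite !gt_eqF// gph0_gt0.
Qed.

Lemma integrable_peak x a e : 0 < a -> 0 < e ->
  (lam n).-integrable setT (fun y => (peak x a e y)%:E).
Proof.
move=> a0 e0; apply/integrableP; split; first by apply/measurable_EFinP; exact: measurable_peak.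
under eq_integral do rewrite gee0_abs ?lee_fin ?peak_ge0//.
by rewrite integral_peak_mass// ltry.
Qed.

(** For N >= d one has a N + 1 <= (1 + 1 / (a d)) (a N + e). Away from x the peak is thus at most e
    times a fixed integrable function. *)
Lemma peak_le x a e d y : 0 < a -> 0 < e -> 0 < d -> d <= N x y ->
  peak x a e y <= e * ((1 + (a * d)^-1) `^ (n%:R / 2 + 1) * peak x a 1 y).
Proof.
move=> a0 e0 d0 dN; rewrite /peak mul1r ler_wpM2l ?(ltW e0)//.
set p := n%:R / 2 + 1; have p0 : 0 < p by rewrite ltr_wpDl// divr_ge0.
have N0 : 0 < N x y := lt_le_trans d0 dN.
have aN : 0 < a * N x y by rewrite mulr_gt0.
rewrite !powRN ler_pdivlMr ?powR_gt0 ?addr_gt0// mulrC ler_pdivrMr ?powR_gt0 ?addr_gt0//.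
rewrite -powRM ?addr_ge0 ?invr_ge0 ?mulr_ge0 ?(ltW a0) ?(ltW d0) ?(ltW N0) ?(ltW e0)//.
apply: ler_powR_base; [exact: ltW|by rewrite addr_ge0// ltW|].
apply: (@le_trans _ _ ((1 + (a * d)^-1) * (a * N x y))); last first.
  by rewrite ler_wpM2l ?addr_ge0 ?invr_ge0 ?mulr_ge0 ?(ltW a0) ?(ltW d0)// lerDl ltW.
rewrite mulrDl mul1r lerD2l mulrC ler_pdivlMr ?mulr_gt0// mul1r.
by rewrite ler_pM2l.
Qed.

(** The density [th k] changes with k, so its closeness to [th0] is required uniformly on a ball
    around x; outside that ball [peak_le] and the common bound M suffice. *)
Lemma cvg_peak x a (th : nat -> n.-tuple mT -> R) (e : nat -> R) th0 M : 0 < a ->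
  (forall k, 0 < e k) -> e k @[k --> \oo] --> 0 ->
  (forall k, measurable_fun setT (th k)) -> (forall k y, `|th k y| <= M) ->
  (forall eta, 0 < eta -> exists2 d, 0 < d &
    \forall k \near \oo, forall y, N x y < d -> `|th k y - th0| <= eta) ->
  \int[lam n]_y (th k y * peak x a (e k) y) @[k --> \oo] --> th0 * peak_mass a.
Proof.
move=> a0 e0 ecvg mth thM thcvg; set c := peak_mass a.
have c0 : 0 <= c.
  rewrite /c /peak_mass divr_ge0 ?powR_ge0// ltW// gph0_gt0// ltr_wpDl// divr_ge0//.
have M0 : 0 <= M by exact: le_trans (normr_ge0 _) (thM 0 (nseq_tuple n 0)).
have mT' := (measurableT : measurable [set: n.-tuple mT]).
have ik k := integrable_peak x a0 (e0 k).
have Ik k : \int[lam n]_y peak x a (e k) y = c.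
  by rewrite /Rintegral integral_peak_mass.
have ithk k : (lam n).-integrable setT (fun y => (th k y * peak x a (e k) y)%:E).
  apply: (integrable_EFin_le (m := lam n) mT' (g := fun y => M * peak x a (e k) y)).
  - by apply: measurable_funM => //; exact: measurable_peak.
  - by move=> y _; rewrite normrM ler_pM// ger0_norm// peak_ge0.
  - exact: integrable_EFinZ.
have i1 := integrable_peak x a0 ltr01.
apply/cvgrPdist_le => eps eps0.
(* Half of eps is spent near x and half away from x; the added 1 keeps the denominators positive. *)
pose eta := eps / (2 * (c + 1)).
have eta0 : 0 < eta by rewrite divr_gt0// mulr_gt0// ltr_wpDl.
have [d d0 near1] := thcvg _ eta0.
pose C := (M + `|th0|) * (1 + (a * d)^-1) `^ (n%:R / 2 + 1).
have C0 : 0 <= C by rewrite mulr_ge0 ?addr_ge0 ?powR_ge0.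
have e2 : \forall k \near \oo, e k <= eps / (2 * (C * c + 1)).
  have h : 0 < eps / (2 * (C * c + 1)) by rewrite divr_gt0// mulr_gt0// ltr_wpDl// mulr_ge0.
  by have /cvgrPdist_le/(_ _ h) := ecvg; apply: filterS => k; rewrite sub0r normrN ger0_norm// ltW.
near=> k.
have P1 : forall y, N x y < d -> `|th k y - th0| <= eta by near: k.
have P2 : e k <= eps / (2 * (C * c + 1)) by near: k.
have -> : th0 * c = \int[lam n]_y (th0 * peak x a (e k) y).
  by rewrite -(Ik k) -RintegralZl//; exact: ik.
rewrite -RintegralB//; last 2 first.
- exact: integrable_EFinZ (ik k).
- exact: ithk.
have idiff : (lam n).-integrable setT (fun y => (th0 * peak x a (e k) y - th k y * peak x a (e k) y)%:E).
  by apply: integrable_EFinB => //; exact: integrable_EFinZ.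
apply: le_trans (le_normr_Rintegral mT' idiff) _.
have iz1 := integrable_EFinZ mT' eta (ik k).
have iz2 := integrable_EFinZ mT' C i1.
have iz3 := integrable_EFinZ mT' (e k) iz2.
have ib : (lam n).-integrable setT (fun y => (eta * peak x a (e k) y + e k * (C * peak x a 1 y))%:E).
  exact: (integrable_EFinD (m := lam n) mT' iz1 iz3).
apply: (@le_trans _ _ (\int[lam n]_y (eta * peak x a (e k) y + e k * (C * peak x a 1 y)))).
  apply: le_Rintegral => //.
    apply: (integrable_EFin_le (m := lam n) mT' (g := fun y => `|th0 * peak x a (e k) y - th k y * peak x a (e k) y|)).
    - apply: measurableT_comp => //; apply: measurable_funB; apply: measurable_funM => //; exact: measurable_peak.
    - by move=> y _; rewrite normr_id.
    - exact: (integrable_norm idiff).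
  move=> y _; rewrite -mulrBl normrM distrC [`|peak _ _ _ _|]ger0_norm ?peak_ge0//.
  have [Nd|dN] := ltP (N x y) d.
    apply: (@le_trans _ _ (eta * peak x a (e k) y)).
      by rewrite ler_wpM2r ?peak_ge0 ?P1.
    by rewrite lerDl mulr_ge0 ?(ltW (e0 k))// mulr_ge0// peak_ge0.
  apply: (@le_trans _ _ (e k * (C * peak x a 1 y))); last first.
    by rewrite lerDr mulr_ge0 ?(ltW eta0)// peak_ge0.
  apply: (@le_trans _ _ ((M + `|th0|) * peak x a (e k) y)).
    by rewrite ler_wpM2r ?peak_ge0// (le_trans (ler_normB _ _))// lerD.
  have -> : e k * (C * peak x a 1 y) = (M + `|th0|) *
      (e k * ((1 + (a * d)^-1) `^ (n%:R / 2 + 1) * peak x a 1 y)) by rewrite /C; ring.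
  have M1 : 0 <= M + `|th0| by rewrite addr_ge0.
  exact: ler_wpM2l M1 _ _ (peak_le a0 (e0 k) d0 dN).
rewrite (RintegralD mT' iz1 iz3) (RintegralZl (e k) mT' iz2).
rewrite (RintegralZl eta mT' (ik k)) (RintegralZl C mT' i1).
rewrite Ik; have -> : \int[lam n]_y peak x a 1 y = c by rewrite /Rintegral integral_peak_mass.
have c1 : 0 < c + 1 by rewrite ltr_wpDl.
have cC1 : 0 < C * c + 1 by rewrite ltr_wpDl// mulr_ge0.
have -> : eps = eta * (c + 1) + eps / (2 * (C * c + 1)) * (C * c + 1).
  by rewrite /eta; field; rewrite !gt_eqF.
apply: lerD; first by rewrite ler_wpM2l ?(ltW eta0)// lerDl.
apply: ler_pM => //; [exact: ltW|by rewrite mulr_ge0|by rewrite lerDl].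
Unshelve. all: end_near. Qed.

End approximate_identity.

Section bounds.
Context {R : realType}.

(** Near 0 the limit bounds g, and on the remaining compact interval continuity does. *)
Lemma bounded_right (g : R -> R) (l S : R) : (forall s : R, 0 < s -> {for s, continuous g}) ->
  g s @[s --> (0 : R)^'+] --> l -> exists2 C, 0 <= C & forall s, 0 < s <= S -> `|g s| <= C.
Proof.
move=> cg /cvgrPdist_lt/(_ _ ltr01)[d /= d0 gd].
have [dS|Sd] := leP d S; last first.
  exists (`|l| + 1); first by rewrite addr_ge0.
  move=> s /andP[s0 sS]; have := gd s; rewrite /= sub0r normrN gtr0_norm// => /(_ (le_lt_trans sS Sd) s0).
  move=> h; rewrite -[g s](subKr l) (le_trans (ler_normB _ _))// lerD2l ltW//.
have d20 : 0 < d / 2 by rewrite divr_gt0.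
have d2d : d / 2 < d by rewrite ltr_pdivrMr// ltr_pMr// ltr1n.
have cn : {within `[d / 2, S], continuous (fun s => `|g s|)}.
  apply: continuous_in_subspaceT => s; rewrite inE/= in_itv/= => /andP[ds _].
  by apply: (ctp_comp (h := fun r : R => `|r|)); [exact: cg (lt_le_trans d20 ds)|exact: norm_continuous].
have [c _ cmax] := EVT_max (ltW (lt_le_trans d2d dS)) cn.
exists (`|l| + 1 + `|g c|); first by rewrite !addr_ge0.
move=> s /andP[s0 sS]; have [ds|sd] := leP (d / 2) s.
  by rewrite (le_trans (cmax s _)) ?in_itv/= ?ds// lerDr addr_ge0.
have := gd s; rewrite /= sub0r normrN gtr0_norm// => /(_ (lt_trans sd d2d) s0) h.
rewrite -[g s](subKr l) (le_trans (ler_normB _ _))// -addrA lerD2l.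
by rewrite (le_trans (ltW h))// lerDl.
Qed.

Lemma bounded_on_compact {n} (K : set 'rV[R]_n) (g : 'rV[R]_n -> R) : compact K ->
  (forall y, K y -> {for y, continuous g}) ->
  exists2 M, 0 <= M & forall y, K y -> `|g y| <= M.
Proof.
move=> cK cg; have [K0|/set0P K0] := eqVneq K set0.
  by exists 0 => // y; rewrite K0.
have cn : {within K, continuous (fun y => `|g y|)}.
  apply: continuous_in_subspaceT => y; rewrite inE => yK.
  by apply: (cvg_comp g (fun r : R => `|r|) (cg y yK)); exact: norm_continuous.
have [c _ cmax] := EVT_max_rV K0 cK cn.
by exists `|g c| => // y yK; apply: cmax; rewrite inE.
Qed.

Lemma cvg_to_right (T : Type) (F : set_system T) {FF : Filter F} (u : T -> R) :
  u t @[t --> F] --> (0 : R) -> (\forall t \near F, 0 < u t) ->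
  u t @[t --> F] --> (0 : R)^'+.
Proof.
move=> u0 up B; rewrite /at_right /within /= => hB.
have := u0 _ hB; rewrite /= => hB'.
by apply: filterS2 up hB' => t ut /(_ ut).
Qed.

(** The asymptotics of h1 and h2 involve powers of s + e, the peak a power of s r + e with r tending
    to 1. The quotient of the two bases tends to 1 however s and e compare, because it differs from
    1 by (1 - r) s / (s + e). The h1 term is one power of s + e smaller and drops out. *)
Lemma cvg_radial_density (T : Type) (F : set_system T) {FF : Filter F}
    (f s e r : T -> R) (f0 k1 k2 p c : R) (h1 h2 : R -> R) : 
  f t @[t --> F] --> f0 -> s t @[t --> F] --> (0 : R) -> e t @[t --> F] --> (0 : R) ->
  r t @[t --> F] --> (1 : R) -> (\forall t \near F, [/\ 0 <= s t, 0 < e t & 0 < r t]) ->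
  h1 u * u `^ (p - 1) @[u --> (0 : R)^'+] --> k1 -> h2 u * u `^ p @[u --> (0 : R)^'+] --> k2 ->
  f t * ((2 * s t + e t + 2) * h2 (s t + e t) + c * h1 (s t + e t)) *
    (s t * r t + e t) `^ p @[t --> F] --> f0 * (2 * k2).
Proof.
move=> cf cs ce cr pos ch1 ch2.
have cse : s t + e t @[t --> F] --> 0^'+.
  apply: cvg_to_right; first by rewrite -[0](addr0 (0 : R)); exact: cvgD.
  by apply: filterS pos => t [s0 e0 _]; rewrite ltr_wpDl.
have c1 := cvg_comp (fun t => s t + e t) _ cse ch1.
have c2 := cvg_comp (fun t => s t + e t) _ cse ch2.
have cse0 : s t + e t @[t --> F] --> (0 : R) by rewrite -[0](addr0 (0 : R)); exact: cvgD.
have crho : (s t * r t + e t) / (s t + e t) @[t --> F] --> (1 : R).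
  apply/cvgrPdist_le => d d0; have /cvgrPdist_le/(_ _ d0) h := cr.
  apply: filterS2 pos h => t [s0 e0 r0] rd.
  have st : 0 < s t + e t by rewrite ltr_wpDl.
  have -> : 1 - (s t * r t + e t) / (s t + e t) = (1 - r t) * (s t / (s t + e t)).
    by field; rewrite gt_eqF.
  rewrite normrM (le_trans _ rd)// ler_piMr// ger0_norm ?divr_ge0 ?(ltW st)//.
  by rewrite ler_pdivrMr// mul1r lerDl ltW.
have crhop : ((s t * r t + e t) / (s t + e t)) `^ p @[t --> F] --> (1 : R).
  have p1 : (1 : R) `^ p = 1 by rewrite powR1.
  by rewrite -[X in _ --> X]p1; apply: (cvg_comp _ (fun u : R => u `^ p) crho); exact: powR_continuous ltr01.
have main : f t * ((2 * s t + e t + 2) * (h2 (s t + e t) * (s t + e t) `^ p) +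
     c * (s t + e t) * (h1 (s t + e t) * (s t + e t) `^ (p - 1))) *
     ((s t * r t + e t) / (s t + e t)) `^ p @[t --> F] --> f0 * (2 * k2).
  rewrite [X in _ --> X](_ : _ = f0 * ((2 * 0 + 0 + 2) * k2 + c * 0 * k1) * 1); last by ring.
  apply: cvgM; last exact: crhop.
  apply: cvgM; first exact: cf.
  apply: cvgD; apply: cvgM; [|exact: c2| |exact: c1].
    apply: cvgD; last exact: cvg_cst.
    apply: cvgD; last exact: ce.
    by apply: cvgM; [exact: cvg_cst|exact: cs].
  by apply: cvgM; [exact: cvg_cst|exact: cse0].
apply: cvg_trans main; apply: near_eq_cvg; apply: filterS pos => t [s0 e0 r0].
have st : 0 < s t + e t by rewrite ltr_wpDl.
have At : 0 < s t * r t + e t by rewrite ltr_wpDl// mulr_ge0// ltW.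
rewrite powRM ?invr_ge0 ?(ltW st) ?(ltW At)// -powR_inv1 ?(ltW st)// -powRrM mulN1r.
rewrite powRN (powRDp p (-1) st) powR_inv1 ?(ltW st)//.
by field; rewrite !gt_eqF ?powR_gt0.
Qed.

Lemma nbhs_dotv {n} (x : 'rV[R]_n) (A : set 'rV[R]_n) : nbhs x A ->
  exists2 d, 0 < d & forall y, dotv (y - x) (y - x) < d -> A y.
Proof.
move=> /nbhs_ballP[e /= e0 xA]; exists (e ^+ 2); first by rewrite exprn_gt0.
move=> y yd; apply: xA; split=> // i j; rewrite ord1 /ball/=.
rewrite -(@ltr_pXn2r _ 2)// ?nnegrE ?(ltW e0)// real_normK ?num_real//.
apply: le_lt_trans yd; have := sqr_le_dotv (y - x) j.
by rewrite !mxE -sqrrN opprB.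
Qed.

End bounds.

(** * The distributional equation for a radial solution with a pole *)

Section point_source.
Context {R : realType} {n : nat}.
Local Notation mT := (measurableTypeR R).
Local Notation lam := (@lebesgue_tuple R).
Implicit Types (x y : 'rV[R]_n) (K : set 'rV[R]_n) (f : 'rV[R]_n -> R).
Context (h h1 h2 : R -> R) (la kap : R).
Hypothesis n2 : (2 < n)%N.
Hypothesis dh : forall s : R, 0 < s -> is_derive s 1 h (h1 s).
Hypothesis dh1 : forall s : R, 0 < s -> is_derive s 1 h1 (h2 s).
Hypothesis ch2 : forall s : R, 0 < s -> {for s, continuous h2}.
Hypothesis ode : forall s, 0 < s ->
  s * (s + 2) * h2 s + n%:R * (1 + s) * h1 s + la * h s = 0.
Local Notation m := (n%:R / 2 - 1 : R).
(** The three limits state that h, h1, h2 behave like kap s^(-m) and its first two derivatives; m +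
    1 = n / 2. *)
Hypothesis lim0 : h s * s `^ m @[s --> (0 : R)^'+] --> kap.
Hypothesis lim1 : h1 s * s `^ (n%:R / 2) @[s --> (0 : R)^'+] --> - m * kap.
Hypothesis lim2 : h2 s * s `^ (n%:R / 2 + 1) @[s --> (0 : R)^'+] --> n%:R / 2 * m * kap.

Let e (k : nat) : R := k.+2%:R^-1.
Let e0 k : 0 < e k. Proof. by rewrite invr_gt0. Qed.
Let e1 k : e k <= 1. Proof. by rewrite invf_le1// ler1n. Qed.

Section fixed_test_function.
Context K (f : 'rV[R]_n -> R) (x : 'rV[R]_n).
Hypotheses (cK : compact K) (KB : K `<=` uball) (sf : smooth f)
  (f0 : forall y, ~ K y -> f y = 0) (xb : uball x).

Definition helm y : R := (- laplaceB f y - la * f y) * dV y.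
(* (- Delta - la) applied to h (hgap x y + e k), times f dV, is e k times this. *)
Definition defect (k : nat) y : R := f y * dV y *
  ((2 * hgap x y + e k + 2) * h2 (hgap x y + e k) + n%:R * h1 (hgap x y + e k)).

Let X0 : 0 < 1 - dotv x x := uball_gt0 xb.
Let s0 y k : uball y -> 0 < hgap x y + e k.
Proof. by move=> yb; rewrite ltr_wpDl// hgap_ge0. Qed.

Lemma helm_outside y : ~ K y -> helm y = 0.
Proof. by move=> Ky; rewrite /helm (laplaceB_outside cK)// f0// mulr0 oppr0 addr0 mul0r. Qed.

Lemma ctp_dV y : uball y -> {for y, continuous (@dV R n)}.
Proof.
move=> yb; rewrite (_ : @dV R n = fun z => conformal z ^+ n); last exact/funext/dV_conformal.
by apply: ctpX; exact: ctp_conformal.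
Qed.

Lemma continuous_helm : continuous helm.
Proof.
apply: (continuous_extend cK KB helm_outside) => y yb; apply: ctpM; last exact: ctp_dV.
apply: ctpB; first by apply: ctpN; exact: ctp_laplaceB.
by apply: ctpM; [exact: ctp_cst|exact: smooth_continuous].
Qed.

Lemma defect_outside k y : ~ K y -> defect k y = 0.
Proof. by move=> Ky; rewrite /defect f0// !mul0r. Qed.

Let ctp_shift y k : uball y -> {for y, continuous (fun z => hgap x z + e k)}.
Proof. by move=> yb; apply: ctpD; [exact: ctp_hgap|exact: ctp_cst]. Qed.

Lemma continuous_defect k : continuous (defect k).
Proof.
apply: (continuous_extend cK KB (@defect_outside k)) => y yb.
have cs := @ctp_shift y k yb; have ys := s0 k yb.
apply: ctpM; first by apply: ctpM; [exact: smooth_continuous|exact: ctp_dV].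
apply: ctpD; apply: ctpM.
- apply: ctpD; last exact: ctp_cst.
  apply: ctpD; last exact: ctp_cst.
  by apply: ctpM; [exact: ctp_cst|exact: ctp_hgap].
- exact: ctp_comp cs (ch2 ys).
- exact: ctp_cst.
- exact: ctp_comp cs (is_derive_continuous (dh1 ys)).
Qed.

Let hhelm k y := h (hgap x y + e k) * helm y.

Let continuous_hhelm k : continuous (hhelm k).
Proof.
apply: (continuous_extend cK KB) => [y Ky|y yb]; first by rewrite /hhelm helm_outside// mulr0.
apply: ctpM; last exact: continuous_helm.
exact: ctp_comp (@ctp_shift y k yb) (is_derive_continuous (dh (s0 k yb))).
Qed.

(** Green's identity, from which f dV times the ODE at the shifted point [hgap x y + e k] is
    subtracted. *)
Lemma integral_regularized k :
  \int[lam n]_t hhelm k (row_of t) = \int[lam n]_t (e k * defect k (row_of t)).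
Proof.
have := integral_green_identity dh dh1 ch2 n2 cK KB sf f0 xb (e0 k).
have z y : ~ K y -> hhelm k y = 0 by move=> Ky; rewrite /hhelm helm_outside// mulr0.
have i1 := (integrable_compact_support cK KB (@continuous_hhelm k) z).1.
have i2 := (integrable_compact_support cK KB (@continuous_defect k) (@defect_outside k)).1.
have i3 := integrable_EFinZ (m := lam n) measurableT (e k) i2.
move=> E; apply/eqP; rewrite eq_sym -subr_eq0 -RintegralB//; apply/eqP.
rewrite /Rintegral -[RHS]/(fine 0) -E; congr fine; apply: eq_integral => t _.
congr EFin; move: (row_of t) => {t}y.
have [yK|yK] := pselect (K y); last first.
  by rewrite /hhelm helm_outside// defect_outside// (laplaceB_outside cK)// f0// !(mulr0, mul0r).
have := ode (s0 k (KB yK)); rewrite /hhelm /helm /defect; set s := hgap x y => O.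
have -> : la * f y = la * f y + 0 by rewrite addr0.
transitivity (e k * (f y * dV y * ((2 * s + e k + 2) * h2 (s + e k) + n%:R * h1 (s + e k))) -
  h (s + e k) * ((- laplaceB f y - (la * f y + 0)) * dV y) -
  f y * dV y * ((s + e k) * (s + e k + 2) * h2 (s + e k) + n%:R * (1 + (s + e k)) * h1 (s + e k) +
    la * h (s + e k))); first by rewrite O mulr0 subr0.
ring.
Qed.

Local Notation a := (2 / (1 - dotv x x) ^+ 2).
Local Notation N y := (dotv (y - x) (y - x)).

Let aN y : uball y -> a * N y = hgap x y * ((1 - dotv y y) / (1 - dotv x x)).
Proof.
move=> yb; have Y0 := uball_gt0 yb.
by rewrite hgapE; field; rewrite !gt_eqF.
Qed.

Let Y1 y : 1 - dotv y y <= 1.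
Proof. by rewrite gerBl dotv_ge0. Qed.

Definition density k y : R := defect k y * (a * N y + e k) `^ (n%:R / 2 + 1).

Lemma density_peak k (t : n.-tuple mT) :
  e k * defect k (row_of t) = density k (row_of t) * peak x a (e k) t.
Proof.
have A0 : 0 < a * N (row_of t) + e k.
  by rewrite ltr_wpDl// mulr_ge0 ?dotv_ge0// divr_ge0// sqr_ge0.
rewrite /density /peak powRN; have := powR_gt0 (n%:R / 2 + 1) A0 => Ap.
by field; rewrite gt_eqF.
Qed.

(** On K the gap is bounded, so s + e stays in an interval ]0, S + 1] on which [h1] and [h2] times
    their powers of s are bounded; and a |y - x|^2 + e <= (s + e) / (1 - |x|^2) compares the two
    bases. *)
Lemma density_bounded : exists M, forall k y, `|density k y| <= M.
Proof.
have [S S0 Sb] : exists2 S, 0 <= S & forall y, K y -> `|hgap x y| <= S.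
  by apply: bounded_on_compact => // y yK; apply: ctp_hgap => //; exact: KB.
have [M M0 Mb] : exists2 M, 0 <= M & forall y, K y -> `|f y * dV y| <= M.
  apply: bounded_on_compact => // y yK.
  by apply: ctpM; [exact: smooth_continuous|apply: ctp_dV; exact: KB].
have cp p (s : R) : 0 < s -> {for s, continuous (fun s => s `^ p)} by exact: powR_continuous.
have [C1 C10 C1b] : exists2 C, 0 <= C & forall s, 0 < s <= S + 1 -> `|h1 s * s `^ (n%:R / 2)| <= C.
  apply: bounded_right lim1 => s sp.
  by apply: ctpM; [exact: is_derive_continuous (dh1 sp)|exact: cp].
have [C2 C20 C2b] : exists2 C, 0 <= C & forall s, 0 < s <= S + 1 -> `|h2 s * s `^ (n%:R / 2 + 1)| <= C.
  by apply: bounded_right lim2 => s sp; apply: ctpM; [exact: ch2|exact: cp].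
set p : R := n%:R / 2 + 1; have p0 : 0 < p by rewrite ltr_wpDl// divr_ge0.
exists (M * ((2 * S + 1 + 2) * C2 + n%:R * (S + 1) * C1) * (1 - dotv x x)^-1 `^ p) => k y.
have B0 : 0 <= (2 * S + 1 + 2) * C2 + n%:R * (S + 1) * C1.
  by rewrite addr_ge0 ?mulr_ge0 ?addr_ge0 ?mulr_ge0.
have [yK|yK] := pselect (K y); last first.
  by rewrite /density defect_outside// mul0r normr0 !mulr_ge0 ?powR_ge0.
have yb := KB yK; have g0 := hgap_ge0 xb yb; have sp := s0 k yb.
have sS : hgap x y <= S by rewrite (le_trans (ler_norm _)) ?Sb.
have sS1 : 0 < hgap x y + e k <= S + 1 by rewrite sp lerD.
have aNy := aN yb.
rewrite /density /defect; move: (hgap x y) g0 sp sS sS1 aNy => s g0 sp sS sS1 aNy.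
have A0 : 0 <= a * N y + e k.
  by rewrite addr_ge0 ?(ltW (e0 k))// mulr_ge0 ?dotv_ge0// divr_ge0// sqr_ge0.
have As : (a * N y + e k) `^ p <= (s + e k) `^ p * (1 - dotv x x)^-1 `^ p.
  rewrite -powRM ?invr_ge0 ?(ltW sp) ?(ltW X0)//; apply: ler_powR_base => //; first exact: ltW.
  rewrite aNy [leRHS]mulrDl; apply: lerD.
    by rewrite ler_wpM2l// ler_piMl// invr_ge0 ltW.
  by rewrite ler_peMr ?(ltW (e0 k))// invf_ge1.
have key : `|(2 * s + e k + 2) * h2 (s + e k) + n%:R * h1 (s + e k)| * (s + e k) `^ p <=
    (2 * S + 1 + 2) * C2 + n%:R * (S + 1) * C1.
  rewrite -[X in _ * X <= _]ger0_norm ?powR_ge0// -normrM.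
  have -> : ((2 * s + e k + 2) * h2 (s + e k) + n%:R * h1 (s + e k)) * (s + e k) `^ p =
      (2 * s + e k + 2) * (h2 (s + e k) * (s + e k) `^ p) +
      n%:R * (s + e k) * (h1 (s + e k) * (s + e k) `^ (n%:R / 2)).
    by rewrite /p powRDp// powRr1 ?(ltW sp)//; ring.
  apply: le_trans (ler_normD _ _) _; apply: lerD; rewrite normrM; apply: ler_pM => //.
  - rewrite ger0_norm ?addr_ge0 ?mulr_ge0 ?(ltW (e0 k))//.
    by rewrite lerD2r lerD// ler_wpM2l.
  - exact: C2b.
  - rewrite ger0_norm ?mulr_ge0 ?(ltW sp)// ler_wpM2l//.
    by have /andP[] := sS1.
  - exact: C1b.
rewrite normrM [X in _ * X]ger0_norm ?powR_ge0// normrM.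
apply: (@le_trans _ _ (M * `|(2 * s + e k + 2) * h2 (s + e k) + n%:R * h1 (s + e k)| *
   ((s + e k) `^ p * (1 - dotv x x)^-1 `^ p))).
  by apply: ler_pM => //; rewrite ?mulr_ge0 ?powR_ge0// ler_wpM2r// Mb.
rewrite [leLHS](_ : _ = M * (`|(2 * s + e k + 2) * h2 (s + e k) + n%:R * h1 (s + e k)| * (s + e k) `^ p) *
   (1 - dotv x x)^-1 `^ p); last by ring.
by rewrite ler_wpM2r ?powR_ge0// ler_wpM2l.
Qed.

(** The limit is taken jointly as y tends to x and e to 0 from the right. A product neighbourhood
    then splits into a ball around x and a condition on [e k] alone, which is the uniformity that
    [cvg_peak] asks for. *)
Lemma density_limit eta : 0 < eta -> exists2 d, 0 < d &
  \forall k \near \oo, forall t : n.-tuple mT, dotv (row_of t - x) (row_of t - x) < d ->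
    `|density k (row_of t) - f x * dV x * (2 * (n%:R / 2 * m * kap))| <= eta.
Proof.
move=> eta0; pose F := filter_prod (nbhs x) (nbhs ((0 : R)^'+)).
have FF : Filter F by exact: filter_prod_filter.
have cy : (fun q : 'rV[R]_n * R => q.1) @ F --> x by exact: cvg_fst.
have ce : (fun q : 'rV[R]_n * R => q.2) @ F --> (0 : R)^'+ by exact: cvg_snd.
have ce0 : (fun q : 'rV[R]_n * R => q.2) @ F --> (0 : R).
  by apply: cvg_trans ce _; exact: cvg_within.
have nb : \forall q \near F, uball q.1.
  by apply: (cy uball); apply: open_nbhs_nbhs; split=> //; exact: uball_open.
have ne : \forall q \near F, 0 < q.2 by apply: (ce [set u | 0 < u]); exact: nbhs_right_gt.
have cf : f q.1 * dV q.1 @[q --> F] --> f x * dV x.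
  apply: (cvg_comp _ (fun y => f y * dV y) cy).
  by apply: ctpM; [exact: smooth_continuous|exact: ctp_dV].
have cs : hgap x q.1 @[q --> F] --> (0 : R).
  have <- : hgap x x = 0 by rewrite hgapE subrr dotv0 mulr0 mul0r.
  by apply: (cvg_comp _ (hgap x) cy); exact: ctp_hgap.
have cr : (1 - dotv q.1 q.1) / (1 - dotv x x) @[q --> F] --> (1 : R).
  rewrite [X in _ --> X](_ : _ = (1 - dotv x x) / (1 - dotv x x)); last by rewrite divff// gt_eqF.
  apply: (cvg_comp _ (fun y => (1 - dotv y y) / (1 - dotv x x)) cy).
  have cc : {for x, continuous (fun y => (1 - dotv y y) / (1 - dotv x x))}.
    by apply: ctpM; [exact: ctp_subdotv|exact: ctp_cst].
  exact: cc.
have pos : \forall q \near F, [/\ 0 <= hgap x q.1, 0 < q.2 & 0 < (1 - dotv q.1 q.1) / (1 - dotv x x)].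
  apply: filterS2 nb ne => q qb q0; split=> //; first exact: hgap_ge0.
  by rewrite divr_gt0// uball_gt0.
have lim1' : h1 s * s `^ (n%:R / 2 + 1 - 1) @[s --> (0 : R)^'+] --> - m * kap by rewrite addrK.
have /cvgrPdist_le/(_ _ eta0) := @cvg_radial_density R _ F FF _ _ _ _ _ _ _ _ n%:R _ _ cf cs ce0 cr pos lim1' lim2.
move=> H; have := filterI nb H => -[[A B] /= [Ax B0] AB].
have [d d0 dA] := nbhs_dotv Ax; exists d => //.
have Be : \forall k \near \oo, B (e k).
  have ek : e k @[k --> \oo] --> (0 : R)^'+.
    by apply: cvg_to_right; [exact: cvg_natinv|exact: nearW].
  exact: ek B0.
apply: filterS Be => k Bk t td; have [/= yb] := AB (row_of t, e k) (conj (dA _ td) Bk).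
by rewrite distrC /density /defect aN.
Qed.

(** The power (1 - |x|^2)^n of the mass cancels against [dV x], and Gamma(n/2 + 1) = (n/2) m
    Gamma(m) absorbs the factor from the second derivative, so the coefficient of kap f(x) is the
    same for all x. *)
Lemma integral_limit_value : f x * dV x * (2 * (n%:R / 2 * m * kap)) * @peak_mass R n a =
  2 * (2 * pi) `^ (n%:R / 2) / gph m 0 0 * kap * f x.
Proof.
have m0 : 0 < m by rewrite subr_gt0 ltr_pdivlMr// mul1r ltr_nat.
have nn0 : 0 < n%:R / 2 :> R by rewrite (lt_trans m0)// ltrBlDr ltrDl ltr01.
have G0 := gph0_gt0 m0.
have -> : @peak_mass R n a = (pi / a) `^ (n%:R / 2) / (n%:R / 2 * (m * gph m 0 0)).
  rewrite /peak_mass; congr (_ / _).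
  have -> : gph (n%:R / 2 + 1) 0 0 = n%:R / 2 * gph (n%:R / 2) 0 0 :> R.
    by rewrite gphS// mul0r subr0.
  by congr (_ * _); rewrite -{1}[n%:R / 2](subrK 1) gphS// mul0r subr0.
have -> : (pi / a) `^ (n%:R / 2) = (pi / 2) `^ (n%:R / 2) * (1 - dotv x x) ^+ n :> R.
  have -> : pi / a = pi / 2 * (1 - dotv x x) ^+ 2 by field; rewrite gt_eqF.
  rewrite powRM ?divr_ge0 ?pi_ge0 ?sqr_ge0//; congr (_ * _).
  rewrite -powR_mulrn ?(ltW X0)// -powRrM mulrC divfK ?pnatr_eq0//.
  by rewrite powR_mulrn// ltW.
have -> : (2 * pi) `^ (n%:R / 2) = 2 ^+ n * (pi / 2) `^ (n%:R / 2) :> R.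
  have -> : 2 * pi = 2 ^+ 2 * (pi / 2) :> R by field.
  rewrite powRM ?divr_ge0 ?pi_ge0 ?sqr_ge0//; congr (_ * _).
  rewrite -powR_mulrn// -powRrM mulrC divfK ?pnatr_eq0//.
  by rewrite powR_mulrn.
rewrite dV_conformal /conformal expr_div_n.
have Xn : (1 - dotv x x) ^+ n != 0 by rewrite expf_neq0// gt_eqF.
set P := (pi / 2) `^ _; set Q := (1 - dotv x x) ^+ n in Xn *.
have m0' : m != 0 by rewrite gt_eqF.
have n0' : n%:R != 0 :> R by rewrite pnatr_eq0 -lt0n (ltn_trans _ n2).
have n2' : n%:R - 2 != 0 :> R by rewrite gt_eqF// subr_gt0 ltr_nat.
by field; rewrite n0' n2' Xn (gt_eqF G0).
Qed.

Lemma cvg_regularized : \int[lam n]_t hhelm k (row_of t) @[k --> \oo] -->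
  2 * (2 * pi) `^ (n%:R / 2) / gph m 0 0 * kap * f x.
Proof.
have [M Mb] := density_bounded.
have a0 : 0 < a by rewrite divr_gt0// exprn_gt0.
rewrite -integral_limit_value.
rewrite (_ : (fun k => _) = fun k => \int[lam n]_t (density k (row_of t) * peak x a (e k) t)); last first.
  apply/funext => k; rewrite integral_regularized; congr fine.
  by apply: eq_integral => t _; rewrite density_peak.
apply: (@cvg_peak R n x a (fun k t => density k (row_of t)) e _ M) => //.
- exact: cvg_natinv.
- move=> k; apply: measurable_funM.
    exact: measurable_continuous_row (@continuous_defect k).
  apply: (measurableT_comp (f := fun u : R => u `^ _) (@measurable_powR _ _)).
  by apply: measurable_funD => //; apply: measurable_funM => //; exact: measurable_dotv_row.
- exact: density_limit.
Qed.

(** Dominated convergence as e tends to 0, carried out off the null set where y = x. Inside the ball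
    |y - x|^2 <= s, so the limit of h(s) s^m gives |h(s + e)| <= C |y - x|^(-2 m), uniformly in
    e. *)
Lemma integral_point_source :
  (lam n).-integrable setT (fun t => (h (hgap x (row_of t)) * helm (row_of t))%:E) /\
  \int[lam n]_t (h (hgap x (row_of t)) * helm (row_of t)) =
    2 * (2 * pi) `^ (n%:R / 2) / gph m 0 0 * kap * f x.
Proof.
have m0 : 0 < m by rewrite subr_gt0 ltr_pdivlMr// mul1r ltr_nat.
have [S S0 Sb] : exists2 S, 0 <= S & forall y, K y -> `|hgap x y| <= S.
  by apply: bounded_on_compact => // y yK; apply: ctp_hgap => //; exact: KB.
have [M M0 Mb] := bounded_of_compact_support cK continuous_helm helm_outside.
have [C C0 Cb] : exists2 C, 0 <= C & forall s, 0 < s <= S + 1 -> `|h s * s `^ m| <= C.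
  apply: bounded_right lim0 => s sp.
  by apply: ctpM; [exact: is_derive_continuous (dh sp)|exact: powR_continuous].
pose X := [set t : n.-tuple mT | row_of t = x].
have mX : measurable X by exact: measurable_row_set1.
have X00 : lam n X = 0%E by apply: lebesgue_tuple_set1; exact: ltn_trans n2.
pose D := setT `\` X; have mD : measurable D by exact: measurableD.
(* The constant e^4 compensates the Gaussian factor of the integrable majorant, since |y - x|^2 <= 4
   for two points of the ball. *)
pose g t : R := C * M * expR 4 *
  (dotv (row_of t - x) (row_of t - x) `^ (- m) * expR (- dotv (row_of t - x) (row_of t - x))).
have ig : (lam n).-integrable setT (fun t => (g t)%:E).
  by apply: integrable_EFinZ => //; exact: integrable_riesz.
have mh k : measurable_fun [set: n.-tuple mT] (fun t => hhelm k (row_of t)).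
  exact: measurable_continuous_row.
have N0 t : D t -> 0 < dotv (row_of t - x) (row_of t - x).
  move=> [_ /= tx]; rewrite lt_neqAle dotv_ge0 andbT eq_sym; apply/eqP => /dotv_eq0/eqP.
  by rewrite subr_eq0 => /eqP.
have dom k t : D t -> `|hhelm k (row_of t)| <= g t.
  move=> Dt; have Nt := N0 t Dt; rewrite /g; move: (row_of t) Nt => y Nt {t Dt}.
  have [yK|yK] := pselect (K y); last first.
    by rewrite /hhelm helm_outside// mulr0 normr0 !mulr_ge0 ?expR_ge0 ?powR_ge0.
  have yb := KB yK; have Y0 := uball_gt0 yb; have sp := s0 k yb; have g0 := hgap_ge0 xb yb.
  have Ns : N y <= hgap x y + e k.
    apply: (@le_trans _ _ (hgap x y)); last by rewrite lerDl ltW.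
    rewrite hgapE ler_pdivlMr ?mulr_gt0// mulrC ler_wpM2r ?dotv_ge0//.
    rewrite (le_trans (ler_pM _ _ (Y1 x) (Y1 y))) ?(ltW X0) ?(ltW Y0)// mul1r.
    by rewrite ler1n.
  have N4 : N y <= 4.
    have p4 : N y = 2 * dotv y y + 2 * dotv x x - dotv (y + x) (y + x).
      by rewrite !dotvE; ring.
    rewrite p4 lerBlDr (@le_trans _ _ 4)//; last by rewrite lerDl dotv_ge0.
    move: X0 Y0; rewrite !subr_gt0 => x1 y1.
    have -> : 4 = 2 * 1 + 2 * 1 :> R by ring.
    by apply: lerD; rewrite ler_wpM2l// ltW.
  rewrite /hhelm normrM.
  have hb : `|h (hgap x y + e k)| <= C * N y `^ (- m).
    have sS : 0 < hgap x y + e k <= S + 1.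
      by rewrite sp lerD// (le_trans (ler_norm _)) ?Sb.
    have := Cb _ sS; rewrite normrM [`|_ `^ _|]ger0_norm ?powR_ge0// => hC.
    rewrite powRN ler_pdivlMr ?powR_gt0//; apply: le_trans hC.
    by rewrite ler_wpM2l// ler_powR_base ?(ltW m0)// ltW.
  have E1 : 1 <= expR 4 * expR (- N y).
    by rewrite -expRD -[leLHS]expR0 ler_expR subr_ge0.
  apply: (@le_trans _ _ (C * N y `^ (- m) * M)); first by rewrite ler_pM.
  rewrite [leRHS](_ : _ = C * N y `^ (- m) * M * (expR 4 * expR (- N y))); last by ring.
  by rewrite ler_peMr// !mulr_ge0 ?powR_ge0.
have lims t : D t -> hhelm k (row_of t) @[k --> \oo] --> h (hgap x (row_of t)) * helm (row_of t).
  move=> Dt; have Nt := N0 t Dt; move: (row_of t) Nt => y Nt {t Dt}.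
  have [yK|yK] := pselect (K y); last first.
    rewrite helm_outside// mulr0 (_ : (fun k => _) = fun=> 0); first exact: cvg_cst.
    by apply/funext => k; rewrite /hhelm helm_outside// mulr0.
  have yb := KB yK; have sp : 0 < hgap x y.
    by rewrite hgapE divr_gt0 ?mulr_gt0 ?uball_gt0.
  apply: cvgM; last exact: cvg_cst.
  have ce : hgap x y + e k @[k --> \oo] --> hgap x y.
    by rewrite -[X in _ --> X]addr0; apply: cvgD; [exact: cvg_cst|exact: cvg_natinv].
  exact: (cvg_comp (fun k => hgap x y + e k) h ce (is_derive_continuous (dh sp))).
have mlim : measurable_fun D (fun t => h (hgap x (row_of t)) * helm (row_of t)).
  apply: (measurable_fun_cvg (h := fun k t => hhelm k (row_of t))) => //.
  by move=> k; apply: measurable_funS (mh k).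
have mlimT : measurable_fun setT (fun t : n.-tuple mT => h (hgap x (row_of t)) * helm (row_of t)).
  have -> : [set: n.-tuple mT] = D `|` X by rewrite /D setDE setTI setvU.
  apply/measurable_funU => //; split=> //.
  apply: (eq_measurable_fun (fun=> h (hgap x x) * helm x)) => //.
  by move=> t; rewrite inE => ->.
have igD : (lam n).-integrable D (fun t => (g t)%:E) by exact: integrableS ig.
have [] := @dominated_convergence _ _ _ (lam n) D mD
  (fun k t => (hhelm k (row_of t))%:E) (fun t => (h (hgap x (row_of t)) * helm (row_of t))%:E)
  (fun t => (g t)%:E).
- by move=> k; apply/measurable_EFinP; apply: measurable_funS (mh k).
- exact/measurable_EFinP.
- by apply: aeW => t Dt; apply/fine_cvgP; split; [exact: nearW|exact: lims].
- exact: igD.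
- by apply: aeW => t k Dt; rewrite lee_fin dom.
move=> iD _ cD.
have iT : (lam n).-integrable setT (fun t => (h (hgap x (row_of t)) * helm (row_of t))%:E).
  by apply/(negligible_integrable mX) => //; apply/measurable_EFinP.
split=> //.
rewrite (fine_integral mD iD) in cD.
have /fine_cvg cD' := cD.
have E k : \int[lam n]_t hhelm k (row_of t) = \int[lam n]_(t in D) hhelm k (row_of t).
  have z y : ~ K y -> hhelm k y = 0 by move=> Ky; rewrite /hhelm helm_outside// mulr0.
  have i1 := (integrable_compact_support cK KB (@continuous_hhelm k) z).1.
  by congr fine; rewrite (negligible_integral mX measurableT i1 X00).
have -> : \int[lam n]_t (h (hgap x (row_of t)) * helm (row_of t)) =
    \int[lam n]_(t in D) (h (hgap x (row_of t)) * helm (row_of t)).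
  by congr fine; rewrite (negligible_integral mX measurableT iT X00).
have cR := cvg_regularized; rewrite (_ : (fun k => _) = fun k => \int[lam n]_(t in D) hhelm k (row_of t)) in cR; last exact/funext.
exact: (cvg_unique _ cD' cR).
Qed.

End fixed_test_function.
End point_source.

(** * The angular integral *)

Section kernel_integral.
Context {R : realType} (nu : R).
Local Notation mu := (@lebesgue_measure R).
Local Notation zpi := (`]0%R, pi[%classic : set R).
Implicit Types (b u t : R).

(* The real part of (c1 - i c2) e^(i x). *)
Definition osc (c1 c2 x : R) : R := c1 * cos x + c2 * sin x.

Lemma osc_bound c1 c2 x : `|osc c1 c2 x| <= `|c1| + `|c2|.
Proof.
rewrite /osc (le_trans (ler_normD _ _))// !normrM lerD// ler_piMr// ler_norml.
  by rewrite cos_geN1 cos_le1.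
by rewrite sin_geN1 sin_le1.
Qed.

Lemma is_derive_osc c1 c2 (x : R) : is_derive x 1 (osc c1 c2) (osc c2 (- c1) x).
Proof. by rewrite /osc; derive_tac; ring. Qed.

Definition phase u t : R := nu * (2 * ln (sin t) - ln (u + cos t)).

(* The real part of (c1 - i c2) (u + cos t)^(b - i nu) (sin t)^(2 i nu). *)
Definition kern b c1 c2 u t : R := (u + cos t) `^ b * osc c1 c2 (phase u t).

Definition kint b c1 c2 u : R := \int[mu]_(t in zpi) kern b c1 c2 u t.

Lemma zpiP t : zpi t <-> 0 < t < pi.
Proof. by rewrite /= in_itv/=. Qed.

Lemma measurable_zpi : @measurable _ (measurableTypeR R) zpi.
Proof. exact: measurable_itv. Qed.

Lemma measurable_osc c1 c2 : measurable_fun [set: R] (osc c1 c2).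
Proof.
apply: continuous_measurable_fun => x.
exact: is_derive_continuous (is_derive_osc c1 c2 x).
Qed.

Lemma measurable_addcos u : measurable_fun [set: R] (fun t => u + cos t).
Proof.
apply: measurable_funD => //; exact: continuous_measurable_fun (@continuous_cos R).
Qed.

Lemma measurable_kern b c1 c2 u : measurable_fun [set: R] (kern b c1 c2 u).
Proof.
apply: measurable_funM.
  apply: (measurableT_comp (f := fun v : R => v `^ b) (@measurable_powR _ _)).
  exact: measurable_addcos.
apply: (measurableT_comp (@measurable_osc c1 c2)); apply: measurable_funM => //.
apply: measurable_funB.
  apply: measurable_funM => //; apply: (measurableT_comp (f := @ln R) (@measurable_ln R)).
  exact: continuous_measurable_fun (@continuous_sin R).
apply: (measurableT_comp (f := @ln R) (@measurable_ln R)); exact: measurable_addcos.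
Qed.

Lemma powR_between b c d (x : R) : 0 < c -> c <= x <= d -> x `^ b <= c `^ b + d `^ b.
Proof.
move=> c0 /andP[cx xd]; have x0 := lt_le_trans c0 cx.
have [b0|b0] := leP 0 b.
  by rewrite (le_trans (ler_powR_base b0 (ltW x0) xd))// lerDr powR_ge0.
apply: (@le_trans _ _ (c `^ b)); last by rewrite lerDl powR_ge0.
rewrite -[b]opprK powRN (powRN c) lef_pV2 ?posrE ?powR_gt0//.
by apply: ler_powR_base; [rewrite oppr_ge0 ltW|exact: ltW|].
Qed.

Lemma cos_bound t : -1 <= cos t <= 1.
Proof. by rewrite cos_geN1 cos_le1. Qed.

Lemma kern_bound b c1 c2 u v w t : 1 < v -> v <= u <= w ->
  `|kern b c1 c2 u t| <= ((v - 1) `^ b + (w + 1) `^ b) * (`|c1| + `|c2|).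
Proof.
move=> v1 /andP[vu uw]; have /andP[cN1 c1'] := cos_bound t.
rewrite /kern normrM ler_pM ?osc_bound// ger0_norm ?powR_ge0//.
apply: powR_between; first by rewrite subr_gt0.
by apply/andP; split; apply: lerD.
Qed.

Lemma integrable_zpi_cst (M : R) : mu.-integrable zpi (fun=> M%:E).
Proof.
have mz := measurable_zpi; apply/integrableP; split; first exact: measurable_cst.
have E : (mu zpi = pi%:E)%E by rewrite lebesgue_measure_itv/= lte_fin pi_gt0 -EFinB subr0.
have h : (`|M%:E| * mu zpi < +oo)%E by rewrite E -EFinM ltry.
by rewrite integral_cst.
Qed.

Lemma integrable_zpi_bounded (g : R -> R) M : measurable_fun zpi g ->
  (forall t, zpi t -> `|g t| <= M) -> mu.-integrable zpi (fun t => (g t)%:E).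
Proof.
move=> mg gM; apply: (integrable_EFin_le (m := mu) measurable_zpi (g := fun=> M)) => //.
exact: integrable_zpi_cst.
Qed.

Lemma integrable_kern b c1 c2 u : 1 < u -> mu.-integrable zpi (fun t => (kern b c1 c2 u t)%:E).
Proof.
move=> u1; apply: (integrable_zpi_bounded (M := ((u - 1) `^ b + (u + 1) `^ b) * (`|c1| + `|c2|))).
  exact: measurable_funS (measurableT) (@subsetT _ _) (@measurable_kern b c1 c2 u).
by move=> t _; apply: kern_bound => //; rewrite lexx.
Qed.

Lemma addcos_gt0 u t : 1 < u -> 0 < u + cos t.
Proof. by move=> u1; have /andP[c _] := cos_bound t; lra. Qed.

Lemma is_derive_kern b c1 c2 u t : 0 < u + cos t ->
  is_derive u 1 (fun v => kern b c1 c2 v t)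
    (b * kern (b - 1) c1 c2 u t - nu * kern (b - 1) c2 (- c1) u t).
Proof.
move=> P0.
have d1 : is_derive u 1 (fun v => phase v t) (- (nu / (u + cos t))).
  by rewrite /phase; derive_tac => //; field; rewrite gt_eqF.
have d2 := is_derive1_compf (g := fun v => phase v t) (is_derive_osc c1 c2 (phase u t)) d1.
rewrite /kern; derive_tac => //.
rewrite (powRDp b (-1) P0) powR_inv1 ?ltW//; field; rewrite gt_eqF//.
Qed.

(** Differentiation under the integral on ]v, w[ with v > 1, where u + cos t stays away from 0. The
    factor b - i nu takes this form because multiplying c1 - i c2 by i replaces (c1, c2) by (c2, -
    c1). *)
Lemma is_derive_kint b c1 c2 u : 1 < u ->
  is_derive u 1 (kint b c1 c2) (b * kint (b - 1) c1 c2 u - nu * kint (b - 1) c2 (- c1) u).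
Proof.
move=> u1; pose v := (1 + u) / 2; pose w := u + 1.
have v1 : 1 < v by rewrite /v; lra.
have ua : `]v, w[%classic u by rewrite /= in_itv/= /v /w; apply/andP; split; lra.
pose B := ((v - 1) `^ (b - 1) + (w + 1) `^ (b - 1)).
pose G := `|b| * (B * (`|c1| + `|c2|)) + `|nu| * (B * (`|c2| + `|c1|)).
have B0 : 0 <= B by rewrite addr_ge0 ?powR_ge0.
have G0 : 0 <= G by apply: addr_ge0; apply: mulr_ge0 => //; apply: mulr_ge0 => //; exact: addr_ge0.
have dk x t : `]v, w[%classic x ->
    is_derive x 1 (fun y => kern b c1 c2 y t)
      (b * kern (b - 1) c1 c2 x t - nu * kern (b - 1) c2 (- c1) x t).
  by rewrite /= in_itv/= => /andP[vx _]; apply/is_derive_kern/addcos_gt0; exact: lt_trans vx.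
have P1E x t : `]v, w[%classic x -> partial1of2 (kern b c1 c2) x t =
    b * kern (b - 1) c1 c2 x t - nu * kern (b - 1) c2 (- c1) x t.
  by move=> xv; rewrite /partial1of2 derive1E; have := dk x t xv => d; rewrite derive_val.
have H1 x : `]v, w[%classic x -> mu.-integrable zpi (EFin \o kern b c1 c2 x).
  by rewrite /= in_itv/= => /andP[vx _]; apply: integrable_kern; exact: lt_trans vx.
have H2 x t : `]v, w[%classic x -> zpi t -> derivable ((kern b c1 c2)^~ t) x 1.
  by move=> xv _; have [] := dk x t xv.
have H3 x t : `]v, w[%classic x -> zpi t -> `|partial1of2 (kern b c1 c2) x t| <= G.
  move=> xv _; rewrite P1E//; move: xv; rewrite /= in_itv/= => /andP[vx xw].
  have xx : v <= x <= w by rewrite !ltW.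
  rewrite (le_trans (ler_normB _ _))// [`|b * _|]normrM [`|nu * _|]normrM lerD// ler_wpM2l//.
    exact: kern_bound.
  by rewrite -[`|c1|]normrN; exact: kern_bound.
have D1 := derivable_under_integral measurable_zpi ua H1 H2 (fun=> G0) (integrable_zpi_cst G) H3.
have D2 := differentiation_under_integral measurable_zpi ua H1 H2 (fun=> G0) (integrable_zpi_cst G) H3.
apply: DeriveDef; first exact: D1.
rewrite -derive1E D2 -RintegralZl ?measurable_zpi//; last exact: integrable_kern.
rewrite -RintegralZl ?measurable_zpi//; last exact: integrable_kern.
rewrite -RintegralB ?measurable_zpi//; last 2 first.
- by apply: integrable_EFinZ; [exact: measurable_zpi|exact: integrable_kern].
- by apply: integrable_EFinZ; [exact: measurable_zpi|exact: integrable_kern].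
by congr fine; apply: eq_integral => t _; rewrite P1E.
Qed.

Lemma addcos1_gt0 t : zpi t -> 0 < 1 + cos t.
Proof. by move=> /zpiP/cos_lt1_0pi/andP[c _]; lra. Qed.

Lemma continuous_kern_angle b c1 c2 u t : 1 < u -> zpi t -> {for t, continuous (kern b c1 c2 u)}.
Proof.
move=> u1 /zpiP t0; have P0 := addcos_gt0 t u1; have s0 := sin_gt0_pi t0.
by rewrite /kern /osc /phase; continuous_tac.
Qed.

(* The integral over ]0, pi[ of the derivative of
   (u + cos t)^(b - 1) sin t osc c1 c2 (phase u t). *)
Lemma kint_recurrence b c1 c2 u : 1 < u ->
  (u ^+ 2 - 1) * ((b - 1) * kint (b - 2) c1 c2 u - nu * kint (b - 2) c2 (- c1) u) +
  (1 - 2 * b) * u * kint (b - 1) c1 c2 u + b * kint b c1 c2 u + nu * kint b c2 (- c1) u = 0.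
Proof.
move=> u1; have mz := measurable_zpi.
pose f t := (u ^+ 2 - 1) * ((b - 1) * kern (b - 2) c1 c2 u t - nu * kern (b - 2) c2 (- c1) u t) +
  (1 - 2 * b) * u * kern (b - 1) c1 c2 u t + b * kern b c1 c2 u t + nu * kern b c2 (- c1) u t.
have ik p d1 d2 : mu.-integrable zpi (fun t => (kern p d1 d2 u t)%:E) by exact: integrable_kern.
have iz c p d1 d2 := integrable_EFinZ mz c (ik p d1 d2).
have i1 := integrable_EFinB mz (iz (b - 1) (b - 2) c1 c2) (iz nu (b - 2) c2 (- c1)).
have i2 := integrable_EFinZ mz (u ^+ 2 - 1) i1.
have i3 := integrable_EFinD mz i2 (iz ((1 - 2 * b) * u) (b - 1) c1 c2).
have i4 := integrable_EFinD mz i3 (iz b b c1 c2).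
have i5 := integrable_EFinD mz i4 (iz nu b c2 (- c1)).
have : \int[mu]_(t in zpi) f t = 0; last first.
  rewrite /f (RintegralD mz i4 (iz nu b c2 (- c1))) (RintegralD mz i3 (iz b b c1 c2)).
  rewrite (RintegralD mz i2 (iz ((1 - 2 * b) * u) (b - 1) c1 c2)) (RintegralZl _ mz i1).
  rewrite (RintegralB mz (iz (b - 1) (b - 2) c1 c2) (iz nu (b - 2) c2 (- c1))).
  by rewrite !(RintegralZl _ mz (ik _ _ _)).
pose F t := (u + cos t) `^ (b - 1) * (sin t * osc c1 c2 (phase u t)).
apply: (Rintegral_FTC_exhausts (F := F) (f := f) exhausts_0pi).
- move=> t /zpiP t0; have P0 := addcos_gt0 t u1; have s0 := sin_gt0_pi t0.
  have d1 : is_derive t 1 (phase u) (nu * (2 * cos t / sin t + sin t / (u + cos t))).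
    by rewrite /phase; derive_tac => //; field; rewrite !gt_eqF.
  have d2 := is_derive1_compf (is_derive_osc c1 c2 (phase u t)) d1.
  rewrite /F; derive_tac => //; rewrite /f /kern.
  set O := osc c1 c2 _; set L := osc c2 _ _.
  have -> : (u + cos t) `^ b = (u + cos t) `^ (b - 1 - 1) * (u + cos t) ^+ 2.
    rewrite -powR_mulrn ?ltW// -powRDp//; congr powR; ring.
  have -> : (u + cos t) `^ (b - 1) = (u + cos t) `^ (b - 1 - 1) * (u + cos t).
    by rewrite -[X in _ = _ * X]powRr1 ?ltW// -powRDp// subrK.
  have -> : b - 2 = b - 1 - 1 by ring.
  set Q := (u + cos t) `^ (b - 1 - 1).
  have S2 : sin t ^+ 2 = 1 - cos t ^+ 2 by rewrite -(cos2Dsin2 t) addrAC subrr add0r.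
  transitivity (- (b - 1) * Q * sin t ^+ 2 * O + Q * (u + cos t) * cos t * O +
     2 * nu * Q * (u + cos t) * cos t * L + nu * Q * sin t ^+ 2 * L).
    by field; rewrite !gt_eqF.
  by rewrite S2; ring.
- move=> t tz; rewrite /f; have ck p d1 d2 := @continuous_kern_angle p d1 d2 u t u1 tz.
  have cZ c p d1 d2 : {for t, continuous (fun t => c * kern p d1 d2 u t)}.
    by apply: ctpM; [exact: ctp_cst|exact: ck].
  apply: ctpD; last exact: cZ.
  apply: ctpD; last exact: cZ.
  apply: ctpD; last exact: cZ.
  by apply: ctpM; [exact: ctp_cst|apply: ctpB; exact: cZ].
- exact: i5.
(* The primitive is bounded by a multiple of |sin t|, so the boundary terms at 0 and pi vanish. *)
pose M := ((u - 1) `^ (b - 1) + (u + 1) `^ (b - 1)) * (`|c1| + `|c2|).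
have FM t : `|F t| <= M * `|sin t|.
  have -> : F t = kern (b - 1) c1 c2 u t * sin t by rewrite /F /kern; ring.
  by rewrite normrM ler_wpM2r// kern_bound// lexx.
have M0 : 0 <= M by rewrite /M mulr_ge0 ?addr_ge0 ?powR_ge0.
apply/cvgrPdist_le => e e0; have e1 : 0 < e / (2 * (M + 1)) by rewrite divr_gt0// mulr_gt0// ltr_wpDl.
have /cvgrPdist_le/(_ _ e1) := @cvg_natinv R; apply: filterS => k /=.
rewrite !sub0r !normrN => ke.
have sk : `|sin (k.+2%:R^-1 : R)| <= e / (2 * (M + 1)) := le_trans (normr_sin_le _) ke.
have sk' : `|sin (pi - k.+2%:R^-1 : R)| <= e / (2 * (M + 1)).
  by rewrite addrC sinDpi sinN opprK.
rewrite (le_trans (ler_normB _ _))//.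
have Me : M * (e / (2 * (M + 1))) <= e / 2.
  rewrite [leLHS](_ : _ = e / 2 * (M / (M + 1))); last by field; rewrite gt_eqF// ltr_wpDl.
  by rewrite ler_piMr ?divr_ge0 ?(ltW e0)// ler_pdivrMr ?ltr_wpDl// mul1r lerDl.
have -> : e = e / 2 + e / 2 by field.
by apply: lerD; apply: le_trans (FM _) (le_trans _ Me); rewrite ler_wpM2l.
Qed.

Lemma cvg_Rintegral_right (F : R -> R -> R) (G : R -> R) M :
  (forall s, measurable_fun zpi (F s)) ->
  (forall s t, 0 < s <= 1 -> zpi t -> `|F s t| <= M) ->
  (forall t, zpi t -> F s t @[s --> (0 : R)^'+] --> G t) ->
  \int[mu]_(t in zpi) F s t @[s --> (0 : R)^'+] --> \int[mu]_(t in zpi) G t.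
Proof.
move=> mF FM FG; have mz := measurable_zpi; apply/cvg_at_rightP => w [w0 wcvg].
(* Truncation at 1 makes the majorant valid for every k and changes only finitely many terms. *)
pose v k := Num.min (w k) 1.
have v01 k : 0 < v k <= 1 by rewrite lt_min w0 ltr01/= ge_min lexx orbT.
have vw : \forall k \near \oo, w k = v k.
  have /cvgrPdist_lt/(_ _ ltr01) := wcvg; apply: filterS => k.
  rewrite sub0r normrN gtr0_norm// => wk; by rewrite /v minElt wk.
have vcvg : v k @[k --> \oo] --> (0 : R).
  by apply: cvg_trans wcvg; apply: near_eq_cvg; apply: filterS vw => k ->.
have FvG t : zpi t -> F (v k) t @[k --> \oo] --> G t.
  move=> tz; have /cvg_at_rightP := FG t tz; apply; split => // k.
  by have /andP[] := v01 k.
have mG : measurable_fun zpi G.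
  by apply: (measurable_fun_cvg (h := fun k => F (v k))) => // k; exact: mF.
have [] := @dominated_convergence _ _ _ mu zpi mz
  (fun k t => (F (v k) t)%:E) (fun t => (G t)%:E) (fun=> M%:E).
- by move=> k; apply/measurable_EFinP; exact: mF.
- exact/measurable_EFinP.
- by apply: aeW => t tz; apply/fine_cvgP; split; [exact: nearW|exact: FvG].
- exact: integrable_zpi_cst.
- by apply: aeW => t k tz; rewrite lee_fin FM.
move=> iG _; rewrite (fine_integral mz iG) => /fine_cvg c.
apply: cvg_trans c; apply: near_eq_cvg; apply: filterS vw => k wk.
by rewrite /= wk.
Qed.

(** Lowering the exponent by k creates a singularity at t = pi as u tends to 1; the factor s^k tames
    it because s <= 1 + s + cos t. The limit integrand contains 0^k, which separates the cases k = 0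
    and k > 0. *)
Lemma cvg_kint_aux b c1 c2 k : 0 <= b ->
  s ^+ k * kint (b - k%:R) c1 c2 (1 + s) @[s --> (0 : R)^'+] -->
  \int[mu]_(t in zpi) (0 ^+ k * kern (b - k%:R) c1 c2 1 t).
Proof.
move=> b0; have mz := measurable_zpi.
have := @cvg_Rintegral_right (fun s t => s ^+ k * kern (b - k%:R) c1 c2 (1 + s) t)
  (fun t => 0 ^+ k * kern (b - k%:R) c1 c2 1 t) (3 `^ b * (`|c1| + `|c2|)) _ _ _.
move=> H; have {H} H := H _ _ _.
apply: cvg_trans (H _ _ _).
- apply: near_eq_cvg; near=> s; have s0 : 0 < s by [].
  rewrite /kint -RintegralZl//; apply: integrable_kern; by rewrite ltrDl.
- move=> s; apply: measurable_funM => //.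
  exact: measurable_funS (measurableT) (@subsetT _ _) (@measurable_kern _ _ _ _).
- move=> s t /andP[s0 s1] tz; have P1 := addcos1_gt0 tz.
  have P0 : 0 < 1 + s + cos t by rewrite addrAC addr_gt0.
  rewrite /kern mulrA normrM ler_pM ?osc_bound// ger0_norm ?mulr_ge0 ?exprn_ge0 ?powR_ge0 ?(ltW s0)//.
  rewrite powRDp// powRN powR_mulrn ?(ltW P0)// mulrCA -[X in _ <= X]mulr1.
  apply: ler_pM; rewrite ?powR_ge0 ?divr_ge0 ?exprn_ge0 ?(ltW s0) ?(ltW P0)//.
    apply: ler_powR_base => //; first exact: ltW.
    have /andP[_ c1'] := cos_bound t; lra.
  rewrite -expr_div_n exprn_ile1 ?divr_ge0 ?(ltW s0) ?(ltW P0)//.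
  by rewrite ler_pdivrMr// mul1r addrAC lerDr ltW.
- move=> t tz; have P1 := addcos1_gt0 tz.
  apply: cvgM.
    apply: cvg_at_right_filter; have -> : (0 : R) ^+ k = (fun s : R => s ^+ k) 0 by [].
    exact: exprn_continuous.
  apply: cvg_at_right_filter.
  have c : {for (0 : R), continuous (fun s : R => kern (b - k%:R) c1 c2 (1 + s) t)}.
    have := is_derive_continuous (@is_derive_kern (b - k%:R) c1 c2 1 t P1) => ck.
    apply: (ctp_comp (f := fun s : R => 1 + s) (h := fun v => kern (b - k%:R) c1 c2 v t)).
      by apply: ctpD; [exact: ctp_cst|exact: cvg_id].
    by rewrite addr0.
  by move: c; rewrite /prop_for /continuous_at addr0.
Unshelve. all: end_near. Qed.

Lemma cvg_kint b c1 c2 : 0 <= b ->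
  kint b c1 c2 (1 + s) @[s --> (0 : R)^'+] --> kint b c1 c2 1.
Proof.
move=> b0; have := @cvg_kint_aux b c1 c2 0 b0.
under eq_fun do rewrite expr0 mul1r subr0.
by under [X in _ --> X]eq_Rintegral do rewrite expr0 mul1r subr0.
Qed.

Lemma cvg_kint0 b c1 c2 k : 0 <= b -> (0 < k)%N ->
  s ^+ k * kint (b - k%:R) c1 c2 (1 + s) @[s --> (0 : R)^'+] --> (0 : R).
Proof.
move=> b0 k0; have := @cvg_kint_aux b c1 c2 k b0.
rewrite [X in _ --> X](_ : _ = 0)// /Rintegral integral0_eq// => t _.
by rewrite expr0n gtn_eqF// mul0r.
Qed.

End kernel_integral.

(** * The radial profile: its equation and its behaviour at the pole *)

Section radial_profile.
Context {R : realType} (n : nat) (nu c1 c2 : R).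
Hypothesis n2 : (2 < n)%N.
Implicit Types (s u : R).
Local Notation m := (n%:R / 2 - 1 : R).
Local Notation b := ((n%:R - 3) / 2 : R).
Local Notation K j := (kint nu (b - j) c1 c2).
Local Notation L j := (kint nu (b - j) c2 (- c1)).

(** [L j] is [K j] with its coefficient multiplied by i. [J1] and [J2] are the first two derivatives
    of [J]: the factors b - i nu and (b - i nu) (b - 1 - i nu) times integrals of lowered exponent,
    in real form. *)
Let J u := kint nu b c1 c2 u.
Let J1 u := b * K 1 u - nu * L 1 u.
Let J2 u := b * ((b - 1) * K 2 u - nu * L 2 u) -
  nu * ((b - 1) * L 2 u - nu * kint nu (b - 2) (- c1) (- c2) u).

Definition profile s : R := (s * (s + 2)) `^ (- m) * J (1 + s).

Definition profile1 s : R := (s * (s + 2)) `^ (- m) * J1 (1 + s) -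
  m * (2 * (1 + s)) * ((s * (s + 2)) `^ (- m - 1) * J (1 + s)).

Definition profile2 s : R := (s * (s + 2)) `^ (- m) * J2 (1 + s) -
  m * (2 * (2 * (1 + s))) * ((s * (s + 2)) `^ (- m - 1) * J1 (1 + s)) -
  m * 2 * ((s * (s + 2)) `^ (- m - 1) * J (1 + s)) +
  m * (m + 1) * (2 * (1 + s)) ^+ 2 * ((s * (s + 2)) `^ (- m - 2) * J (1 + s)).

Let b0 : 0 <= b.
Proof. by rewrite divr_ge0// subr_ge0 ler_nat. Qed.

Let sub2 (p : R) : p - 2 = p - 1 - 1. Proof. ring. Qed.

Let dJ u : 1 < u -> is_derive u 1 J (J1 u).
Proof. exact: is_derive_kint. Qed.

Let dJ1 u : 1 < u -> is_derive u 1 J1 (J2 u).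
Proof.
move=> u1; have d1 := is_derive_kint nu (b - 1) c1 c2 u1.
have d2 := is_derive_kint nu (b - 1) c2 (- c1) u1.
rewrite /J1; derive_tac; rewrite /J2 !(sub2 b).
move: (kint nu (b - 1 - 1) c1 c2 u) (kint nu (b - 1 - 1) c2 (- c1) u)
  (kint nu (b - 1 - 1) (- c1) (- c2) u) (kint nu (b - 1) c1 c2 u) (kint nu (b - 1) c2 (- c1) u).
by move: ((n%:R - 3) / 2) => B k2 l2 k3 k1 l1; ring.
Qed.

Let cJ2 u : 1 < u -> {for u, continuous J2}.
Proof.
move=> u1; have c p d1 d2 : {for u, continuous (kint nu p d1 d2)}.
  exact: is_derive_continuous (is_derive_kint nu p d1 d2 u1).
have cZ a p d1 d2 : {for u, continuous (fun v => a * kint nu p d1 d2 v)}.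
  by apply: ctpM; [exact: ctp_cst|exact: c].
apply: ctpB; (apply: ctpM; first exact: ctp_cst); apply: ctpB; exact: cZ.
Qed.

Let kintN p u : 1 < u -> kint nu p (- c1) (- c2) u = - kint nu p c1 c2 u.
Proof.
move=> u1; rewrite -[RHS]mulN1r /kint -RintegralZl ?measurable_zpi//; last exact: integrable_kern.
congr fine; apply: eq_integral => t _; congr EFin; rewrite /kern /osc; ring.
Qed.

(** The complex form of [kint_recurrence] multiplied by b - i nu: b times the instance (c1, c2)
    minus nu times the instance (c2, - c1). *)
Let odeJ u : 1 < u -> (u ^+ 2 - 1) * J2 u + (1 - 2 * b) * u * J1 u +
  (b ^+ 2 + nu ^+ 2) * J u = 0.
Proof.
move=> u1; have E1 := kint_recurrence nu b c1 c2 u1.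
have E2 := kint_recurrence nu b c2 (- c1) u1.
have := congr2 (fun x y => b * x - nu * y) E1 E2; rewrite !mulr0 subr0 => <-.
rewrite /J2 /J1 /J (kintN b u1).
move: (K 2 u) (L 2 u) (kint nu (b - 2) _ _ u) (K 1 u) (L 1 u) (kint nu b _ _ u) (kint nu b _ _ u).
by move: ((n%:R - 3) / 2) => B k2 l2 k3 k1 l1 k0 l0; ring.
Qed.

Let w0 s : 0 < s -> 0 < s * (s + 2).
Proof. by move=> s0; rewrite mulr_gt0// addr_gt0. Qed.

Let u1 s : 0 < s -> 1 < 1 + s. Proof. by move=> s0; rewrite ltrDl. Qed.

Lemma is_derive_profile s : 0 < s -> is_derive s 1 profile (profile1 s).
Proof.
move=> s0; have d1 : is_derive s 1 (fun r => J (1 + r)) (J1 (1 + s)).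
  have d : is_derive s 1 (fun r : R => 1 + r) 1 by derive_tac; ring.
  by have := is_derive1_compf (dJ (u1 s0)) d; rewrite mulr1.
by rewrite /profile; derive_tac; [exact: w0|rewrite /profile1; ring].
Qed.

Lemma is_derive_profile1 s : 0 < s -> is_derive s 1 profile1 (profile2 s).
Proof.
move=> s0; have d : is_derive s 1 (fun r : R => 1 + r) 1 by derive_tac; ring.
have d1 : is_derive s 1 (fun r => J (1 + r)) (J1 (1 + s)).
  by have := is_derive1_compf (dJ (u1 s0)) d; rewrite mulr1.
have d2 : is_derive s 1 (fun r => J1 (1 + r)) (J2 (1 + s)).
  by have := is_derive1_compf (dJ1 (u1 s0)) d; rewrite mulr1.
rewrite /profile1; derive_tac; try exact: w0.
by rewrite /profile2 !(sub2 (- m)); ring.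
Qed.

Lemma continuous_profile2 s : 0 < s -> {for s, continuous profile2}.
Proof.
move=> s0; have d : is_derive s 1 (fun r : R => 1 + r) 1 by derive_tac; ring.
have cs : {for s, continuous (fun r : R => 1 + r)} := is_derive_continuous d.
have cw p : {for s, continuous (fun r : R => (r * (r + 2)) `^ p)}.
  by continuous_tac; exact: w0.
have k0 : {for s, continuous (fun r : R => J (1 + r))}.
  exact: ctp_comp cs (is_derive_continuous (dJ (u1 s0))).
have k1 : {for s, continuous (fun r : R => J1 (1 + r))}.
  exact: ctp_comp cs (is_derive_continuous (dJ1 (u1 s0))).
have k2 : {for s, continuous (fun r : R => J2 (1 + r))} by exact: ctp_comp cs (cJ2 (u1 s0)).
have cc a : {for s, continuous (fun=> a : R)} by exact: ctp_cst.
have c2s : {for s, continuous (fun r : R => 2 * (1 + r))} by exact: ctpM.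
apply: ctpD; first (apply: ctpB; first apply: ctpB).
- exact: ctpM (cw _) k2.
- exact: ctpM (ctpM (cc _) (ctpM (cc _) c2s)) (ctpM (cw _) k1).
- exact: ctpM (cc _) (ctpM (cw _) k0).
- exact: ctpM (ctpM (cc _) (@ctpX _ _ _ 2 _ c2s)) (ctpM (cw _) k0).
Qed.

(** Put w = s (s + 2) = u^2 - 1. For h = w^(-m) J the terms in u^2 / w cancel because 2 m + 2 = n;
    the first-order coefficient becomes n - 4 m = 1 - 2 b, and (n - 1)^2 / 4 - 2 m = b^2. This is
    the equation of J. *)
Lemma profile_ode s : 0 < s -> s * (s + 2) * profile2 s + n%:R * (1 + s) * profile1 s +
  ((n%:R - 1) ^+ 2 / 4 + nu ^+ 2) * profile s = 0.
Proof.
move=> s0; have := odeJ (u1 s0); rewrite /profile /profile1 /profile2.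
have ws := w0 s0.
have -> : (s * (s + 2)) `^ (- m) = (s * (s + 2)) `^ (- m - 2) * (s * (s + 2)) ^+ 2.
  by rewrite -powR_mulrn ?(ltW ws)// -powRDp// subrK.
have -> : (s * (s + 2)) `^ (- m - 1) = (s * (s + 2)) `^ (- m - 2) * (s * (s + 2)).
  by rewrite -[X in _ = _ * X]powRr1 ?(ltW ws)// -powRDp//; congr powR; ring.
move: (_ `^ (- m - 2)) (J _) (J1 _) (J2 _) => W A A1 A2 E.
by rewrite -[RHS](mulr0 (W * (s * (s + 2)) ^+ 2)) -E; field.
Qed.

Let at0 (f : R -> R) (l : R) : {for (0 : R), continuous f} -> f 0 = l ->
  f s @[s --> (0 : R)^'+] --> l.
Proof. by move=> cf <-; apply: cvg_at_right_filter; exact: cf. Qed.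

Let pow_split p s : 0 < s -> (s * (s + 2)) `^ (- p) * s `^ p = (s + 2) `^ (- p).
Proof.
move=> s0; rewrite powRM ?(ltW s0) ?addr_ge0 ?(ltW s0)//.
rewrite mulrAC -powRDp// addrC subrr powRr0 mul1r//.
Qed.

Let lim_pow p : (s + 2) `^ p @[s --> (0 : R)^'+] --> 2 `^ p.
Proof.
apply: at0; last by rewrite add0r.
by continuous_tac; rewrite add0r.
Qed.

Let lim_lin : 2 * (1 + s) @[s --> (0 : R)^'+] --> (2 : R).
Proof. by apply: at0; [continuous_tac|rewrite addr0 mulr1]. Qed.

Let lim_id : s @[s --> (0 : R)^'+] --> (0 : R).
Proof. by apply: at0 => //; exact: cvg_id. Qed.

Let limJ : J (1 + s) @[s --> (0 : R)^'+] --> kint nu b c1 c2 1.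
Proof. exact: cvg_kint. Qed.

(** The derivatives of J may be unbounded at u = 1. It is enough that s J1 and s^2 J2 tend to 0,
    since in the limits of the profile they come with just these powers of s. *)
Let limJ1 : s * J1 (1 + s) @[s --> (0 : R)^'+] --> (0 : R).
Proof.
rewrite (_ : (fun s => _) = fun s => b * (s ^+ 1 * kint nu (b - 1%:R) c1 c2 (1 + s)) -
   nu * (s ^+ 1 * kint nu (b - 1%:R) c2 (- c1) (1 + s))); last first.
  by apply/funext => s; rewrite /J1 !expr1; ring.
rewrite [X in _ --> X](_ : _ = b * 0 - nu * 0); last by ring.
by apply: cvgB; apply: cvgM; try exact: cvg_cst; exact: cvg_kint0.
Qed.

Let limJ2 : s ^+ 2 * J2 (1 + s) @[s --> (0 : R)^'+] --> (0 : R).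
Proof.
rewrite (_ : (fun s => _) = fun s => b * (b - 1) * (s ^+ 2 * kint nu (b - 2%:R) c1 c2 (1 + s)) -
   (b * nu + nu * (b - 1)) * (s ^+ 2 * kint nu (b - 2%:R) c2 (- c1) (1 + s)) +
   nu ^+ 2 * (s ^+ 2 * kint nu (b - 2%:R) (- c1) (- c2) (1 + s))); last first.
  by apply/funext => s; rewrite /J2; ring.
rewrite [X in _ --> X](_ : _ = b * (b - 1) * 0 - (b * nu + nu * (b - 1)) * 0 + nu ^+ 2 * 0); last by ring.
by apply: cvgD; [apply: cvgB|]; apply: cvgM; try exact: cvg_cst; exact: cvg_kint0.
Qed.

Definition profile_residue : R := 2 `^ (- m) * kint nu b c1 c2 1.

Let cvg_right (f g : R -> R) (l : R) : (forall s, 0 < s -> f s = g s) ->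
  g s @[s --> (0 : R)^'+] --> l -> f s @[s --> (0 : R)^'+] --> l.
Proof.
move=> fg gl; apply: cvg_trans gl; apply: near_eq_cvg; near=> s; apply/esym/fg; by [].
Unshelve. all: end_near. Qed.

Lemma cvg_profile : profile s * s `^ m @[s --> (0 : R)^'+] --> profile_residue.
Proof.
apply: (cvg_right (g := fun s => (s + 2) `^ (- m) * J (1 + s))).
  by move=> s s0; rewrite /profile mulrAC pow_split.
exact: cvgM.
Qed.

Lemma cvg_profile1 : profile1 s * s `^ (n%:R / 2) @[s --> (0 : R)^'+] --> - m * profile_residue.
Proof.
apply: (cvg_right (g := fun s => (s + 2) `^ (- m) * (s * J1 (1 + s)) -
   m * (2 * (1 + s)) * ((s + 2) `^ (- (m + 1)) * J (1 + s)))).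
  move=> s s0; rewrite /profile1 -!pow_split// -!opprD.
  have -> : s `^ (n%:R / 2) = s `^ (m + 1) by rewrite subrK.
  by rewrite (powRDp m 1 s0) powRr1 ?(ltW s0)//; ring.
rewrite [X in _ --> X](_ : _ = 2 `^ (- m) * 0 - m * 2 * (2 `^ (- (m + 1)) * kint nu b c1 c2 1)); last first.
  rewrite /profile_residue [- (m + 1)]opprD (powRDp (- m) (-1))// powR_inv1//; by field.
apply: cvgB; first exact: cvgM.
apply: cvgM; first by apply: cvgM => //; exact: cvg_cst.
exact: cvgM.
Qed.

Lemma cvg_profile2 :
  profile2 s * s `^ (n%:R / 2 + 1) @[s --> (0 : R)^'+] --> n%:R / 2 * m * profile_residue.
Proof.
apply: (cvg_right (g := fun s => (s + 2) `^ (- m) * (s ^+ 2 * J2 (1 + s)) -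
   m * (2 * (2 * (1 + s))) * ((s + 2) `^ (- (m + 1)) * (s * J1 (1 + s))) -
   m * 2 * ((s + 2) `^ (- (m + 1)) * (s * J (1 + s))) +
   m * (m + 1) * (2 * (1 + s)) ^+ 2 * ((s + 2) `^ (- (m + 2)) * J (1 + s)))).
  move=> s s0; rewrite /profile2 -!pow_split// -!opprD.
  have -> : n%:R / 2 + 1 = m + 2 by field.
  rewrite (powRDp m 1 s0) (powRDp m 2 s0) powRr1 ?(ltW s0)// powR_mulrn ?(ltW s0)//; ring.
rewrite [X in _ --> X](_ : _ = 2 `^ (- m) * 0 - m * (2 * 2) * (2 `^ (- (m + 1)) * 0) -
   m * 2 * (2 `^ (- (m + 1)) * (0 * kint nu b c1 c2 1)) +
   m * (m + 1) * 2 ^+ 2 * (2 `^ (- (m + 2)) * kint nu b c1 c2 1)); last first.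
  rewrite /profile_residue [- (m + 2)]opprD (powRDp (- m) (- 2))// [2 `^ (- 2)]powRN powR_mulrn//.
  by field.
have cM (a : R) (f : R -> R) l : f s @[s --> (0 : R)^'+] --> l -> a * f s @[s --> (0 : R)^'+] --> a * l.
  by move=> fl; apply: cvgM => //; exact: cvg_cst.
apply: cvgD; first (apply: cvgB; first apply: cvgB).
- exact: cvgM.
- apply: cvgM; last exact: cvgM.
  by apply: (cM); exact: (cM).
- by apply: (cM); apply: cvgM => //; exact: cvgM.
- apply: cvgM; last exact: cvgM.
  by apply: (cM); rewrite !expr2; under eq_fun do rewrite expr2; exact: cvgM.
Qed.

End radial_profile.

(** * Identification of the Green kernel *)

Section residue.
Context {R : realType} (n : nat) (nu : R).
Hypothesis n2 : (2 < n)%N.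
Local Notation mu := (@lebesgue_measure R).
Local Notation pos := (`]0%R, +oo[%classic : set R).
Local Notation zpi := (`]0%R, pi[%classic : set R).
Local Notation m := (n%:R / 2 - 1 : R).
Local Notation b := ((n%:R - 3) / 2 : R).
Implicit Types (p u s t : R).

Lemma n_bounds : 0 <= b /\ 2^-1 <= m.
Proof.
have n3 : 3 <= n%:R :> R by rewrite ler_nat.
by split; [rewrite divr_ge0// subr_ge0|lra].
Qed.

Lemma Rintegral_zpi (f g : R -> R) : measurable_fun zpi g ->
  (forall t, zpi t -> f t = g t) ->
  \int[mu]_(t in `[0%R, pi]) f t = \int[mu]_(t in zpi) g t.
Proof.
move=> mg fg; have mf : measurable_fun zpi (EFin \o f).
  apply/measurable_EFinP; apply: eq_measurable_fun mg => t; rewrite inE => tz.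
  by rewrite fg.
have mf' : measurable_fun `[0, pi[ (EFin \o f).
  rewrite -(setU1itv false) ?bnd_simp ?pi_gt0//.
  by apply/measurable_funU => //; split=> //; exact: measurable_fun_set1.
congr fine; rewrite -integral_itv_bndo_bndc// -integral_itv_obnd_cbnd//.
by apply: eq_integral => t; rewrite inE => tz; rewrite fg.
Qed.

Lemma cexpE (x y : R) : cexp (Complex x y) = Complex (expR x * cos y) (expR x * sin y).
Proof. by rewrite /cexp/=; apply/eqP; rewrite eq_complex/= !mul0r subr0 addr0 !eqxx. Qed.

Lemma cpowE (a x y : R) : 0 < a ->
  cpow a (Complex x y) = Complex (a `^ x * cos (y * ln a)) (a `^ x * sin (y * ln a)).
Proof.
move=> a0; rewrite /cpow.
have -> : Complex x y * (Complex (ln a) 0) = Complex (x * ln a) (y * ln a).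
  by apply/eqP; rewrite eq_complex/= !mulr0 subr0 add0r !eqxx.
by rewrite cexpE /powR gt_eqF.
Qed.

Lemma cGammaE p : 0 < p -> cGamma (Complex p nu) = Complex (gph p nu 0) (gph p nu (- (pi / 2))).
Proof.
move=> p0; rewrite /cGamma /cintegral.
have H (f : R -> R) th :
    (forall t, pos t -> f t = t `^ (p - 1) * expR (- t) * cos (nu * ln t + th)) ->
    \int[mu]_(t in pos) f t = gph p nu th.
  by move=> fE; congr fine; apply: eq_integral => t; rewrite inE => tp; rewrite fE.
have E t : pos t -> cpow t (Complex p nu - 1) * Complex (expR (- t)) 0 =
   Complex (t `^ (p - 1) * expR (- t) * cos (nu * ln t + 0))
     (t `^ (p - 1) * expR (- t) * cos (nu * ln t + - (pi / 2))).
  move=> /posP t0; have -> : Complex p nu - 1 = Complex (p - 1) nu.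
    by apply/eqP; rewrite eq_complex/= subr0 !eqxx.
  rewrite cpowE//; apply/eqP; rewrite eq_complex/= !mulr0 subr0 add0r addr0 cosBpihalf.
  by apply/andP; split; apply/eqP; ring.
by congr Complex; apply: H => t tp; rewrite (E t tp).
Qed.

(** Real form of the beta integral B(m, 1/2 + i nu): the coefficients (1, 0) and (0, 1) give its
    real and imaginary parts. *)
Definition hcos_osc c1 c2 : R :=
  \int[mu]_(t in zpi) (hcos2 t `^ b * osc c1 c2 (nu * ln (hsin2 t))).

Lemma integrable_hcos_osc c1 c2 :
  mu.-integrable zpi (fun t => (hcos2 t `^ b * osc c1 c2 (nu * ln (hsin2 t)))%:E).
Proof.
have [b0 _] := n_bounds.
have ms : measurable_fun [set: R] (@hsin2 R).
  rewrite (_ : @hsin2 R = fun t => 1 - hcos2 t); last by apply/funext => t; rewrite /hsin2 /hcos2; field.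
  by apply: measurable_funB => //; exact: measurable_hcos2.
apply: (integrable_zpi_bounded (M := 1 * (`|c1| + `|c2|))).
  apply: (measurable_funS (E := setT)) => //; apply: measurable_funM.
    exact: (measurableT_comp (f := fun v : R => v `^ b) (@measurable_powR _ _) measurable_hcos2).
  apply: (measurableT_comp (@measurable_osc R c1 c2)); apply: measurable_funM => //.
  exact: (measurableT_comp (f := @ln R) (@measurable_ln R) ms).
move=> t tz; rewrite normrM ler_pM ?osc_bound// ger0_norm ?powR_ge0//.
have /andP[h0 h1] := @hcos2_le1 R t.
have b1 : 1 `^ b = 1 :> R by rewrite powR1.
by rewrite -[leRHS]b1 ler_powR_base.
Qed.

Lemma hcos_oscE c1 c2 : hcos_osc c1 c2 = c1 * hcos_osc 1 0 + c2 * hcos_osc 0 1.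
Proof.
have mz := @measurable_zpi R; rewrite /hcos_osc.
rewrite -(RintegralZl _ mz (integrable_hcos_osc 1 0)) -(RintegralZl _ mz (integrable_hcos_osc 0 1)).
rewrite -RintegralD//; last 2 first.
- exact: (integrable_EFinZ (m := mu) mz c1 (integrable_hcos_osc 1 0)).
- exact: (integrable_EFinZ (m := mu) mz c2 (integrable_hcos_osc 0 1)).
by congr fine; apply: eq_integral => t _; congr EFin; rewrite /osc; ring.
Qed.

Lemma beta_hcos_osc th : gph m 0 0 * gph 2^-1 nu th =
  hcos_osc (gph (m + 2^-1) nu th) (- gph (m + 2^-1) nu (th - pi / 2)).
Proof.
have [_ m2] := n_bounds; have m0 : 0 < m by rewrite (lt_le_trans _ m2).
rewrite beta_gph//; congr fine; apply: eq_integral => t _; congr EFin.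
have -> : m - 2^-1 = b by field.
have mp : 0 < m + 2^-1 by lra.
by rewrite [_ + th]addrC (gphD nu th (nu * ln (hsin2 t)) mp) /osc; ring.
Qed.

(** Half angles: 1 + cos t = 2 cos^2 (t / 2) and sin^2 t / (1 + cos t) = 2 sin^2 (t / 2). The
    integral is 2^(b + i nu) times the beta integral, and the factor 2^(i nu) rotates the
    coefficients. *)
Lemma kint_at1 c1 c2 : kint nu b c1 c2 1 = 2 `^ b *
  hcos_osc (c1 * cos (nu * ln 2) + c2 * sin (nu * ln 2))
           (c2 * cos (nu * ln 2) - c1 * sin (nu * ln 2)).
Proof.
rewrite /hcos_osc -RintegralZl ?measurable_zpi//; last exact: integrable_hcos_osc.
congr fine; apply: eq_integral => t; rewrite inE => /zpiP t0; congr EFin.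
have c0 := hcos2_gt0 t0; have s0 := hsin2_gt0 t0; have st := sin_gt0_pi t0.
rewrite /kern; have -> : 1 + cos t = 2 * hcos2 t by rewrite /hcos2; field.
rewrite powRM ?(ltW c0)// -mulrA; congr (_ * (_ * _)).
have -> : phase nu 1 t = nu * ln 2 + nu * ln (hsin2 t).
  rewrite /phase -mulrDr; congr (_ * _).
  have -> : 1 + cos t = 2 * hcos2 t by rewrite /hcos2; field.
  have -> : 2 * ln (sin t) = ln (sin t ^+ 2) by rewrite lnXn// mulr_natl.
  have -> : sin t ^+ 2 = 2 * hcos2 t * (2 * hsin2 t).
    have := cos2Dsin2 t; rewrite /hcos2 /hsin2 => h.
    by rewrite -[LHS](addrK (cos t ^+ 2)) [sin t ^+ 2 + _]addrC h; field.
  have -> : ln (2 * hcos2 t * (2 * hsin2 t)) = ln (2 * hcos2 t) + ln (2 * hsin2 t).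
    by rewrite lnM// posrE mulr_gt0.
  by rewrite addrAC subrr add0r lnM// posrE.
by rewrite /osc cosD sinD; ring.
Qed.

Lemma divfK_swap (F : fieldType) (c g e g2 : F) : e != 0 -> g2 != 0 ->
  c * (g / (e * g2)) * (g2 * e) = c * g.
Proof. by move=> e0 g0; field; rewrite e0 g0. Qed.

Lemma mulr_eq_swap (F : fieldType) (x y z e k g c l : F) : y != 0 ->
  x * (y * (z * e)) = c * g -> l * y = g * k -> x * (z * (e * k)) = c * l.
Proof.
move=> y0 E B; apply: (mulfI y0).
transitivity (x * (y * (z * e)) * k); first by ring.
by rewrite E -mulrA -B; ring.
Qed.

(** The definition of A with its denominator cleared, where (n - 1) / 2 = m + 1/2; here Gamma(1/2 +
    i nu) <> 0 is needed. *)
Lemma Acoef_eq : let A := Acoef n (Complex 0 nu) in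
  A * (Complex (gph 2^-1 nu 0) (gph 2^-1 nu (- (pi / 2))) *
    Complex (2 `^ 2^-1 * cos (nu * ln 2)) (2 `^ 2^-1 * sin (nu * ln 2))) =
  Complex ((2 * pi) `^ (- (n%:R / 2))) 0 *
  Complex (gph (m + 2^-1) nu 0) (gph (m + 2^-1) nu (- (pi / 2))).
Proof.
have [_ m2] := n_bounds; have m0 : 0 < m by rewrite (lt_le_trans _ m2).
rewrite /= /Acoef.
have -> : (Complex ((n%:R - 1) / 2) 0 + Complex 0 nu : R[i]) = Complex (m + 2^-1) nu.
  by apply/eqP; rewrite eq_complex/= add0r addr0 eqxx andbT; apply/eqP; field.
have -> : (Complex 0 nu + Complex 2^-1 0 : R[i]) = Complex 2^-1 nu.
  by apply/eqP; rewrite eq_complex/= add0r addr0 !eqxx.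
have mp : 0 < m + 2^-1 by lra.
rewrite !cGammaE ?invr_gt0// cpowE//.
set cc := Complex _ 0; have -> : ((2 * pi) `^ (- (n%:R / 2)))%:C%C = cc by [].
move: cc => cc; set E := Complex (_ * cos _) _.
have g20 : Complex (gph 2^-1 nu 0) (gph 2^-1 nu (- (pi / 2))) != 0.
  apply/eqP => -[h1 h2]; exact: (@gph_neq0 R 2^-1 nu).
have E0 : E != 0.
  apply/eqP => -[/eqP h1 /eqP h2]; move: h1 h2.
  rewrite !mulf_eq0 gt_eqF ?powR_gt0//= => /eqP h1 /eqP h2.
  by have /eqP := cos2Dsin2 (nu * ln 2 : R); rewrite h1 h2 expr0n addr0 eq_sym oner_eq0.
exact: divfK_swap.
Qed.

(** Let B be the beta integral. [Acoef_eq] together with Gamma(m) Gamma(1/2 + i nu) = Gamma(m + 1/2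
    + i nu) B eliminates the complex Gamma values and leaves A 2^(i nu) B = 2^(-1/2) (2 pi)^(-n/2)
    Gamma(m). The right-hand side is real, so the imaginary profile has residue 0; the other factor
    2^(-1/2) in k is 2^(b - m). *)
Lemma residue_eq : let A := Acoef n (Complex 0 nu) in
  let k := 2^-1 * (2 * pi) `^ (- (n%:R / 2)) * gph m 0 0 in
  profile_residue n nu (complex.Re A) (- complex.Im A) = k /\
  profile_residue n nu (complex.Im A) (complex.Re A) = 0.
Proof.
have [_ m2] := n_bounds; have m0 : 0 < m by rewrite (lt_le_trans _ m2).
have AE := Acoef_eq; move: (Acoef n _) AE => A AE /= .
set k := 2^-1 * _ * _; pose I := Complex (hcos_osc 1 0) (hcos_osc 0 1).
pose e := Complex (cos (nu * ln 2)) (sin (nu * ln 2)).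
pose g := Complex (gph (m + 2^-1) nu 0) (gph (m + 2^-1) nu (- (pi / 2))).
pose g2 := Complex (gph 2^-1 nu 0) (gph 2^-1 nu (- (pi / 2))).
have B : Complex (gph m 0 0) 0 * g2 = g * I.
  apply/eqP; rewrite eq_complex/= !mul0r subr0 addr0 !beta_hcos_osc.
  rewrite hcos_oscE [X in _ && (X == _)]hcos_oscE add0r.
  have -> : - (pi / 2) - pi / 2 = 0 - pi :> R by field.
  have mp : 0 < m + 2^-1 by lra.
  by rewrite gphDpi// opprK; apply/andP; split; apply/eqP; ring.
pose r := 2 `^ 2^-1 : R.
have r0 : 0 < r by rewrite powR_gt0.
have E1 : Complex (r * cos (nu * ln 2)) (r * sin (nu * ln 2)) = Complex r 0 * e.
  by apply/eqP; rewrite eq_complex/= !mul0r subr0 addr0 !eqxx.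
pose c := (2 * pi) `^ (- (n%:R / 2)) : R.
have {}AE : A * (g2 * (Complex r 0 * e)) = Complex c 0 * g by rewrite -E1.
have g20 : g2 != 0 by apply/eqP => -[h1 h2]; exact: (@gph_neq0 R 2^-1 nu).
have K : A * (Complex r 0 * (e * I)) = Complex c 0 * Complex (gph m 0 0) 0.
  exact: mulr_eq_swap AE B.
have h2 : 2^-1 + 2^-1 = 1 :> R by field.
have rr : r * r = 2 by rewrite -powRDp// h2 powRr1.
have K2 : A * (e * I) = Complex (r^-1 * c * gph m 0 0) 0.
  have rc0 : Complex r 0 != 0 by apply/eqP => -[h]; rewrite h ltxx in r0.
  apply: (mulfI rc0); transitivity (A * (Complex r 0 * (e * I))); first by ring.
  rewrite K; apply/eqP; rewrite eq_complex/= !(mul0r, mulr0) !subr0 addr0 eqxx andbT.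
  by apply/eqP; field; rewrite gt_eqF.
have P c1 c2 : profile_residue n nu c1 c2 = r^-1 *
   ((c1 * cos (nu * ln 2) + c2 * sin (nu * ln 2)) * hcos_osc 1 0 +
    (c2 * cos (nu * ln 2) - c1 * sin (nu * ln 2)) * hcos_osc 0 1).
  rewrite /profile_residue kint_at1 hcos_oscE mulrA; congr (_ * _).
  by rewrite -powRDp// /r -powRN; congr powR; field.
case: A {AE K} K2 => Ar Ai K2 /=.
have KR := congr1 (@complex.Re R) K2; have KI := congr1 (@complex.Im R) K2.
rewrite /= in KR KI.
split.
  rewrite P (_ : k = r^-1 * (r^-1 * c * gph m 0 0)); last first.
    by rewrite /k /c -rr; field; rewrite gt_eqF.
  by rewrite -KR; congr (_ * _); ring.
by rewrite P -[RHS](mulr0 r^-1) -[in RHS]KI; congr (_ * _); ring.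
Qed.

(* At s = 0 both sides vanish, because 0 `^ p = 0 for p <> 0 and 0^-1 = 0. *)
Lemma greenE s : 0 <= s -> let A := Acoef n (Complex 0 nu) in
  green n (Complex 0 nu) (acosh (1 + s)) =
  Complex (profile n nu (complex.Re A) (- complex.Im A) s)
          (profile n nu (complex.Im A) (complex.Re A) s).
Proof.
have [b0 m2] := n_bounds; have m0 : 0 < m by rewrite (lt_le_trans _ m2).
move=> s0 A; have s1 : 1 <= 1 + s by rewrite lerDl.
rewrite /green acoshK// sinh_acosh//.
have -> : (1 + s) ^+ 2 - 1 = s * (s + 2) by ring.
have shp : Num.sqrt (s * (s + 2)) ^+ (n - 2) = (s * (s + 2)) `^ m.
  have w0 : 0 <= s * (s + 2) by rewrite mulr_ge0// addr_ge0.
  rewrite -powR12_sqrt// -powR_mulrn ?powR_ge0// -powRrM; congr powR.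
  by rewrite natrB ?(ltnW n2)//; field.
rewrite shp.
move: s0; rewrite le_eqVlt => /orP[/eqP <-|s0].
  have z p : p != 0 -> (0 * (0 + 2)) `^ p = 0 :> R by move=> p0; rewrite mul0r powR0.
  rewrite /profile (z m) ?gt_eqF// (z (- m)) ?oppr_eq0 ?gt_eqF// !mul0r.
  by rewrite (_ : Complex 0 0 = 0)// invr0 mulr0 mulr0 mul0r.
set u := 1 + s; have u1 : 1 < u by rewrite ltrDl.
have u0 : 0 < u by rewrite (lt_trans ltr01).
have wE : Complex b 0 - Complex 0 nu = Complex b (- nu).
  by apply/eqP; rewrite eq_complex/= subr0 add0r !eqxx.
have zE : 2 * Complex 0 nu = Complex 0 (2 * nu) :> R[i].
  by apply/eqP; rewrite eq_complex/= ; apply/andP; split; apply/eqP; ring.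
rewrite wE zE cpowE//.
pose ps t := - nu * ln (1 + cos t / u) + 2 * nu * ln (sin t).
pose G c1 c2 t := (1 + cos t / u) `^ b * osc c1 c2 (ps t).
have P0 t : 0 < 1 + cos t / u.
  have -> : 1 + cos t / u = (u + cos t) / u by field; rewrite gt_eqF.
  by rewrite divr_gt0// addcos_gt0.
have uP t : u * (1 + cos t / u) = u + cos t by field; rewrite gt_eqF.
have GE t : zpi t -> cpow (1 + cos t / u) (Complex b (- nu)) * cpow (sin t) (Complex 0 (2 * nu)) =
    Complex (G 1 0 t) (G 0 1 t).
  move=> /zpiP t0; rewrite !cpowE ?sin_gt0_pi// powRr0.
  by apply/eqP; rewrite eq_complex/= /G /osc /ps cosD sinD; apply/andP; split; apply/eqP; ring.
have mG c1 c2 : measurable_fun [set: R] (G c1 c2).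
  have m1 : measurable_fun [set: R] (fun t : R => 1 + cos t / u).
    apply: measurable_funD => //; apply: measurable_funM => //.
    exact: continuous_measurable_fun (@continuous_cos R).
  apply: measurable_funM.
    exact: (measurableT_comp (f := fun v : R => v `^ b) (@measurable_powR _ _)).
  apply: (measurableT_comp (@measurable_osc R c1 c2)); apply: measurable_funD.
    apply: measurable_funM => //; exact: (measurableT_comp (f := @ln R) (@measurable_ln R)).
  apply: measurable_funM => //; apply: (measurableT_comp (f := @ln R) (@measurable_ln R)).
  exact: continuous_measurable_fun (@continuous_sin R).
have mGz c1 c2 : measurable_fun zpi (G c1 c2) by exact: measurable_funS (mG c1 c2).
rewrite /cintegral.
rewrite (@Rintegral_zpi _ (G 1 0))//; last by move=> t tz; rewrite (GE t tz).
rewrite (@Rintegral_zpi _ (G 0 1))//; last by move=> t tz; rewrite (GE t tz).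
(* The phase of the prefactor u^(b - i nu), which recombines with 1 + cos t / u into u + cos t. *)
set al := - nu * ln u.
have iG c1 c2 : mu.-integrable zpi (fun t => (G c1 c2 t)%:E).
  apply: (integrable_zpi_bounded (M := 2 `^ b * (`|c1| + `|c2|))) => // t _.
  rewrite normrM ler_pM ?osc_bound// ger0_norm ?powR_ge0// ler_powR_base ?(ltW (P0 t))//.
  have -> : 2 = 1 + 1 :> R by [].
  have /andP[_ ct] := @cos_bound R t.
  by rewrite lerD2l ler_pdivrMr// mul1r (le_trans ct)// ltW.
have kE c1 c2 : kint nu b c1 c2 u = u `^ b *
   ((c1 * cos al + c2 * sin al) * \int[mu]_(t in zpi) G 1 0 t +
    (c2 * cos al - c1 * sin al) * \int[mu]_(t in zpi) G 0 1 t).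
  have mz := @measurable_zpi R.
  rewrite -(RintegralZl _ mz (iG 1 0)) -(RintegralZl _ mz (iG 0 1)).
  have i1 p q c := integrable_EFinZ mz c (iG p q).
  rewrite -(RintegralD mz (i1 _ _ _) (i1 _ _ _)) -RintegralZl//; last first.
    exact: (integrable_EFinD (m := mu) mz (i1 _ _ _) (i1 _ _ _)).
  congr fine; apply: eq_integral => t _; congr EFin; rewrite /kern /G -uP powRM ?(ltW u0) ?(ltW (P0 t))//.
  have -> : phase nu u t = al + ps t.
    by rewrite /phase -uP lnM ?posrE// /al /ps; ring.
  by rewrite /osc; move: (ps t) al (_ `^ b) => q a P; rewrite cosD sinD; ring.
have V : (Complex ((s * (s + 2)) `^ m) 0)^-1 = Complex ((s * (s + 2)) `^ (- m)) 0 :> R[i].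
  have wm : (s * (s + 2)) `^ m != 0 by rewrite gt_eqF// powR_gt0// mulr_gt0// addr_gt0.
  rewrite powRN; apply: (mulfI (x := Complex ((s * (s + 2)) `^ m) 0)).
    by apply/eqP => -[h]; rewrite h eqxx in wm.
  rewrite divff; last by apply/eqP => -[h]; rewrite h eqxx in wm.
  by apply/eqP; rewrite eq_complex/= !(mulr0, mul0r) subr0 addr0 divff// !eqxx.
rewrite V /profile -/u !kE /A; case: (Acoef n (Complex 0 nu)) => Ar Ai /=.
move: (_ `^ (- m)) (u `^ b) (cos al) (sin al) (\int[mu]_(t in zpi) G 1 0 t) (\int[mu]_(t in zpi) G 0 1 t) => a1 a2 a3 a4 a5 a6.
by apply/eqP; rewrite eq_complex/=; apply/andP; split; apply/eqP; ring.
Qed.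

End residue.

Lemma hgapC {R : realType} {n : nat} (x y : 'rV[R]_n) : hgap x y = hgap y x.
Proof. by rewrite hgapE /hgap [(1 - dotv x x) * _]mulrC. Qed.

Lemma acosh_lt {R : realType} (u v : R) : 1 <= u -> u < v -> acosh u < acosh v.
Proof.
move=> u1 uv; have v1 : 1 <= v by rewrite (le_trans u1)// ltW.
rewrite /acosh ltr_ln ?posrE ?acosh_arg_gt0// ltr_leD// ler_sqrt ?sqr_subr1_ge0//.
by rewrite lerD2r ler_pXn2r ?nnegrE ?(le_trans ler01 u1) ?(le_trans ler01 v1)// ltW.
Qed.

(** * The Green kernel: the delta equation and the decay *)

Section green_kernel.
Context {R : realType} {n : nat} (nu : R).
Hypothesis n2 : (2 < n)%N.
Local Notation mT := (measurableTypeR R).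
Local Notation lam := (@lebesgue_tuple R).
Local Notation mu1 := (@lebesgue_measure R).
Local Notation zpi := (`]0%R, pi[%classic : set R).
Local Notation m := (n%:R / 2 - 1 : R).
Local Notation b := ((n%:R - 3) / 2 : R).
Implicit Types (x y : 'rV[R]_n) (F : 'rV[R]_n -> R[i]).

Definition ball_tuples : set (n.-tuple mT) := @row_of R n @^-1` uball.

Lemma measurable_ball_tuples : measurable ball_tuples.
Proof.
have -> : ball_tuples = setT `&` (fun t => dotv (row_of t - 0) (row_of t - 0)) @^-1` `]-oo, 1[%classic.
  by apply/seteqP; split => t; rewrite /ball_tuples /= uballE subr0 in_itv/=; [split|case].
by apply: (@measurable_dotv_row R n 0) => //; exact: measurable_itv.
Qed.

Lemma Rintegral_support (g : n.-tuple mT -> R) : (forall t, ~ ball_tuples t -> g t = 0) ->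
  \int[lam n]_(t in ball_tuples) g t = \int[lam n]_t g t.
Proof.
move=> g0; congr fine; rewrite integral_mkcond; apply: eq_integral => t _.
by rewrite patchE; case: ifPn => // /negP tB; rewrite g0// => tB'; apply: tB; rewrite inE.
Qed.

(** Writing the kernel as hr + i hi and the test function as p1 + i p2 leaves four real integrals:
    hr reproduces the values of p1 and p2 at x, and hi gives 0. The parameter enters the operator
    only through nu^2, so both signs are covered. *)
Lemma solves_delta_green mu x F : nu ^+ 2 = mu ^+ 2 -> uball x ->
  (forall y, uball y -> F y = green n (Complex 0 nu) (acosh (1 + hgap x y))) ->
  solves_delta mu x F.
Proof.
move=> numu xb FE phi [s1 s2 [K [cK KB phi0]]] f.
have [_ m2] := @n_bounds R n n2; have m0 : 0 < m by rewrite (lt_le_trans _ m2).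
pose A := Acoef n (Complex 0 nu).
have [res1 res2] := residue_eq nu n2; rewrite -/A in res1 res2.
pose hr := profile n nu (complex.Re A) (- complex.Im A).
pose hi := profile n nu (complex.Im A) (complex.Re A).
pose la := (n%:R - 1) ^+ 2 / 4 + nu ^+ 2.
pose p1 y := complex.Re (phi y); pose p2 y := complex.Im (phi y).
have p10 y : ~ K y -> p1 y = 0 by move=> /phi0; rewrite /p1 => ->.
have p20 y : ~ K y -> p2 y = 0 by move=> /phi0; rewrite /p2 => ->.
have ps c1 c2 p : smooth p -> (forall y, ~ K y -> p y = 0) ->
    (lam n).-integrable setT (fun t => (profile n nu c1 c2 (hgap x (row_of t)) * helm la p (row_of t))%:E) /\
    \int[lam n]_t (profile n nu c1 c2 (hgap x (row_of t)) * helm la p (row_of t)) =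
      2 * (2 * pi) `^ (n%:R / 2) / gph m 0 0 * profile_residue n nu c1 c2 * p x.
  move=> sp p0; apply: (@integral_point_source R n (profile n nu c1 c2) (profile1 n nu c1 c2)
    (profile2 n nu c1 c2) la (profile_residue n nu c1 c2) n2 _ _ _ _ _ _ _ K p x) => //.
  - by move=> s s0; exact: is_derive_profile.
  - by move=> s s0; exact: is_derive_profile1.
  - by move=> s s0; exact: continuous_profile2.
  - by move=> s s0; exact: profile_ode.
  - exact: cvg_profile.
  - exact: cvg_profile1.
  - exact: cvg_profile2.
have c1 : 2 * (2 * pi) `^ (n%:R / 2) / gph m 0 0 *
    (2^-1 * (2 * pi) `^ (- (n%:R / 2)) * gph m 0 0) = 1 :> R.
  have G0 := gph0_gt0 m0.
  have P0 : 0 < (2 * pi) `^ (n%:R / 2) :> R by rewrite powR_gt0// mulr_gt0// pi_gt0.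
  by rewrite powRN; field; rewrite !gt_eqF.
have val1 p : smooth p -> (forall y, ~ K y -> p y = 0) ->
    \int[lam n]_t (hr (hgap x (row_of t)) * helm la p (row_of t)) = p x.
  by move=> sp p0; rewrite (ps _ _ p sp p0).2 res1 c1 mul1r.
have val0 p : smooth p -> (forall y, ~ K y -> p y = 0) ->
    \int[lam n]_t (hi (hgap x (row_of t)) * helm la p (row_of t)) = 0.
  by move=> sp p0; rewrite (ps _ _ p sp p0).2 res2 mulr0 mul0r.
have int_r p sp p0 := (ps (complex.Re A) (- complex.Im A) p sp p0).1.
have int_i p sp p0 := (ps (complex.Im A) (complex.Re A) p sp p0).1.
pose fr t := hr (hgap x (row_of t)) * helm la p1 (row_of t) - hi (hgap x (row_of t)) * helm la p2 (row_of t).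
pose fi t := hr (hgap x (row_of t)) * helm la p2 (row_of t) + hi (hgap x (row_of t)) * helm la p1 (row_of t).
have fE t : ball_tuples t -> f t = Complex (fr t) (fi t).
  move=> tB; rewrite /f FE// greenE ?hgap_ge0// -/A -/hr -/hi -mulrA.
  have -> : helmholtz mu phi (row_of t) * (dV (row_of t))%:C%C =
     Complex (helm la p1 (row_of t)) (helm la p2 (row_of t)).
    rewrite /helmholtz /claplaceB -/p1 -/p2 -numu /helm /la.
    move: (laplaceB p1 _) (laplaceB p2 _) (dV _) => l1 l2 v; rewrite /p1 /p2.
    case: (phi (row_of t)) => z1 z2; apply/eqP; rewrite eq_complex/=.
    by apply/andP; split; apply/eqP; ring.
  by apply/eqP; rewrite eq_complex/= /fr /fi; apply/andP; split; apply/eqP; ring.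
have mD := measurable_ball_tuples.
have i11 := int_r _ s1 p10; have i22 := int_i _ s2 p20.
have i12 := int_r _ s2 p20; have i21 := int_i _ s1 p10.
have ifr : (lam n).-integrable setT (fun t => (fr t)%:E).
  exact: (integrable_EFinB (m := lam n) measurableT i11 i22).
have ifi : (lam n).-integrable setT (fun t => (fi t)%:E).
  exact: (integrable_EFinD (m := lam n) measurableT i12 i21).
have out t : ~ ball_tuples t -> helm la p1 (row_of t) = 0 /\ helm la p2 (row_of t) = 0.
  move=> tB; have tK : ~ K (row_of t) by move=> /KB.
  by split; apply: (helm_outside _ cK).
split; first split.
- apply: (eq_integrable mD (fun t => (fr t)%:E)); last exact: integrableS ifr.
  by move=> t; rewrite inE => tB; rewrite fE.
- apply: (eq_integrable mD (fun t => (fi t)%:E)); last exact: integrableS ifi.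
  by move=> t; rewrite inE => tB; rewrite fE.
rewrite /cintegral -/ball_tuples.
have -> : \int[lam n]_(t in ball_tuples) complex.Re (f t) = \int[lam n]_(t in ball_tuples) fr t.
  by congr fine; apply: eq_integral => t; rewrite inE => tB; rewrite fE.
have -> : \int[lam n]_(t in ball_tuples) complex.Im (f t) = \int[lam n]_(t in ball_tuples) fi t.
  by congr fine; apply: eq_integral => t; rewrite inE => tB; rewrite fE.
rewrite !Rintegral_support; last 2 first.
- by move=> t /out [z1 z2]; rewrite /fi z1 z2 !mulr0 addr0.
- by move=> t /out [z1 z2]; rewrite /fr z1 z2 !mulr0 subr0.
rewrite (RintegralB measurableT i11 i22) (RintegralD measurableT i12 i21).
rewrite -/hr -/hi (val1 _ s1 p10) (val0 _ s2 p20) (val1 _ s2 p20) (val0 _ s1 p10) subr0 addr0.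
by rewrite /p1 /p2; case: (phi x).
Qed.

(** The oscillating factor is bounded, and 0 < u + cos t <= u + 1 with b >= 0. *)
Lemma kint_growth c1 c2 : exists2 C, 0 <= C &
  forall u, 1 < u -> `|kint nu b c1 c2 u| <= C * (u + 1) `^ b.
Proof.
have [b0 _] := @n_bounds R n n2; have mz := @measurable_zpi R.
pose V := \int[mu1]_(t in zpi) (`|c1| + `|c2|).
exists V; first by apply: Rintegral_ge0 => t _; rewrite addr_ge0.
move=> u u1; have ik := integrable_kern nu b c1 c2 u1.
have iV := integrable_zpi_cst (`|c1| + `|c2|).
apply: le_trans (le_normr_Rintegral mz ik) _.
have -> : V * (u + 1) `^ b = \int[mu1]_(t in zpi) ((u + 1) `^ b * (`|c1| + `|c2|)).
  by rewrite RintegralZl// mulrC.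
apply: le_Rintegral => //.
- exact: integrable_norm ik.
- exact: (integrable_EFinZ (m := mu1) mz _ iV).
move=> t tz; rewrite /kern normrM ler_pM ?osc_bound// ger0_norm ?powR_ge0//.
apply: ler_powR_base => //; first exact: ltW (addcos_gt0 _ u1).
by rewrite lerD2l cos_le1.
Qed.

(** The exponents add up to - 2 m + b = - (n - 1) / 2; the constant 3^b comes from s + 2 <= 3 s. *)
Lemma profile_decay c1 c2 : exists2 C, 0 <= C &
  forall s, 1 <= s -> `|profile n nu c1 c2 s| <= C * s `^ (- ((n%:R - 1) / 2)).
Proof.
have [b0 m2] := @n_bounds R n n2; have m0 : 0 < m by rewrite (lt_le_trans _ m2).
have [C C0 Cb] := kint_growth c1 c2; exists (C * 3 `^ b); first by rewrite mulr_ge0// powR_ge0.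
move=> s s1; have s0 : 0 < s by rewrite (lt_le_trans _ s1).
rewrite /profile normrM ger0_norm ?powR_ge0//.
have H1 : (s * (s + 2)) `^ (- m) <= s `^ (- m) * s `^ (- m).
  rewrite -powRM ?(ltW s0)// !powRN lef_pV2 ?posrE ?powR_gt0 ?mulr_gt0 ?addr_gt0//.
  by apply: ler_powR_base; rewrite ?(ltW m0) ?mulr_ge0 ?(ltW s0)// ler_wpM2l ?(ltW s0)// lerDl.
have H2 : `|kint nu b c1 c2 (1 + s)| <= C * (3 `^ b * s `^ b).
  have us : 1 < 1 + s by rewrite ltrDl.
  rewrite (le_trans (Cb _ us))// ler_wpM2l// -powRM ?(ltW s0)//.
  by apply: ler_powR_base => //; lra.
apply: le_trans (ler_pM _ _ H1 H2) _; rewrite ?powR_ge0//.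
have -> : - ((n%:R - 1) / 2) = - m + - m + b by field.
by rewrite !powRDp// le_eqVlt; apply/orP; left; apply/eqP; ring.
Qed.

(** The quotient of the gaps from y to x and to 0 is |y - x|^2 / (|y|^2 (1 - |x|^2)), hence at least
    |y - x|^2. Once |y| >= (1 + |x|) / 2, one has |y - x| >= (1 - |x|) / 2. *)
Lemma hgap_compare x : uball x -> exists c T, [/\ 0 < c, 1 <= T &
  forall y, uball y -> T <= hgap y 0 -> c * hgap y 0 <= hgap x y /\ 1 <= hgap x y].
Proof.
move=> xb; have X0 := uball_gt0 xb.
pose al := Num.sqrt (dotv x x).
have al0 : 0 <= al by exact: sqrtr_ge0.
have al2 : al ^+ 2 = dotv x x by rewrite sqr_sqrtr// dotv_ge0.
have al1 : al < 1 by rewrite /al -enormE.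
pose c := ((1 - al) / 2) ^+ 2; pose c1 := ((1 + al) / 2) ^+ 2.
have c0 : 0 < c by rewrite exprn_gt0// divr_gt0// subr_gt0.
have c11 : c1 < 1.
  rewrite expr_lte1//; last by rewrite divr_ge0// addr_ge0.
  by rewrite ltr_pdivrMr// mul1r; lra.
have c10 : 0 <= c1 by rewrite sqr_ge0.
(* The last summand is the gap from 0 at radius (1 + |x|) / 2; the summand 1 / c forces the gap from
   x to be at least 1. *)
exists c, (1 + c^-1 + 2 * c1 / (1 - c1)); split=> //.
  rewrite -addrA lerDl addr_ge0 ?invr_ge0 ?(ltW c0)//.
  by rewrite divr_ge0 ?subr_ge0 ?(ltW c11)// mulr_ge0.
move=> y yb; have Y0 := uball_gt0 yb.
have gE : hgap y 0 = 2 * dotv y y / (1 - dotv y y).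
  by rewrite /hgap subr0 dotv0 subr0 mulr1.
set T := 1 + _ + _ => Ty.
have d0 : 0 <= 2 * c1 / (1 - c1) by rewrite divr_ge0 ?subr_ge0 ?(ltW c11)// mulr_ge0.
have cy : c1 <= dotv y y.
  have : 2 * c1 / (1 - c1) <= 2 * dotv y y / (1 - dotv y y).
    by rewrite -gE (le_trans _ Ty)// /T lerDr addr_ge0// invr_ge0 ltW.
  rewrite ler_pdivrMr ?subr_gt0// mulrAC ler_pdivlMr//.
  nra.
have g0 : 0 <= hgap y 0 by rewrite gE divr_ge0 ?mulr_ge0 ?dotv_ge0 ?(ltW Y0).
have key : c * hgap y 0 <= hgap x y.
  rewrite gE hgapE.
  have N : c <= dotv (y - x) (y - x).
    pose ga := Num.sqrt (dotv y y).
    have ga2 : ga ^+ 2 = dotv y y by rewrite sqr_sqrtr// dotv_ge0.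
    have ga0 : 0 <= ga by exact: sqrtr_ge0.
    have gac : (1 + al) / 2 <= ga.
      rewrite -(@ler_pXn2r _ 2)// ?nnegrE//; last by rewrite divr_ge0// addr_ge0.
      by rewrite ga2.
    have cs : dotv y x <= ga * al.
      apply: le_trans (ler_norm _) _.
      rewrite -(@ler_pXn2r _ 2)// ?nnegrE ?mulr_ge0// real_normK ?num_real//.
      by rewrite exprMn ga2 al2 dotv_cauchy.
    have -> : dotv (y - x) (y - x) = ga ^+ 2 + al ^+ 2 - 2 * dotv y x.
      by rewrite ga2 al2 !dotvE [dotv x y]dotvC; ring.
    apply: (@le_trans _ _ ((ga - al) ^+ 2)); last by rewrite sqrrB; lra.
    rewrite /c ler_pXn2r ?nnegrE//; lra.
  have -> : c * (2 * dotv y y / (1 - dotv y y)) =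
      2 * (c * (dotv y y * (1 - dotv x x))) / ((1 - dotv x x) * (1 - dotv y y)).
    by field; rewrite !gt_eqF.
  rewrite ler_wpM2r ?invr_ge0 ?mulr_ge0 ?(ltW X0) ?(ltW Y0)// ler_wpM2l//.
  apply: le_trans N; rewrite ler_piMr ?(ltW c0)// mulr_ile1 ?dotv_ge0 ?(ltW X0)//.
    by rewrite ltW// -subr_gt0.
  by rewrite gerBl dotv_ge0.
split=> //; apply: le_trans key.
by rewrite -ler_pdivrMl// mulr1 (le_trans _ Ty)// /T addrAC lerDr addr_ge0.
Qed.

Lemma sinh_decay_green x F : uball x ->
  (forall y, uball y -> F y = green n (Complex 0 nu) (acosh (1 + hgap x y))) ->
  sinh_decay F.
Proof.
move=> xb FE; pose A := Acoef n (Complex 0 nu).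
have [b0 m2] := @n_bounds R n n2.
pose q : R := (n%:R - 1) / 2.
have q0 : 0 <= q by rewrite /q; lra.
have [C1 C10 Cb1] := profile_decay (complex.Re A) (- complex.Im A).
have [C2 C20 Cb2] := profile_decay (complex.Im A) (complex.Re A).
have [c [T [c0 T1 cT]]] := hgap_compare xb.
(* For s >= 1 one has sinh rho = sqrt (s (s + 2)) <= 2 s, so c / 2 times sinh rho(y, 0) is at most
   the gap from x. *)
exists ((C1 + C2) * (c / 2) `^ (- q)), (acosh (1 + T)) => y yb.
have u0 : @uball R n 0 by rewrite uballE dotv0 ltr01.
have g0 := hgap_ge0 yb u0.
rewrite hdistE// => dy.
have Ty : T <= hgap y 0.
  rewrite leNgt; apply/negP => yT; move: dy; apply/negP; rewrite -ltNge.
  by apply: acosh_lt; [rewrite lerDl|rewrite ltrD2l].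
have [cg g1] := cT y yb Ty; have s1 : 1 <= hgap y 0 := le_trans T1 Ty.
rewrite FE// greenE ?hgap_ge0// -/A.
have -> : ComplexField.Normc.normc (Complex (profile n nu (complex.Re A) (- complex.Im A) (hgap x y))
   (profile n nu (complex.Im A) (complex.Re A) (hgap x y))) =
   Num.sqrt (profile n nu (complex.Re A) (- complex.Im A) (hgap x y) ^+ 2 +
     profile n nu (complex.Im A) (complex.Re A) (hgap x y) ^+ 2) by [].
have normle (a d : R) : Num.sqrt (a ^+ 2 + d ^+ 2) <= `|a| + `|d|.
  rewrite -(@ler_pXn2r _ 2)// ?nnegrE ?sqrtr_ge0 ?addr_ge0// sqr_sqrtr ?addr_ge0 ?sqr_ge0//.
  by rewrite sqrrD !real_normK ?num_real// lerD2r lerDl mulrn_wge0// mulr_ge0.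
apply: le_trans (normle _ _) _; apply: le_trans (lerD (Cb1 _ g1) (Cb2 _ g1)) _.
rewrite -mulrDl -mulrA ler_wpM2l ?addr_ge0// sinh_acosh ?lerDl//.
have -> : (1 + hgap y 0) ^+ 2 - 1 = hgap y 0 * (hgap y 0 + 2) by ring.
set s := hgap y 0 in g0 s1 cg *; have s0 : 0 < s by rewrite (lt_le_trans _ s1).
have w0 : 0 < Num.sqrt (s * (s + 2)) by rewrite sqrtr_gt0 mulr_gt0// addr_gt0.
rewrite -powRM ?divr_ge0 ?(ltW c0) ?(ltW w0)// !powRN.
have cw : 0 < c / 2 * Num.sqrt (s * (s + 2)) by rewrite !mulr_gt0 ?invr_gt0.
have g10 : 0 < hgap x y by rewrite (lt_le_trans _ g1).
rewrite lef_pV2 ?posrE ?powR_gt0//; apply: ler_powR_base => //; first exact: ltW.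
apply: le_trans cg; rewrite -mulrA ler_wpM2l ?(ltW c0)// mulrC ler_pdivrMr//.
have ws : 0 <= s * (s + 2) by rewrite mulr_ge0// addr_ge0.
have s20 : 0 <= s * 2 by rewrite mulr_ge0.
have w0' := ltW w0.
by rewrite -(@ler_pXn2r _ 2)// ?nnegrE// sqr_sqrtr//; nra.
Qed.

End green_kernel.

Local Open Scope complex_scope.

Theorem theorem4p1 (R : realType) (n : nat) (mu : R)
    (hn : (3 <= n)%N) (hmu : 0 < mu) :
  let Gm (r : R) := green n (0 -i* mu) r in
  let Gp (r : R) := green n (0 +i* mu) r in
  [/\ solves_delta mu 0 (fun x : 'rV[R]_n => Gm (hdist x 0)),
      sinh_decay (fun x : 'rV[R]_n => Gm (hdist x 0)) &
      forall x : 'rV[R]_n, uball x ->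
        [/\ solves_delta mu x (fun y => Gm (hdist x y)),
            solves_delta mu x (fun y => Gp (hdist x y)),
            sinh_decay (fun y => Gm (hdist x y)) &
            sinh_decay (fun y => Gp (hdist x y))]].
Proof.
move=> Gm Gp; have sq : (- mu) ^+ 2 = mu ^+ 2 by exact: sqrrN.
have u0 : @uball R n 0 by rewrite uballE dotv0 ltr01.
have E0 (y : 'rV[R]_n) : uball y -> Gm (hdist y 0) = green n (0 -i* mu) (acosh (1 + hgap 0 y)).
  by move=> yb; rewrite hgapC -hdistE.
split.
- exact: (solves_delta_green hn sq u0 E0).
- exact: (sinh_decay_green hn u0 E0).
move=> x xb.
have Em (y : 'rV[R]_n) : uball y -> Gm (hdist x y) = green n (0 -i* mu) (acosh (1 + hgap x y)).
  by move=> yb; rewrite hdistE.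
have Ep (y : 'rV[R]_n) : uball y -> Gp (hdist x y) = green n (0 +i* mu) (acosh (1 + hgap x y)).
  by move=> yb; rewrite hdistE.
split.
- exact: (solves_delta_green hn sq xb Em).
- exact: (solves_delta_green hn erefl xb Ep).
- exact: (sinh_decay_green hn xb Em).
- exact: (sinh_decay_green hn xb Ep).
Qed.
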